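(* Let $d\ge 2$, let $\mathbf{X}=(X_1,\dots,X_d)$ be a random vector with continuous marginal distribution functions $F_1,\dots,F_d$ and copula $C$, and let $(X_{i,1},\dots,X_{i,d})$, $i=1,\dots,n$, be $n$ independent copies of $\mathbf{X}$. Suppose that for each $j\in\{1,\dots,d\}$ the partial derivative $\partial C/\partial u_j$ exists and is continuous on the set $V_j:=\{\mathbf{u}\in[0,1]^d: 0<u_j<1\}$. Let $w:[0,1]^d\to\mathbb{R}$ be any bounded, non-negative, integrable function. Then, under mutual independence of $X_1,\dots,X_d$, the statistic $$W_n = n\int_{[0,1]^d}\Big(C_n(\mathbf{u})-\prod_{j=1}^d u_j\Big)^2 w(\mathbf{u})\,d\mathbf{u}$$ converges in distribution, as $n\to\infty$, to $$W=\int_{[0,1]^d}\mathcal{M}(\mathbf{u})^2\,w(\mathbf{u})\,d\mathbf{u}.$$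
   Context: $\mathbb{I}$ denotes the indicator function. The empirical marginal distribution functions are $\hat F_j(x)=\frac1n\sum_{i=1}^n\mathbb{I}(X_{i,j}\le x)$, $x\in\mathbb{R}$, $j=1,\dots,d$, and the empirical copula is $$C_n(\mathbf{u})=\frac1n\sum_{i=1}^n\prod_{j=1}^d\mathbb{I}\big[\hat F_j(X_{i,j})\le u_j\big],\qquad \mathbf{u}\in[0,1]^d.$$ The copula $C$ of $\mathbf{X}$ is the function $C:[0,1]^d\to[0,1]$ with $F(x_1,\dots,x_d)=C[F_1(x_1),\dots,F_d(x_d)]$ for all $(x_1,\dots,x_d)\in\mathbb{R}^d$, where $F$ is the joint distribution function of $\mathbf{X}$ (unique since the marginals are continuous). The process $\mathcal{M}$ is the tight centred Gaussian process on $[0,1]^d$ defined by $$\mathcal{M}(\mathbf{u})=\mathcal{B}(\mathbf{u})-\sum_{i=1}^d\Big(\prod_{j=1,\,j\ne i}^d u_j\Big)\mathcal{B}(1,\dots,1,u_i,1,\dots,1),\qquad\mathbf{u}\in[0,1]^d,$$ where $u_i$ is in the $i$-th position and $\mathcal{B}$ is a multivariate tied-down Brownian bridge on $[0,1]^d$, i.e. a tight centred Gaussian process with covariance function $$E[\mathcal{B}(\mathbf{u})\mathcal{B}(\mathbf{u}')]=\prod_{j=1}^d\min\{u_j,u_j'\}-\prod_{j=1}^d u_ju_j'.$$ *)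

(* Defs.v *)
From HB Require Import structures.
From mathcomp Require Import all_boot all_order all_algebra.
From mathcomp Require Import all_classical all_reals all_analysis.

Set Implicit Arguments.
Unset Strict Implicit.
Unset Printing Implicit Defensive.

Import Order.TTheory GRing.Theory Num.Theory.
Import numFieldNormedType.Exports.

Local Open Scope classical_set_scope.
Local Open Scope ring_scope.

(* Points of R^d are tuples [d.-tuple R], which carry the product
   sigma-algebra; coordinates are numbered from 0. *)

Definition unit_cube (R : realType) (d : nat) : set (d.-tuple R) :=
  [set u | forall j : 'I_d, 0 <= tnth u j <= 1].

Definition set_coord (R : realType) (d : nat) (u : d.-tuple R) (j : 'I_d)
    (x : R) : d.-tuple R :=
  [tuple if k == j then x else tnth u k | k < d].

Definition ones (R : realType) (d : nat) : d.-tuple R := [tuple 1 | _ < d].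

Definition prod_coords (R : realType) (d : nat) (u : d.-tuple R) : R :=
  \prod_(j < d) tnth u j.

Definition tuple_coord (R : realType) (d : nat) (j : 'I_d) : d.-tuple R -> R :=
  fun u => tnth u j.

HB.instance Definition _ (R : realType) (d : nat) (j : 'I_d) :=
  isMeasurableFun.Build _ _ (d.-tuple R) R (@tuple_coord R d j)
    (measurable_tnth (T := R) j).

(* The library's Lebesgue measure lives on [measurableTypeR R], an alias of [R]
   with the same Borel sigma-algebra under another display. *)
Definition tuple_cons (R : realType) (d : nat)
    (p : measurableTypeR R * d.-tuple R) : d.+1.-tuple R :=
  [the d.+1.-tuple R of (p.1 : R) :: p.2].

Lemma measurable_tuple_cons (R : realType) (d : nat) :
  measurable_fun setT (@tuple_cons R d).
Proof.
apply: (@measurable_cons _ _ _ R (fun p => p.1 : R) d (fun p => p.2)).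
- by move=> mD Y mY; exact: (@measurable_fst _ _ (measurableTypeR R) _ mD Y mY).
- exact: measurable_snd.
Qed.

Definition lebesgue_cons (R : realType) (d : nat)
    (m : {measure set (d.-tuple R) -> \bar R}) : set (d.+1.-tuple R) -> \bar R :=
  pushforward (@lebesgue_measure R \x^ m)%E (@tuple_cons R d).

HB.instance Definition _ (R : realType) (d : nat)
    (m : {measure set (d.-tuple R) -> \bar R}) :=
  Measure.copy (lebesgue_cons m)
    (measure_function_pushforward__canonical__measure_function_Measure
       (@lebesgue_measure R \x^ m)%E (@measurable_tuple_cons R d)).

Fixpoint lebesgue_tuple (R : realType) (d : nat) :
    {measure set (d.-tuple R) -> \bar R} :=
  match d with
  | 0 => dirac ([tuple] : 0.-tuple R)
  | d'.+1 => lebesgue_cons (lebesgue_tuple R d')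
  end.

Lemma measurable_box (R : realType) (d : nat) (A : 'I_d -> set R) :
  (forall j, measurable (A j)) ->
  measurable [set u : d.-tuple R | forall j, A j (tnth u j)].
Proof.
move=> mA.
rewrite (_ : [set u | _] =
  \bigcap_(j in [set: 'I_d]) (@tuple_coord R d j @^-1` A j)).
  apply: fin_bigcap_measurable => [|j _]; first exact: finite_finset.
  by rewrite -[X in measurable X]setTI;
    exact: (measurable_funPT (@tuple_coord R d j)).
by apply/seteqP; split => u /= h j => [_|]; exact: (h j).
Qed.

Lemma lebesgue_tuple_box (R : realType) (d : nat) (A : 'I_d -> set R) :
  (forall j, measurable (A j)) ->
  lebesgue_tuple R d [set u | forall j, A j (tnth u j)] =
  (\prod_(j < d) lebesgue_measure (A j))%E.
Proof.
elim: d A => [|d IH] A mA.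
  by rewrite big_ord0 /= diracE mem_set// => -[].
rewrite big_ord_recl /= /lebesgue_cons /pushforward.
rewrite (_ : _ @^-1` _ = (A ord0 : set (measurableTypeR R)) `*`
  [set u : d.-tuple R | forall j, A (lift ord0 j) (tnth u j)]).
  rewrite product_measure2E.
  - by congr (_ * _)%E; apply: (IH (fun j => A (lift ord0 j))).
  - exact: (mA ord0).
  - by apply: (measurable_box (d := d) (A := fun j => A (lift ord0 j))).
apply/seteqP; split => -[x u] /=.
  move=> h; split; first by have := h ord0; rewrite tnth0.
  by move=> j; have := h (lift ord0 j); rewrite tnthS.
move=> [h0 h] j; have [->|[k ->]] : j = ord0 \/ exists k, j = lift ord0 k.
  by case: (unliftP ord0 j) => [k ->|->]; [right; exists k|left].
  by rewrite tnth0.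
by rewrite tnthS; exact: h.
Qed.

(* Lebesgue (rather than only Borel) integrability: almost everywhere equal to
   an integrable function that is measurable for the Borel sigma-algebra. On a
   non-negative such function, the library's integral, a supremum over
   measurable simple minorants, is the Lebesgue integral. *)
Definition lebesgue_integrable (R : realType) (d : nat) (D : set (d.-tuple R))
    (f : d.-tuple R -> R) : Prop :=
  exists g : d.-tuple R -> R,
    (lebesgue_tuple R d).-integrable D (EFin \o g) /\
    {ae lebesgue_tuple R d, forall u, D u -> f u = g u}.

Definition mutually_independent (disp : measure_display)
    (T : measurableType disp) (R : realType) (P : probability T R)
    (I : choiceType) (disp' : measure_display) (T' : measurableType disp')
    (X : I -> T -> T') : Prop :=
  forall (s : seq I) (A : I -> set T'), uniq s ->
    (forall i, i \in s -> measurable (A i)) ->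
    P (\bigcap_(i in [set` s]) (X i @^-1` A i)) =
    (\prod_(i <- s) P (X i @^-1` A i))%E.

Definition same_distribution (disp1 disp2 disp' : measure_display)
    (T1 : measurableType disp1) (T2 : measurableType disp2)
    (T' : measurableType disp') (R : realType)
    (P1 : probability T1 R) (P2 : probability T2 R)
    (X1 : {RV P1 >-> T'}) (X2 : {RV P2 >-> T'}) : Prop :=
  forall A : set T', measurable A -> distribution P1 X1 A = distribution P2 X2 A.

Definition marginal_cdf (disp : measure_display) (T : measurableType disp)
    (R : realType) (P : probability T R) (d : nat) (X : {RV P >-> d.-tuple R})
    (j : 'I_d) (x : R) : R :=
  fine (cdf ((@tuple_coord R d j \o X : {mfun T >-> R}) : {RV P >-> R}) x).

Definition joint_cdf (disp : measure_display) (T : measurableType disp)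
    (R : realType) (P : probability T R) (d : nat) (X : {RV P >-> d.-tuple R})
    (x : d.-tuple R) : R :=
  fine (distribution P X [set y | forall j : 'I_d, tnth y j <= tnth x j]).

(* Convergence in distribution of real random variables, possibly defined on
   different probability spaces. *)
Definition cvg_in_distribution (disp disp' : measure_display)
    (T : measurableType disp) (T' : measurableType disp') (R : realType)
    (P : probability T R) (P' : probability T' R)
    (Y : nat -> T -> R) (Z : T' -> R) : Prop :=
  [/\ forall n, measurable_fun setT (Y n),
      measurable_fun setT Z &
      forall f : R -> R, continuous f -> [bounded f x | x in setT] ->
        ('E_P[f \o Y n] @[n --> \oo] --> 'E_P'[f \o Z])%E].

(* Only the values of [C] on the unit cube are meaningful. *)
Definition is_copula_of (disp : measure_display) (T : measurableType disp)
    (R : realType) (P : probability T R) (d : nat) (X : {RV P >-> d.-tuple R})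
    (C : d.-tuple R -> R) : Prop :=
  (forall u, @unit_cube R d u -> 0 <= C u <= 1) /\
  forall x : d.-tuple R,
    joint_cdf X x = C [tuple marginal_cdf X j (tnth x j) | j < d].

Definition open_coord_cube (R : realType) (d : nat) (j : 'I_d) :
    set (d.-tuple R) :=
  [set u | @unit_cube R d u /\ 0 < tnth u j < 1].

Definition partial (R : realType) (d : nat) (C : d.-tuple R -> R) (j : 'I_d)
    (u : d.-tuple R) : R :=
  derive1 (fun x : R => C (set_coord u j x)) (tnth u j).

Definition has_partial (R : realType) (d : nat) (C : d.-tuple R -> R)
    (j : 'I_d) (u : d.-tuple R) : Prop :=
  derivable (fun x : R => C (set_coord u j x)) (tnth u j) 1.

Definition tuple_of_row (R : realType) (d : nat) (v : 'rV[R]_d) : d.-tuple R :=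
  [tuple v ord0 j | j < d].

(* Tuples carry no topology in the library, hence the detour through row
   vectors to express continuity. *)
Definition has_continuous_partial (R : realType) (d : nat)
    (C : d.-tuple R -> R) (j : 'I_d) : Prop :=
  (forall u, @open_coord_cube R d j u -> has_partial C j u) /\
  {within (@tuple_of_row R d @^-1` @open_coord_cube R d j),
    continuous (partial C j \o @tuple_of_row R d)}.

Definition empirical_cdf (R : realType) (d n : nat) (x : 'I_n -> d.-tuple R)
    (j : 'I_d) (y : R) : R :=
  n%:R^-1 * \sum_(i < n) (tnth (x i) j <= y)%R%:R.

Definition empirical_copula (R : realType) (d n : nat)
    (x : 'I_n -> d.-tuple R) (u : d.-tuple R) : R :=
  n%:R^-1 * \sum_(i < n) \prod_(j < d)
    (empirical_cdf x j (tnth (x i) j) <= tnth u j)%R%:R.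

Definition independence_statistic (R : realType) (d n : nat)
    (w : d.-tuple R -> R) (x : 'I_n -> d.-tuple R) : R :=
  n%:R * \int[lebesgue_tuple R d]_(u in @unit_cube R d)
    ((empirical_copula x u - prod_coords u) ^+ 2 * w u).

(* [normal_prob m 0] is not the Dirac mass at [m], hence the case analysis. *)
Definition is_gaussian (disp : measure_display) (T : measurableType disp)
    (R : realType) (P : probability T R) (Y : T -> R) : Prop :=
  measurable_fun setT Y /\
  exists m s : R, forall A : set R, measurable A ->
    P (Y @^-1` A) = if s == 0 then \d_m A else normal_prob m s A.

Definition gaussian_process (disp : measure_display) (T : measurableType disp)
    (R : realType) (P : probability T R) (d : nat) (B : T -> d.-tuple R -> R) :
    Prop :=
  forall (n : nat) (a : 'I_n -> R) (u : 'I_n -> d.-tuple R),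
    (forall k, @unit_cube R d (u k)) ->
    is_gaussian P (fun t => \sum_(k < n) a k * B t (u k)).

Definition centred (disp : measure_display) (T : measurableType disp)
    (R : realType) (P : probability T R) (d : nat) (B : T -> d.-tuple R -> R) :
    Prop :=
  forall u, @unit_cube R d u -> 'E_P[fun t => B t u]%E = 0%E.

(* Tightness as a Borel random element of the space of bounded functions on the
   unit cube with the supremum norm. Values outside the cube are ignored by
   the topology, which is therefore not separated, whence [closed K]. *)
Definition tight_process (disp : measure_display) (T : measurableType disp)
    (R : realType) (P : probability T R) (d : nat) (B : T -> d.-tuple R -> R) :
    Prop :=
  [/\ forall t, [bounded B t u | u in @unit_cube R d],
      forall U : set {uniform` @unit_cube R d -> R}, open U ->
        measurable (B @^-1` U) &
      forall e : R, 0 < e ->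
        exists K : set {uniform` @unit_cube R d -> R},
          [/\ compact K, closed K & ((1 - e)%:E <= P (B @^-1` K))%E]].

Definition tied_down_brownian_bridge (disp : measure_display)
    (T : measurableType disp) (R : realType) (P : probability T R) (d : nat)
    (B : T -> d.-tuple R -> R) : Prop :=
  [/\ tight_process P B, gaussian_process P B, centred P B &
      forall u v, @unit_cube R d u -> @unit_cube R d v ->
        'E_P[(fun t => B t u * B t v)%R]%E =
        (\prod_(j < d) Num.min (tnth u j) (tnth v j) -
         \prod_(j < d) (tnth u j * tnth v j))%:E].

Definition limit_process (R : realType) (d : nat) (b : d.-tuple R -> R)
    (u : d.-tuple R) : R :=
  b u - \sum_(i < d)
    (\prod_(j < d | j != i) tnth u j) * b (set_coord (@ones R d) i (tnth u i)).

Definition limit_statistic (R : realType) (d : nat) (w b : d.-tuple R -> R) :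
    R :=
  \int[lebesgue_tuple R d]_(u in @unit_cube R d)
    (limit_process b u ^+ 2 * w u).

(* Main.v *)
Require Import Defs.
From HB Require Import structures.
From mathcomp Require Import all_boot all_order all_algebra.
From mathcomp Require Import all_classical all_reals all_analysis.
From mathcomp Require Import perm measurable_realfun.
From mathcomp Require Import ring lra.

Import Order.TTheory GRing.Theory Num.Theory.
Import numFieldNormedType.Exports.

Local Open Scope classical_set_scope.
Local Open Scope ring_scope.

Set Implicit Arguments.
Unset Strict Implicit.
Unset Printing Implicit Defensive.

(** The statistic depends on the sample only through ranks. Write [p] for a point
    of the unit cube and [F j] for the marginal distribution functions, and let
    [beta_n] be the empirical process of the vectors with coordinates
    [F j (X_ij)], whose coordinates are independent and uniform under the
    hypothesis of independence. Let [M] be the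
    linear map [limit_process], so that the limit statistic is the weighted
    integral of [(M B) ^ 2].

    - Rank approximation ([rank_process_approx_at]). In
      [sqrt n * (C_n p - \prod_j p_j)] the indicators compare ranks with
      [n * p_j]. Expanding the products of indicators around [p], the
      first-order terms are nearly constant since ranks are a permutation of
      [1, ..., n], and [M beta_n] is what remains of [beta_n] once its own
      first-order terms are removed. The difference of the two higher-order
      remainders is a sum of terms with two small factors in different
      coordinates. As coordinates are independent and exchangeable over the
      sample, its second moment is of order [n ^ (- 1 / 2)], uniformly in [p]
      ([decoupled_second_moment]).

    - Limit of quadratic forms ([quadratic_form_cvg]). The central limit theorem
      in characteristic form ([clt_cos]) says that linear forms in finitely many
      values of [beta_n] converge to Gaussian ones, whose characteristic
      functions are those of the bridge, since the covariances agree
      ([empirical_cos_cvg], [bridge_cos]). Writing [exp (- c x ^ 2)] as a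
      Gaussian average of [cos (sqrt (2 c) z x)] transfers this to Laplace
      transforms of nonnegative quadratic forms, in particular of Riemann sums
      of the integral of [(M beta_n) ^ 2].

    - Discretization. On the sample side the second moments of the increments
      of [M beta_n] are bounded by the distance, so Riemann sums are close to
      the statistic uniformly in [n] ([empirical_limit_increment],
      [statistic_laplace]). On the limit side the same covariance bound and
      tightness yield equicontinuity in probability ([tight_equicontinuity]):
      up to small probability the paths lie in a compact set, hence follow
      finitely many profiles that are nearly constant on finitely many cells,
      and cells with points arbitrarily close to each other cannot be separated
      by a jump of the bridge. This gives [bridge_discretization]. Paths of
      [B] may be non-measurable functions on the cube; then the integral is a
      supremum over simple minorants, which is still Lipschitz for the supremum
      norm ([expect_dist_le]), and this also makes the limit statistic a random
      variable.

    - Conclusion. Together these steps give convergence of the Laplace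
      transforms [E exp (- k W_n)] at all natural [k], which implies convergence
      in distribution for nonnegative variables
      ([laplace_cvg_in_distribution]): up to a tail that the Laplace transforms
      control, a bounded continuous function of [x] is a continuous function of
      [exp (- x)], hence a uniform limit of polynomials in [exp (- x)]. *)

(** * Expectations of bounded measurable functions *)

Definition bounded_measurable {disp : measure_display} {T : measurableType disp}
    {R : realType} (f : T -> R) : Prop :=
  measurable_fun setT f /\ exists M : R, forall t, `|f t| <= M.

Definition expect {disp : measure_display} {T : measurableType disp}
    {R : realType} (P : probability T R) (f : T -> R) : R :=
  \int[P]_t f t.

Section bounded_measurable_theory.
Context {disp : measure_display} {T : measurableType disp} {R : realType}.
Implicit Types (f g : T -> R) (P : probability T R).

Lemma bm_cst (c : R) : bounded_measurable (fun _ : T => c).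
Proof. by split; [exact: measurable_cst | exists `|c|]. Qed.

Lemma bmD f g : bounded_measurable f -> bounded_measurable g ->
  bounded_measurable (fun t => f t + g t).
Proof.
move=> [mf [M fM]] [mg [N gN]]; split; first exact: measurable_funD.
by exists (M + N) => t; rewrite (le_trans (ler_normD _ _))// lerD.
Qed.

Lemma bmM f g : bounded_measurable f -> bounded_measurable g ->
  bounded_measurable (fun t => f t * g t).
Proof.
move=> [mf [M fM]] [mg [N gN]]; split; first exact: measurable_funM.
by exists (M * N) => t; rewrite normrM ler_pM.
Qed.

Lemma bmN f : bounded_measurable f -> bounded_measurable (fun t => - f t).
Proof.
move=> [mf [M fM]]; split; first exact: measurableT_comp.
by exists M => t; rewrite normrN.
Qed.

Lemma bmB f g : bounded_measurable f -> bounded_measurable g ->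
  bounded_measurable (fun t => f t - g t).
Proof. by move=> bf bg; apply: bmD => //; exact: bmN. Qed.

Lemma bmZ (c : R) f : bounded_measurable f ->
  bounded_measurable (fun t => c * f t).
Proof. by move=> bf; apply: bmM => //; exact: bm_cst. Qed.

Lemma bmX f (k : nat) : bounded_measurable f ->
  bounded_measurable (fun t => f t ^+ k).
Proof.
move=> bf; elim: k => [|k IH]; first by under eq_fun do rewrite expr0; exact: bm_cst.
by under eq_fun do rewrite exprS; exact: bmM.
Qed.

Lemma bm_sum (I : Type) (s : seq I) (p : pred I) (h : I -> T -> R) :
  (forall i, p i -> bounded_measurable (h i)) ->
  bounded_measurable (fun t => \sum_(i <- s | p i) h i t).
Proof.
move=> bh; elim: s => [|i s IH].
  by under eq_fun do rewrite big_nil; exact: bm_cst.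
under eq_fun do rewrite big_cons.
by case E : (p i) => //; apply: bmD => //; exact: bh.
Qed.

Lemma bm_prod (I : Type) (s : seq I) (p : pred I) (h : I -> T -> R) :
  (forall i, p i -> bounded_measurable (h i)) ->
  bounded_measurable (fun t => \prod_(i <- s | p i) h i t).
Proof.
move=> bh; elim: s => [|i s IH].
  by under eq_fun do rewrite big_nil; exact: bm_cst.
under eq_fun do rewrite big_cons.
by case E : (p i) => //; apply: bmM => //; exact: bh.
Qed.

Lemma bm_norm f : bounded_measurable f -> bounded_measurable (fun t => `|f t|).
Proof.
move=> [mf [M fM]]; split; first exact: measurableT_comp.
by exists M => t; rewrite normr_id.
Qed.

Lemma bm_bool (b : T -> bool) : measurable_fun setT b ->
  bounded_measurable (fun t => (b t)%:R : R).
Proof.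
move=> mb; split; last by exists 1 => t; case: (b t); rewrite ?normr1 ?normr0.
rewrite (_ : (fun t => _) = (fun t => if b t then 1 else 0)).
  exact: measurable_fun_ifT.
by apply/funext => t; case: (b t).
Qed.

Lemma bm_comp {disp' : measure_display} {T' : measurableType disp'}
    (f : T' -> R) (g : T -> T') : measurable_fun setT g ->
  bounded_measurable f -> bounded_measurable (fun t => f (g t)).
Proof.
move=> mg [mf [M fM]]; split; first exact: (measurableT_comp mf).
by exists M => t; exact: fM.
Qed.

Lemma bm_cos f : measurable_fun setT f ->
  bounded_measurable (fun t => cos (f t)).
Proof.
move=> mf; split; last by exists 1 => t; exact: cos_max.
by apply: measurableT_comp mf; apply: continuous_measurable_fun; exact: continuous_cos.
Qed.

Lemma bm_sin f : measurable_fun setT f ->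
  bounded_measurable (fun t => sin (f t)).
Proof.
move=> mf; split; last by exists 1 => t; exact: sin_max.
by apply: measurableT_comp mf; apply: continuous_measurable_fun; exact: continuous_sin.
Qed.

Lemma bm_expRN f : measurable_fun setT f -> (forall t, 0 <= f t) ->
  bounded_measurable (fun t => expR (- f t)).
Proof.
move=> mf f0; split.
  by apply: measurableT_comp => //; exact: measurableT_comp.
by exists 1 => t; rewrite ger0_norm ?expR_ge0// -expR0 ler_expR oppr_le0.
Qed.

Lemma bm_integrable P f : bounded_measurable f ->
  P.-integrable setT (EFin \o f).
Proof.
move=> [mf [M fM]]; apply: measurable_bounded_integrable => //.
  by rewrite /= probability_setT ltry.
by exists M; split; [exact: num_real | move=> x Mx t _ /=; rewrite (le_trans (fM t))// ltW].
Qed.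

Lemma expect_EFin P f : bounded_measurable f ->
  'E_P[f]%E = (expect P f)%:E.
Proof.
move=> bf; rewrite unlock /expect /Rintegral fineK//.
by apply: integrable_fin_num => //; exact: bm_integrable.
Qed.

Lemma expect_cst P (c : R) : expect P (fun _ => c) = c.
Proof. by rewrite /expect Rintegral_cst//= probability_setT mulr1. Qed.

Lemma expectD P f g : bounded_measurable f -> bounded_measurable g ->
  expect P (fun t => f t + g t) = expect P f + expect P g.
Proof. by move=> bf bg; apply: RintegralD => //; exact: bm_integrable. Qed.

Lemma expectB P f g : bounded_measurable f -> bounded_measurable g ->
  expect P (fun t => f t - g t) = expect P f - expect P g.
Proof. by move=> bf bg; apply: RintegralB => //; exact: bm_integrable. Qed.

Lemma expectZ P (c : R) f : bounded_measurable f ->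
  expect P (fun t => c * f t) = c * expect P f.
Proof. by move=> bf; apply: RintegralZl => //; exact: bm_integrable. Qed.

Lemma expect_sum P (I : Type) (s : seq I) (p : pred I) (h : I -> T -> R) :
  (forall i, p i -> bounded_measurable (h i)) ->
  expect P (fun t => \sum_(i <- s | p i) h i t) =
  \sum_(i <- s | p i) expect P (h i).
Proof.
move=> bh; elim: s => [|i s IH].
  rewrite big_nil -[RHS](expect_cst P).
  by congr (expect P _); apply/funext => t; rewrite big_nil.
rewrite big_cons -IH; case: ifP => pi_.
  rewrite -expectD//; [|exact: bh|exact: bm_sum].
  by congr (expect P _); apply/funext => t; rewrite big_cons pi_.
by congr (expect P _); apply/funext => t; rewrite big_cons pi_.
Qed.

Lemma le_expect P f g : bounded_measurable f -> bounded_measurable g ->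
  (forall t, f t <= g t) -> expect P f <= expect P g.
Proof. by move=> bf bg fg; apply: le_Rintegral => //; exact: bm_integrable. Qed.

Lemma expect_ge0 P f : (forall t, 0 <= f t) -> 0 <= expect P f.
Proof. by move=> f0; exact: Rintegral_ge0. Qed.

Lemma norm_expect P f : bounded_measurable f ->
  `|expect P f| <= expect P (fun t => `|f t|).
Proof. by move=> bf; apply: le_normr_Rintegral => //; exact: bm_integrable. Qed.

Lemma expect_le_cst P f (c : R) : bounded_measurable f ->
  (forall t, f t <= c) -> expect P f <= c.
Proof.
by move=> bf fc; rewrite -[leRHS](expect_cst P); apply: le_expect => //; exact: bm_cst.
Qed.

Lemma expect_indic P (A : set T) : measurable A ->
  expect P (\1_A : T -> R) = fine (P A).
Proof. by move=> mA; rewrite /expect /Rintegral integral_indic// setIT. Qed.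

Lemma expect_bool P (b : T -> bool) : measurable_fun setT b ->
  expect P (fun t => (b t)%:R : R) = fine (P [set t | b t]).
Proof.
move=> mb; rewrite -expect_indic; last first.
  by rewrite -[X in measurable X]setTI; exact: (mb measurableT [set true]).
by congr (expect P _); apply/funext => t; rewrite indicE; congr (_%:R); rewrite mem_setE.
Qed.

Lemma expect_distribution {disp' : measure_display}
    {S : measurableType disp'} P (V : {RV P >-> S}) (h : S -> R) :
  bounded_measurable h ->
  expect P (fun t => h (V t)) = expect (distribution P V) h.
Proof.
move=> bh; rewrite /expect /Rintegral integral_distribution//.
  by apply/measurable_EFinP; exact: bh.1.
by apply: (bm_integrable P); apply: bm_comp bh.
Qed.

(** The point of a null exceptional set is that ties between observations are
    excluded only almost surely. *)
Lemma le_expect_ae P f g (N : set T) : bounded_measurable f ->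
  bounded_measurable g -> measurable N -> P N = 0%E ->
  (forall t, ~ N t -> f t <= g t) -> expect P f <= expect P g.
Proof.
move=> bf bg mN PN fg.
have bi : bounded_measurable (\1_N : T -> R).
  split; first exact: measurable_indic.
  by exists 1 => t; rewrite indicE; case: (t \in N); rewrite ?normr1 ?normr0.
pose h t := \1_N t * (f t - g t).
have bh : bounded_measurable h by apply: bmM => //; exact: bmB.
have h0 : expect P h <= 0.
  have [_ [M hM]] := bmB bf bg.
  apply: (@le_trans _ _ (expect P (fun t => M * \1_N t))).
    apply: le_expect => //; first exact: bmZ.
    move=> t; rewrite /h mulrC ler_wpM2r ?indicE ?ler0n//.
    exact: le_trans (ler_norm _) (hM t).
  by rewrite expectZ// expect_indic// PN mulr0.
have : expect P f <= expect P (fun t => g t + h t).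
  apply: le_expect => //; first exact: bmD.
  move=> t; rewrite /h indicE; have [tN|tN] := boolP (t \in N).
    by rewrite mul1r addrC subrK.
  by rewrite mul0r addr0 fg// => /mem_set; rewrite (negbTE tN).
by rewrite expectD// => /le_trans; apply; rewrite gerDl.
Qed.

End bounded_measurable_theory.

(** * Independence of disjoint subfamilies *)

Section independent_subfamilies.
Context {disp : measure_display} {T : measurableType disp} {R : realType}.
Context (P : probability T R).

(** Independence of two real random variables turns their joint law into a
    product measure, so Fubini's theorem factors the expectation of the
    product. *)
Lemma expectM_indep (f g : T -> R) :
  bounded_measurable f -> bounded_measurable g ->
  (forall A B : set R, measurable A -> measurable B ->
    P (f @^-1` A `&` g @^-1` B) = (P (f @^-1` A) * P (g @^-1` B))%E) ->
  expect P (fun t => f t * g t) = expect P f * expect P g.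
Proof.
move=> bf bg ind; have [mf [M fM]] := bf; have [mg [N gN]] := bg.
pose F : {mfun T >-> R} := HB.pack f (isMeasurableFun.Build _ _ _ _ f mf).
pose G : {mfun T >-> R} := HB.pack g (isMeasurableFun.Build _ _ _ _ g mg).
have mFG : measurable_fun setT (fun t => (f t, g t)) by exact: measurable_fun_pair.
pose FG : {mfun T >-> (R * R)%type} :=
  HB.pack (fun t => (f t, g t)) (isMeasurableFun.Build _ _ _ _ _ mFG).
pose m1 : probability R R := distribution P F.
pose m2 : probability R R := distribution P G.
pose m12 := distribution P FG.
have mE X : measurable X -> (m1 \x m2)%E X = m12 X.
  move=> mX; apply: (@product_measure_unique _ _ _ _ _ m1 m2 m12) mX => A B mA mB.
  exact: ind.
pose trunc (K : R) (x : R) : R := Num.max (- K) (Num.min x K).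
have bt K : bounded_measurable (trunc K).
  split; first by apply: measurable_maxr => //; exact: measurable_minr.
  exists `|K| => x; rewrite /trunc ler_norml; apply/andP; split.
    by rewrite le_max lerN2 ler_norm.
  by rewrite ge_max ge_min (ler_norm K) orbT andbT -normrN ler_norm.
have tK K x : `|x| <= K -> trunc K x = x.
  rewrite ler_norml => /andP[h1 h2]; rewrite /trunc (min_idPl h2).
  exact/max_idPr.
pose k (z : R * R) := trunc M z.1 * trunc N z.2.
have mk1 : measurable_fun setT (fun z : R * R => trunc M z.1).
  by apply: measurableT_comp => //; case: (bt M).
have mk2 : measurable_fun setT (fun z : R * R => trunc N z.2).
  by apply: measurableT_comp => //; case: (bt N).
have bk : bounded_measurable k.
  apply: bmM; split=> //.
    by have [_ [K hK]] := bt M; exists K => z; exact: hK.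
  by have [_ [K hK]] := bt N; exists K => z; exact: hK.
have e1 : expect P (fun t => f t * g t) = expect m12 k.
  rewrite /m12 -expect_distribution//; congr (expect P _); apply/funext => t.
  by rewrite /k/= !tK.
have e2 : expect P f = expect m1 (trunc M).
  rewrite /m1 -expect_distribution//; congr (expect P _); apply/funext => t.
  by rewrite /= tK.
have e3 : expect P g = expect m2 (trunc N).
  rewrite /m2 -expect_distribution//; congr (expect P _); apply/funext => t.
  by rewrite /= tK.
have m12E : (\int[m12]_z (k z)%:E = \int[(m1 \x m2)%E]_z (k z)%:E)%E.
  by apply: eq_measure_integral => A mA _; exact: (esym (mE A mA)).
have ik : (m1 \x m2)%E.-integrable setT (EFin \o k).
  have := bm_integrable m12 bk.
  move=> /integrableP[mk kfin]; apply/integrableP; split => //.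
  apply: le_lt_trans kfin; rewrite le_eqVlt; apply/orP; left; apply/eqP.
  by apply: eq_measure_integral => A mA _; exact: (mE A mA).
rewrite e1 e2 e3 {1}/expect /Rintegral m12E -integral12_prod_meas1//.
rewrite /fubini_F/= /k /=.
under eq_integral => x _.
  rewrite (_ : (\int[m2]_y _ = (trunc M x * expect m2 (trunc N))%:E)%E); last first.
    rewrite -(expectZ m2 (trunc M x) (bt N)).
    rewrite /expect /Rintegral fineK//.
    by apply: integrable_fin_num => //; apply: bm_integrable; apply: bmZ; exact: bt.
  over.
rewrite [RHS]mulrC -(expectZ m1 _ (bt M)).
by congr fine; apply: eq_integral => x _; rewrite mulrC.
Qed.

Context {I : choiceType} {disp' : measure_display} {T' : measurableType disp'}.
Context (Z : I -> T -> T').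
Hypothesis mZ : forall i, measurable_fun setT (Z i).
Hypothesis indZ : mutually_independent P Z.

Definition subfamily_events (J : set I) : set (set T) :=
  [set E | exists s : seq I, exists A : I -> set T',
    [/\ uniq s, (forall i, i \in s -> J i), (forall i, measurable (A i)) &
        E = \bigcap_(i in [set` s]) (Z i @^-1` A i)]].

Local Lemma subfamily_events_measurable (J : set I) (E : set T) :
  <<s subfamily_events J >> E -> measurable E.
Proof.
move=> /(_ measurable); apply; split; first exact: sigma_algebra_measurable.
move=> _ [s [A [us sJ mA ->]]]; apply: fin_bigcap_measurable => // i _.
by rewrite -[X in measurable X]setTI; exact: mZ.
Qed.

(* Outside of its index list a generator is unconstrained, so lists may be
   enlarged by putting the whole space there. *)
Local Lemma bigcap_widen (s u : seq I) (A : I -> set T') : {subset s <= u} ->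
  \bigcap_(i in [set` s]) (Z i @^-1` A i) =
  \bigcap_(i in [set` u]) (Z i @^-1` (if i \in s then A i else setT)).
Proof.
move=> su; apply/seteqP; split => t h i /= iu.
  by case: ifP => // is_; exact: h.
by have := h i (su _ iu); rewrite /= iu.
Qed.

Local Lemma subfamily_events_setI (J : set I) : setI_closed (subfamily_events J).
Proof.
move=> _ _ [s [A [us sJ mA ->]]] [s' [A' [us' sJ' mA' ->]]].
pose u := undup (s ++ s').
pose B i := (if i \in s then A i else setT) `&` (if i \in s' then A' i else setT).
exists u, B; split; first exact: undup_uniq.
- by move=> i; rewrite mem_undup mem_cat => /orP[/sJ|/sJ'].
- by move=> i; apply: measurableI; case: ifP.
- rewrite (@bigcap_widen s u); last by move=> i; rewrite mem_undup mem_cat => ->.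
  rewrite (@bigcap_widen s' u); last by move=> i; rewrite mem_undup mem_cat => ->; rewrite orbT.
  by rewrite -bigcapI.
Qed.

Local Lemma indep_generators (J1 J2 : set I) (A B : set T) :
  J1 `&` J2 = set0 ->
  subfamily_events J1 A -> subfamily_events J2 B ->
  P (A `&` B) = (P A * P B)%E.
Proof.
move=> J0 [s [A1 [us sJ mA1 ->]]] [s' [A2 [us' sJ' mA2 ->]]].
have dj i : i \in s -> i \in s' = false.
  move=> is1; apply/negP => is2; have : (J1 `&` J2) i by split; [exact: sJ|exact: sJ'].
  by rewrite J0.
pose C i := if i \in s then A1 i else A2 i.
have -> : \bigcap_(i in [set` s]) (Z i @^-1` A1 i) `&`
    \bigcap_(i in [set` s']) (Z i @^-1` A2 i) =
    \bigcap_(i in [set` s ++ s']) (Z i @^-1` C i).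
  apply/seteqP; split => t.
    move=> [h1 h2] i /=; rewrite mem_cat /C; case: ifP => [is1 _|_ /= is2].
      exact: h1.
    exact: h2.
  move=> h; split => i /= is1.
    by have := h i; rewrite /= mem_cat is1 /C is1 => /(_ isT).
  have := h i; rewrite /= mem_cat is1 orbT /C; case: ifP => [/dj|_]; last exact.
  by rewrite is1.
rewrite !indZ// ?cat_uniq ?us ?us' ?andbT//=.
- rewrite big_cat/=; congr (_ * _)%E; rewrite big_seq [RHS]big_seq; apply: eq_bigr => i is1.
    by rewrite /C is1.
  rewrite /C; case: ifP => // /dj; by rewrite is1.
- by apply/hasPn => i is2; apply/negP => /dj; rewrite is2.
- by move=> i _; rewrite /C; case: ifP.
Qed.

Local Lemma indep_extend (G : set (set T)) (B : set T) :
  measurable B -> setI_closed G -> (forall A, <<s G >> A -> measurable A) ->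
  (forall A, G A -> P (A `&` B) = (P A * P B)%E) ->
  forall A, <<s G >> A -> P (A `&` B) = (P A * P B)%E.
Proof.
move=> mB GI mG GB A sA.
pose H := [set A : set T | measurable A /\ P (A `&` B) = (P A * P B)%E].
suff : H A by case.
move: A sA; apply: lambda_system_subset => //.
  apply/dynkin_lambda_system; split.
  - by split; [exact: measurableT | rewrite setTI probability_setT mul1e].
  - move=> C [mC CB]; split; first exact: measurableC.
    have mCB : measurable (C `&` B) by exact: measurableI.
    have mCB' : measurable (~` C `&` B) by apply: measurableI => //; exact: measurableC.
    have e : P B = (P (~` C `&` B) + P (C `&` B))%E.
      rewrite -measureU//; first by rewrite -setIUl setvU setTI.
      by rewrite setIACA setICl set0I.
    have -> : P (~` C `&` B) = (P B - P (C `&` B))%E.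
      by rewrite e addeK// fin_num_measure.
    rewrite probability_setC// CB muleBl ?mul1e ?fin_num_measure//.
  - move=> F tF HF; split; first by apply: bigcup_measurable => k _; exact: (HF k).1.
    rewrite setI_bigcupl measure_bigcup//; last first.
    - by apply: trivIset_setIr.
    - by move=> k _; apply: measurableI => //; exact: (HF k).1.
    rewrite measure_bigcup//; last by move=> k _; exact: (HF k).1.
    rewrite muleC -[in RHS](@fineK _ (P B)) ?fin_num_measure// -nneseriesZl//.
    apply: eq_eseriesr => k _.
    by rewrite fineK ?fin_num_measure// muleC; exact: (HF k).2.
by move=> A GA; split; [apply: mG; exact: sub_sigma_algebra | exact: GB].
Qed.

(** Two applications of the pi-lambda theorem, one for each side. *)
Lemma indep_subfamilies (J1 J2 : set I) (A B : set T) :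
  J1 `&` J2 = set0 ->
  <<s subfamily_events J1 >> A -> <<s subfamily_events J2 >> B ->
  P (A `&` B) = (P A * P B)%E.
Proof.
move=> J0 sA sB.
apply: (@indep_extend (subfamily_events J1)) sA.
- exact: subfamily_events_measurable sB.
- exact: subfamily_events_setI.
- exact: subfamily_events_measurable.
move=> {}A gA; rewrite setIC muleC.
apply: (@indep_extend (subfamily_events J2)) sB.
- by apply: subfamily_events_measurable; exact: sub_sigma_algebra gA.
- exact: subfamily_events_setI.
- exact: subfamily_events_measurable.
move=> {}B gB; rewrite setIC muleC; exact: (@indep_generators J1 J2).
Qed.

(** The sample space with the sigma-algebra generated by the variables with
    indices in [J]: measurability on it says that a random variable is a
    function of that subfamily. *)
Definition subfamily (J : set I) : measurableType _ :=
  g_sigma_algebraType (subfamily_events J).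

Lemma measurable_subfamily (J : set I) (i : I) : J i ->
  measurable_fun setT (Z i : subfamily J -> T').
Proof.
move=> Ji _ A mA; rewrite setTI; apply: sub_sigma_algebra.
exists [:: i], (fun _ => A); split => //; first by move=> j; rewrite inE => /eqP ->.
apply/seteqP; split => t /=; first by move=> h j /=; rewrite inE => /eqP ->.
by move=> /(_ i); apply => /=; rewrite inE.
Qed.

Lemma measurable_of_subfamily (J : set I) (disp2 : measure_display)
    (T2 : measurableType disp2) (f : T -> T2) :
  measurable_fun setT (f : subfamily J -> T2) -> measurable_fun setT f.
Proof.
move=> mf _ A mA; have := mf measurableT A mA.
exact: subfamily_events_measurable.
Qed.

Lemma bm_of_subfamily (J : set I) (f : T -> R) :
  bounded_measurable (f : subfamily J -> R) -> bounded_measurable f.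
Proof. by move=> [mf hf]; split => //; exact: measurable_of_subfamily mf. Qed.

Lemma expectM_subfamilies (J1 J2 : set I) (f g : T -> R) :
  J1 `&` J2 = set0 ->
  bounded_measurable (f : subfamily J1 -> R) ->
  bounded_measurable (g : subfamily J2 -> R) ->
  expect P (fun t => f t * g t) = expect P f * expect P g.
Proof.
move=> J0 bf bg; apply: expectM_indep; [exact: bm_of_subfamily bf|exact: bm_of_subfamily bg|].
move=> A B mA mB; apply: (indep_subfamilies J0).
  by have := bf.1 measurableT A mA; rewrite setTI.
by have := bg.1 measurableT B mB; rewrite setTI.
Qed.

End independent_subfamilies.

(** * Gaussian integrals *)

Section gaussian_integrals.
Context {R : realType} (m s : R).
Hypothesis s0 : s != 0.
Local Notation mu := (@lebesgue_measure R).
Local Notation pdf := (normal_pdf m s).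

Local Lemma normal_pdf_expR x :
  pdf x = normal_peak s * expR (- (x - m) ^+ 2 / (s ^+ 2 *+ 2)).
Proof. by rewrite normal_pdfE. Qed.

(** Doubling the standard deviation absorbs any quadratic factor: this is the
    source of all integrability below. *)
Lemma normal_pdf_quadratic : exists2 C : R, 0 <= C &
  forall x, (1 + (x - m) ^+ 2) * pdf x <= C * normal_pdf m (2 * s) x.
Proof.
have s20 : 2 * s != 0 by rewrite mulf_neq0.
exists ((1 + 8 * s ^+ 2) * normal_peak s / normal_peak (2 * s)).
  rewrite !mulr_ge0 ?invr_ge0 ?normal_peak_ge0//.
  by rewrite addr_ge0// mulr_ge0// sqr_ge0.
move=> x; rewrite normal_pdf_expR [in leRHS]normal_pdfE//.
rewrite [in leRHS]mulrA divfK ?gt_eqF ?normal_peak_gt0//.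
rewrite /normal_fun.
have s2 : 0 < s ^+ 2 by rewrite exprn_even_gt0.
pose t := (x - m) ^+ 2 / (8 * s ^+ 2).
have t0 : 0 <= t by rewrite divr_ge0 ?sqr_ge0// mulr_ge0// ltW.
have yt : (x - m) ^+ 2 = 8 * s ^+ 2 * t.
  by rewrite /t mulrC divfK// mulf_neq0// gt_eqF.
have -> : - (x - m) ^+ 2 / (s ^+ 2 *+ 2) = - (4 * t).
  by rewrite yt; field.
have -> : - (x - m) ^+ 2 / ((2 * s) ^+ 2 *+ 2) = - t.
  by rewrite yt; field.
rewrite yt.
rewrite [leLHS](_ : _ = normal_peak s * ((1 + 8 * s ^+ 2 * t) * expR (- (4 * t)))); last by ring.
rewrite [leRHS](_ : _ = normal_peak s * ((1 + 8 * s ^+ 2) * expR (- t))); last by ring.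
apply: ler_wpM2l; first exact: normal_peak_ge0.
have -> : - (4 * t) = - (3 * t) + - t by ring.
rewrite expRD mulrA ler_wpM2r ?expR_ge0// expRN ler_pdivrMr ?expR_gt0//.
have e3 := expR_ge1Dx (3 * t).
have h1 : 1 <= expR (3 * t) by lra.
have h2 : t <= expR (3 * t) by lra.
by rewrite [leRHS]mulrDl mul1r lerD// ler_wpM2l// mulr_ge0// ltW.
Qed.

Lemma integrable_normal_pdfM (q : R -> R) (A : R) : measurable_fun setT q ->
  (forall x, `|q x| <= A * (1 + (x - m) ^+ 2)) ->
  mu.-integrable setT (fun x => (q x * pdf x)%:E).
Proof.
move=> mq qA; have [C C0 hC] := normal_pdf_quadratic.
have A0 : 0 <= A.
  have := le_trans (normr_ge0 _) (qA m); rewrite subrr expr0n addr0 mulr1.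
  exact.
apply: (@le_integrable _ _ _ mu setT _ _ (fun x => ((A * C) * normal_pdf m (2 * s) x)%:E)) => //.
- apply/measurable_EFinP; apply: measurable_funM => //.
  exact: measurable_normal_pdf.
- move=> x _; rewrite lee_fin [leRHS]ger0_norm; last first.
    by rewrite !mulr_ge0// normal_pdf_ge0.
  rewrite normrM (ger0_norm (normal_pdf_ge0 _ _ _)).
  apply: (le_trans (ler_wpM2r _ (qA x))); first exact: normal_pdf_ge0.
  by rewrite -!mulrA ler_wpM2l.
- under eq_fun do rewrite EFinM; apply: integrableZl => //.
  exact: integrable_normal_pdf.
Qed.

(** Integration by parts on the whole line: the derivative of [q * pdf]
    integrates to zero because [q * pdf] vanishes at infinity. *)
Lemma integral_normal_derive (q q' : R -> R) (A : R) :
  (forall x : R, is_derive x (1 : R) q (q' x)) -> continuous q' ->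
  (forall x, `|q x| <= A * (1 + `|x - m|)) -> (forall x, `|q' x| <= A) ->
  \int[mu]_x ((x - m) * q x * pdf x) = s ^+ 2 * \int[mu]_x (q' x * pdf x).
Proof.
move=> dq cq' qA q'A.
have s2 : s ^+ 2 != 0 by rewrite expf_neq0.
have A0 : 0 <= A := le_trans (normr_ge0 _) (q'A m).
have cq : continuous q.
  move=> x; apply: differentiable_continuous; apply/derivable1_diffP.
  exact: (@ex_derive _ _ _ _ _ _ _ (dq x)).
pose g x := q x * pdf x.
pose h x := (q' x - (x - m) / s ^+ 2 * q x) * pdf x.
have dpdf (x : R) : is_derive x (1 : R) pdf (- (x - m) / s ^+ 2 * pdf x).
  rewrite (_ : pdf = (fun x => normal_peak s *: expR (- (x - m) ^+ 2 / (s ^+ 2 *+ 2)))); last first.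
    by apply/funext => z; rewrite normal_pdf_expR.
  apply: is_derive_eq.
  rewrite /GRing.scale/=; set E := expR _.
  by field; rewrite s0.
have dg (x : R) : is_derive x (1 : R) g (h x).
  rewrite /g; apply: is_derive_eq.
  by rewrite /h /GRing.scale/=; ring.
have cm : continuous (fun x : R => x - m).
  by move=> x; apply: cvgB; [exact: cvg_id|exact: cvg_cst].
have ch : continuous h.
  move=> x; apply: cvgM; last exact: continuous_normal_pdf.
  apply: cvgB; first exact: cq'.
  apply: cvgM; last exact: cq.
  by apply: cvgM; [exact: cm|exact: cvg_cst].
have mq : measurable_fun setT q by exact: continuous_measurable_fun.
have mq' : measurable_fun setT q' by exact: continuous_measurable_fun.
have mxm : measurable_fun setT (fun x : R => x - m) by exact: continuous_measurable_fun.
have quad (y : R) : y <= 1 + y ^+ 2 by nra.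
have quad2 (y : R) : `|y| * (1 + `|y|) <= 2 * (1 + y ^+ 2).
  by rewrite -[y ^+ 2]real_normK ?num_real//; move: `|y| => z; nra.
have iq' : mu.-integrable setT (fun x => (q' x * pdf x)%:E).
  apply: (@integrable_normal_pdfM _ A) => // x.
  by apply: (le_trans (q'A x)); rewrite ler_peMr// lerDl sqr_ge0.
have ixq : mu.-integrable setT (fun x => ((x - m) * q x * pdf x)%:E).
  apply: (@integrable_normal_pdfM _ (2 * A)); first exact: measurable_funM.
  move=> x; rewrite normrM.
  apply: (le_trans (ler_wpM2l (normr_ge0 _) (qA x))).
  rewrite mulrCA [2 * A]mulrC -mulrA ler_wpM2l//.
have ih : mu.-integrable setT (EFin \o h).
  rewrite (_ : EFin \o h = fun x => ((q' x * pdf x)%:E - (s ^+ 2)^-1%:E * ((x - m) * q x * pdf x)%:E)%E).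
    by apply: integrableB => //; exact: integrableZl.
  by apply/funext => x; rewrite /comp -EFinM -EFinB; congr EFin; rewrite /h; field.
have [C C0 hC] := normal_pdf_quadratic.
pose D := C * normal_peak (2 * s).
have s20 : 2 * s != 0 by rewrite mulf_neq0.
have D0 : 0 <= D by rewrite mulr_ge0// normal_peak_ge0.
have pdfD x : (1 + (x - m) ^+ 2) * pdf x <= D.
  by apply: (le_trans (hC x)); rewrite ler_wpM2l// normal_pdf_ub.
(* (1 + y)(1 + n) is at most 4(1 + y^2) when y = n, so g decays like 1/n. *)
have gdecay (n : nat) x : `|x - m| = n%:R -> `|g x| <= A * D * 4 * n.+1%:R^-1.
  move=> xn; rewrite ler_pdivlMr ?ltr0n// /g normrM.
  rewrite (ger0_norm (normal_pdf_ge0 _ _ _)).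
  have := pdfD x; rewrite -[(x - m) ^+ 2]real_normK ?num_real// xn => pD.
  have p0 := normal_pdf_ge0 m s x.
  have := qA x; rewrite xn => qx.
  have n0 : (0 : R) <= n%:R by [].
  rewrite -[n.+1]addn1 natrD.
  apply: (@le_trans _ _ (A * (1 + n%:R) * pdf x * (n%:R + 1))).
    by rewrite ler_wpM2r ?addr_ge0// ler_wpM2r.
  have -> : A * (1 + n%:R) * pdf x * (n%:R + 1) = A * (pdf x * ((1 + n%:R) ^+ 2)) by ring.
  rewrite -!mulrA ler_wpM2l//.
  apply: (@le_trans _ _ (pdf x * (4 * (1 + n%:R ^+ 2)))).
    by rewrite ler_wpM2l//; nra.
  apply: (@le_trans _ _ (4 * D)); last by rewrite /D; lra.
  by rewrite mulrCA ler_wpM2l// mulrC.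
have gcvg (x_ : nat -> R) : (forall n, `|x_ n - m| = n%:R) ->
    g (x_ n) @[n --> \oo] --> (0 : R).
  move=> hx; apply: norm_cvg0.
  apply: (@squeeze_cvgr _ _ _ _ (fun _ => 0) (fun n => A * D * 4 * n.+1%:R^-1)).
  - by apply: nearW => n; rewrite normr_ge0/= gdecay.
  - exact: cvg_cst.
  - rewrite -[X in _ --> X](mulr0 (A * D * 4)).
    by apply: cvgMr; exact: cvg_harmonic.
have int0 : \int[mu]_x h x = 0.
  pose I n : set R := `[m - n.+1%:R, m + n.+1%:R]%classic.
  have mI n : measurable (I n) by exact: measurable_itv.
  have hn n : (\int[mu]_x ((h \_ (I n)) x)%:E = (g (m + n.+1%:R) - g (m - n.+1%:R))%:E)%E.
    transitivity (\int[mu]_(x in I n) (h x)%:E)%E.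
      rewrite [RHS]integral_mkcond; apply: eq_integral => x _.
      by rewrite !patchE; case: ifP.
    rewrite EFinB.
    have lt : m - n.+1%:R < m + n.+1%:R :> R.
      by have : 0 < n.+1%:R :> R by []; lra.
    apply: continuous_FTC2 => //.
    - exact: continuous_subspaceT.
    - have cg : continuous g.
        move=> x; apply: differentiable_continuous; apply/derivable1_diffP.
        exact: (@ex_derive _ _ _ _ _ _ _ (dg x)).
      split.
      + by move=> x _; exact: (@ex_derive _ _ _ _ _ _ _ (dg x)).
      + by apply: cvg_at_right_filter; exact: cg.
      + by apply: cvg_at_left_filter; exact: cg.
    - by move=> x _; rewrite derive1E; exact: (@derive_val _ _ _ _ _ _ _ (dg x)).
  have mh : measurable_fun setT h by exact: continuous_measurable_fun.
  have [| | | | |_ _ lim1] := @dominated_convergence _ _ _ mu setT measurableT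
    (fun n x => ((h \_ (I n)) x)%:E) (fun x => (h x)%:E) (fun x => `|(h x)%:E|%E).
  - move=> n; apply/measurable_EFinP; apply/(measurable_restrictT _ (mI n)).
    exact: measurable_funTS.
  - exact/measurable_EFinP.
  - apply: aeW => x _; apply: cvg_near_cst.
    near=> n; rewrite patchE mem_set//= /I/= in_itv/=.
    have : `|x - m| <= n%:R by near: n; exact: nbhs_infty_ger.
    have : n%:R <= n.+1%:R :> R by rewrite ler_nat.
    rewrite ler_norml => h1 /andP[h2 h3]; apply/andP; split; lra.
  - exact: integrable_abse.
  - apply: aeW => x n _; rewrite patchE; case: ifP => // _.
    by rewrite abse0.
  have lim2 : (\int[mu]_x ((h \_ (I n)) x)%:E @[n --> \oo] --> (0 : \bar R))%E.
    rewrite (eq_cvg _ _ hn); apply: cvg_EFin; first exact: nearW.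
    rewrite [X in _ --> X](_ : _ = 0 - 0 :> R); last by rewrite subr0.
    apply: cvgB.
    + rewrite (@cvg_shiftS _ (fun n => g (m + n%:R))).
      by apply: gcvg => n; rewrite addrAC subrr add0r ger0_norm.
    + rewrite (@cvg_shiftS _ (fun n => g (m - n%:R))).
      by apply: gcvg => n; rewrite addrAC subrr add0r normrN ger0_norm.
  by rewrite /Rintegral (cvg_unique _ lim1 lim2).
have -> : \int[mu]_x ((x - m) * q x * pdf x) =
    \int[mu]_x (s ^+ 2 * (q' x * pdf x - h x)).
  by apply: eq_Rintegral => x _; rewrite /h; field.
rewrite RintegralZl//; last first.
  by rewrite /comp; under eq_fun do rewrite EFinB; exact: integrableB.
by rewrite RintegralB// int0 subr0.
Unshelve. all: by end_near. Qed.

Local Lemma integral_mul_normal_pdf (f : R -> R) :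
  (normal_prob m s).-integrable setT (EFin \o f) ->
  \int[normal_prob m s]_x f x = \int[mu]_x (f x * pdf x).
Proof.
move=> /integrableP[mf finf]; congr fine.
rewrite -(Radon_Nikodym_change_of_variables (@normal_prob_dominates R m s))//=; last first.
  by apply/integrableP; split.
under [RHS]eq_integral do rewrite EFinM.
have mpdf : measurable_fun setT (EFin \o pdf).
  by apply/measurable_EFinP; exact: measurable_normal_pdf.
apply: ae_eq_integral => //.
- apply: emeasurable_funM => //; apply: (measurable_int mu).
  by apply: Radon_Nikodym_integrable; exact: normal_prob_dominates.
- exact: emeasurable_funM.
- apply: ae_eqe_mul2l => /=.
  rewrite Radon_NikodymE//=; first exact: normal_prob_dominates.
  move=> dom.
  case: cid => /= h [h1 h2 h3].
  apply: integral_ae_eq => //=.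
  by move=> E E01 mE; rewrite -h3.
Qed.

Lemma normal_mean : (normal_prob m s).-integrable setT (EFin \o id) ->
  \int[normal_prob m s]_x x = m.
Proof.
move=> ix.
have i1 : mu.-integrable setT (fun x => (1 * pdf x)%:E).
  apply: (@integrable_normal_pdfM _ 1) => // x.
  by rewrite normr1 mul1r lerDl sqr_ge0.
have ixm : mu.-integrable setT (fun x => ((x - m) * pdf x)%:E).
  apply: (@integrable_normal_pdfM _ 1); first exact: measurable_funB.
  by move=> x; rewrite mul1r -[(x - m) ^+ 2]real_normK ?num_real//; move: `|_| => z; nra.
have p1 : \int[mu]_x (1 * pdf x) = 1.
  by under eq_Rintegral do rewrite mul1r; rewrite /Rintegral integral_normal_pdf.
have := @integral_normal_derive (fun _ => 1) (fun _ => 0) 1.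
move=> /(_ (fun x => is_derive_cst _ _ _)) H.
have {}H : \int[mu]_x ((x - m) * pdf x) = 0.
  transitivity (\int[mu]_x ((x - m) * 1 * pdf x)).
    by apply: eq_Rintegral => x _; rewrite mulr1.
  rewrite H.
  - under [X in _ * X]eq_Rintegral do rewrite mul0r.
    by rewrite Rintegral_cst//= mul0r mulr0.
  - exact: cst_continuous.
  - by move=> x; rewrite normr1 mul1r lerDl.
  - by move=> x; rewrite normr0.
rewrite integral_mul_normal_pdf//.
transitivity (\int[mu]_x ((x - m) * pdf x + m * (1 * pdf x))).
  by apply: eq_Rintegral => x _; ring.
rewrite RintegralD//; last exact: (integrableZl measurableT m i1).
by rewrite RintegralZl// p1 H add0r mulr1.
Qed.

Lemma normal_variance :
  (normal_prob m s).-integrable setT (fun x => ((x - m) ^+ 2)%:E) ->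
  \int[normal_prob m s]_x ((x - m) ^+ 2) = s ^+ 2.
Proof.
move=> ix; rewrite integral_mul_normal_pdf//.
have p1 : \int[mu]_x (1 * pdf x) = 1.
  by under eq_Rintegral do rewrite mul1r; rewrite /Rintegral integral_normal_pdf.
have H : \int[mu]_x ((x - m) * (x - m) * pdf x) = s ^+ 2 * \int[mu]_x (1 * pdf x).
  apply: (@integral_normal_derive _ _ 1).
  - by move=> x; apply: is_derive_eq; rewrite subr0.
  - exact: cst_continuous.
  - by move=> x; rewrite mul1r lerDr.
  - by move=> x; rewrite normr1.
by rewrite -[RHS]mulr1 -p1 -H; apply: eq_Rintegral => x _; rewrite expr2.
Qed.

(** The function [k a] below solves [k' = - s^2 a k]: differentiate under the
    integral sign, then integrate by parts. *)
Lemma normal_cos (th a : R) :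
  expect (normal_prob m s) (fun x => cos (th + a * (x - m))) =
  cos th * expR (- (s ^+ 2 * a ^+ 2 / 2)).
Proof.
have maff b : measurable_fun setT (fun x : R => th + b * (x - m)).
  apply: measurable_funD => //; apply: measurable_funM => //.
  exact: measurable_funB.
rewrite /expect integral_mul_normal_pdf; last first.
  by apply: bm_integrable; apply: bm_cos; exact: maff.
pose f b x := cos (th + b * (x - m)) * pdf x.
pose k b := \int[mu]_x f b x.
have cosle1 (u : R) x : `|cos u| <= 1 * (1 + (x - m) ^+ 2).
  by rewrite mul1r (le_trans (cos_max _))// lerDl sqr_ge0.
have dk b : is_derive b (1 : R) k (- (s ^+ 2 * b) * k b).
  have df (c x : R) : is_derive c (1 : R) (f ^~ x) (- (x - m) * sin (th + c * (x - m)) * pdf x).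
    rewrite /f; apply: is_derive_eq.
    by rewrite /GRing.scale/=; ring.
  have intf c : mu.-integrable setT (EFin \o f c).
    apply: (@integrable_normal_pdfM _ 1) => //.
    by case: (bm_cos (maff c)).
  have intG : mu.-integrable setT (EFin \o (fun x => `|x - m| * pdf x)).
    apply: (@integrable_normal_pdfM _ 1).
      by apply: measurableT_comp => //; exact: measurable_funB.
    move=> x; rewrite normr_id mul1r -[(x - m) ^+ 2]real_normK ?num_real//.
    by move: `|_| => z; nra.
  have d1 c x : partial1of2 f c x = - (x - m) * sin (th + c * (x - m)) * pdf x.
    by rewrite partial1of2E; exact: (@derive_val _ _ _ _ _ _ _ (df c x)).
  have bI : (b - 1 < b < b + 1)%R by rewrite ltrBlDr ltrDl ltr01/=.
  have G0 x : 0 <= `|x - m| * pdf x by rewrite mulr_ge0// normal_pdf_ge0.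
  have derf c x : derivable (f ^~ x) c 1 by exact: (@ex_derive _ _ _ _ _ _ _ (df c x)).
  have Gub c x : `|partial1of2 f c x| <= `|x - m| * pdf x.
    rewrite d1 !normrM normrN (ger0_norm (normal_pdf_ge0 _ _ _)).
    by rewrite ler_wpM2r ?normal_pdf_ge0// ler_piMr// sin_max.
  have Ib : (`]b - 1, b + 1[%classic : set R) b by rewrite /= in_itv.
  have D1 := @derivable_under_integral _ _ _ mu f setT measurableT b (b - 1) (b + 1)
    Ib (fun c _ => intf c) (fun c x _ _ => derf c x) _ G0 intG (fun c x _ _ => Gub c x).
  have D2 := @differentiation_under_integral _ _ _ mu f setT measurableT b (b - 1) (b + 1)
    Ib (fun c _ => intf c) (fun c x _ _ => derf c x) _ G0 intG (fun c x _ _ => Gub c x).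
  apply: DeriveDef; first exact: D1.
  rewrite -derive1E D2.
  under eq_Rintegral do rewrite d1.
  have H : \int[mu]_x ((x - m) * sin (th + b * (x - m)) * pdf x) =
      s ^+ 2 * \int[mu]_x (b * cos (th + b * (x - m)) * pdf x).
    apply: (@integral_normal_derive _ _ (`|b| + 1)).
    - move=> x; apply: is_derive_eq; by rewrite /GRing.scale/=; ring.
    - move=> x; apply: cvgM; first exact: cvg_cst.
      apply: continuous_comp; last exact: continuous_cos.
      apply: cvgD; first exact: cvg_cst.
      apply: cvgM; first exact: cvg_cst.
      by apply: cvgB; [exact: cvg_id|exact: cvg_cst].
    - move=> x; apply: (le_trans (sin_max _)).
      by have := normr_ge0 b; have := normr_ge0 (x - m); nra.
    - move=> x; rewrite normrM.
      apply: (@le_trans _ _ (`|b| * 1)); first by rewrite ler_wpM2l// cos_max.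
      by rewrite mulr1 lerDl.
  transitivity (\int[mu]_x (- 1 * ((x - m) * sin (th + b * (x - m)) * pdf x))).
    by apply: eq_Rintegral => x _; ring.
  rewrite RintegralZl//; last first.
    apply: (@integrable_normal_pdfM _ 1).
      apply: measurable_funM; first exact: measurable_funB.
      by case: (bm_sin (maff b)).
    move=> x; rewrite normrM mul1r.
    apply: (@le_trans _ _ (`|x - m| * 1)); first by rewrite ler_wpM2l// sin_max.
    rewrite -[(x - m) ^+ 2]real_normK ?num_real//; move: `|_| => z; nra.
  rewrite H; transitivity (-1 * (s ^+ 2 * \int[mu]_x (b * f b x))).
    by congr (_ * (_ * _)); apply: eq_Rintegral => x _; rewrite /f mulrA.
  by rewrite RintegralZl// /k; ring.
have k0 : k 0 = cos th.
  rewrite /k /f; under eq_Rintegral do rewrite mul0r addr0.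
  rewrite RintegralZl//; last exact: integrable_normal_pdf.
  by rewrite /Rintegral integral_normal_pdf mulr1.
pose K b := k b * expR (s ^+ 2 * b ^+ 2 / 2).
have KE : K a = K 0.
  apply: is_derive_0_is_cst => b; rewrite /K.
  apply: is_derive_eq.
  by rewrite /GRing.scale/=; field.
have : k a * expR (s ^+ 2 * a ^+ 2 / 2) = cos th.
  by rewrite -/(K a) KE /K k0 expr0n/= mulr0 mul0r expR0 mulr1.
by rewrite /k /f => <-; rewrite -[RHS]mulrA expRxMexpNx_1 mulr1.
Qed.

End gaussian_integrals.

(** The hypotheses give the first two moments of [Y]; they identify the
    parameters [m = 0] and [s ^+ 2 = v] of its law. *)
Lemma gaussian_cos {disp : measure_display} {T : measurableType disp}
    {R : realType} (P : probability T R) (Y : T -> R) (v th : R) :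
  is_gaussian P Y -> ('E_P[Y] = 0)%E -> ('E_P[fun t => (Y t ^+ 2)%R] = v%:E)%E ->
  expect P (fun t => cos (th + Y t)) = cos th * expR (- (v / 2)).
Proof.
move=> [mY [m [s law]]] EY EY2.
(* The normal law lives on the copy of the line carrying Lebesgue measure. *)
have mY' : measurable_fun setT (Y : T -> measurableTypeR R) by exact: mY.
pose V : {RV P >-> measurableTypeR R} := HB.pack Y (isMeasurableFun.Build _ _ _ _ _ mY').
pose nu : probability (measurableTypeR R) R := distribution P V.
have iY2 : P.-integrable setT (fun t => (Y t ^+ 2)%:E).
  apply/integrableP; split.
    by apply/measurable_EFinP; exact: measurable_funX.
  rewrite (eq_integral (fun t => (Y t ^+ 2)%:E)).
    by move: EY2; rewrite unlock => ->; rewrite ltry.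
  by move=> t _; rewrite gee0_abs// lee_fin sqr_ge0.
have iY : P.-integrable setT (EFin \o Y).
  apply: (@le_integrable _ _ _ P setT _ _ (fun t => (1 + Y t ^+ 2)%:E)) => //.
  - exact/measurable_EFinP.
  - move=> t _; rewrite lee_fin [leRHS]ger0_norm ?addr_ge0 ?sqr_ge0//.
    by rewrite -[Y t ^+ 2]real_normK ?num_real//; move: `|_| => z; nra.
  - under eq_fun do rewrite EFinD; apply: integrableD => //.
    by apply: bm_integrable; exact: bm_cst.
have nuE (A : set (measurableTypeR R)) : measurable A -> nu A = if s == 0 then \d_m A else normal_prob m s A.
  by move=> mA; rewrite -law.
have transf (h : measurableTypeR R -> R) : measurable_fun setT h ->
    P.-integrable setT (EFin \o (h \o Y)) ->
    \int[P]_t h (Y t) = \int[nu]_x h x.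
  move=> mh ih; rewrite /Rintegral integral_distribution//.
  exact/measurable_EFinP.
have mean0 : \int[nu]_x x = 0.
  rewrite -(transf id)//; move: EY; rewrite unlock => EY.
  by rewrite /Rintegral EY.
have var0 : \int[nu]_x (x ^+ 2) = v.
  rewrite -(transf (fun x => x ^+ 2) (measurable_funX _ (@measurable_id _ _ _)) iY2).
  by move: EY2; rewrite unlock => EY2; rewrite /Rintegral EY2.
have cosE : expect P (fun t => cos (th + Y t)) = \int[nu]_x cos (th + x).
  apply: (transf (fun x => cos (th + x))).
    by case: (@bm_cos _ _ _ (fun x : R => th + x) (measurable_funD (measurable_cst _) (@measurable_id _ _ _))).
  by apply: bm_integrable; apply: bm_cos; exact: measurable_funD.
rewrite cosE; have [s0|s0] := eqVneq s 0.
  have nud (h : measurableTypeR R -> R) : measurable_fun setT h -> \int[nu]_x h x = h m.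
    move=> mh; rewrite /Rintegral (@eq_measure_integral _ (measurableTypeR R) _ setT (@dirac _ (measurableTypeR R) m R)).
      by rewrite integral_dirac//; [rewrite diracE mem_set// mul1e|exact/measurable_EFinP].
    by move=> A mA _; have := nuE A mA; rewrite s0 eqxx.
  have m0 : m = 0 by rewrite -mean0 nud.
  have v0 : v = 0 by rewrite -var0 nud ?m0 ?expr0n//; exact: measurable_funX.
  rewrite nud; first by rewrite m0 v0 mul0r oppr0 expR0 addr0 mulr1.
  by case: (@bm_cos _ _ _ (fun x : R => th + x) (measurable_funD (measurable_cst _) (@measurable_id _ _ _))).
have nun (h : measurableTypeR R -> R) : \int[nu]_x h x = \int[normal_prob m s]_x h x.
  rewrite /Rintegral; congr fine.
  apply: eq_measure_integral => A mA _.
  by have := nuE A mA; rewrite (negbTE s0).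
have inun (h : measurableTypeR R -> R) : measurable_fun setT h ->
    P.-integrable setT (EFin \o (h \o Y)) ->
    (normal_prob m s).-integrable setT (EFin \o h).
  move=> mh /integrableP[_ ih]; apply/integrableP; split; first exact/measurable_EFinP.
  apply: le_lt_trans ih; rewrite -(@ge0_integral_distribution _ _ _ _ _ P V (fun x => `|(h x)%:E|%E))//.
    rewrite le_eqVlt; apply/orP; left; apply/eqP.
    apply: eq_measure_integral => A mA _.
    by have := nuE A mA; rewrite (negbTE s0) => e; exact: (esym e).
  by apply: measurableT_comp => //; exact/measurable_EFinP.
have m0 : m = 0.
  by rewrite -mean0 nun normal_mean//; apply: inun.
have v0 : v = s ^+ 2.
  rewrite -var0 nun -(@normal_variance R m s)//.
    by apply: eq_Rintegral => x _; rewrite m0 subr0.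
  apply: (inun (fun x => (x - m) ^+ 2)).
    by apply: measurable_funX; exact: measurable_funB.
  by rewrite /comp m0; under eq_fun do rewrite subr0.
rewrite nun v0; have := @normal_cos R m s s0 th 1.
rewrite expr1n mulr1 => <-; apply: eq_Rintegral => x _.
by rewrite m0 subr0 mul1r.
Qed.

(** * Bounded convergence *)

Lemma expect_cvg {disp : measure_display} {T : measurableType disp}
    {R : realType} (P : probability T R) (F : nat -> T -> R) (f : T -> R) (M : R) :
  (forall n, measurable_fun setT (F n)) -> measurable_fun setT f ->
  (forall n t, `|F n t| <= M) -> (forall t, F n t @[n --> \oo] --> f t) ->
  expect P (F n) @[n --> \oo] --> expect P f.
Proof.
move=> mF mf FM Ff; rewrite /expect /Rintegral.
have [| | | | |if_ _ lim] := @dominated_convergence _ _ _ P setT measurableT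
  (fun n t => (F n t)%:E) (fun t => (f t)%:E) (fun=> M%:E).
- by move=> n; exact/measurable_EFinP.
- exact/measurable_EFinP.
- by apply: aeW => t _; apply: cvg_EFin; [exact: nearW|exact: Ff].
- by apply: bm_integrable; exact: bm_cst.
- by apply: aeW => t n _; rewrite lee_fin.
apply: fine_cvg; rewrite fineK//.
exact: integrable_fin_num.
Qed.

Lemma cvg_finsum {R : realType} (I : Type) (r : seq I) (F : I -> nat -> R)
    (l : I -> R) : (forall i, F i n @[n --> \oo] --> l i) ->
  \sum_(i <- r) F i n @[n --> \oo] --> \sum_(i <- r) l i.
Proof.
move=> Fl; elim: r => [|i r IH].
  by under eq_fun do rewrite big_nil; rewrite big_nil; exact: cvg_cst.
by under eq_fun do rewrite big_cons; rewrite big_cons; exact: cvgD.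
Qed.

(** * Convergence in distribution from Laplace transforms *)

Section polynomial_approximation.
Context {R : realType}.
Implicit Types (q : R -> R) (h : nat -> R).

(** A modulus of continuity in quadratic form is what pairs with a variance. *)
Lemma quadratic_modulus q (e : R) : continuous q -> 0 < e ->
  exists2 C : R, 0 <= C & forall x y : R, 0 <= x <= 1 -> 0 <= y <= 1 ->
    `|q x - q y| <= e + C * (x - y) ^+ 2.
Proof.
move=> cq e0; apply: contrapT => noC.
have /choice[u hu] : forall n : nat, exists p : R * R,
    [/\ 0 <= p.1 <= 1, 0 <= p.2 <= 1 &
        e + n%:R * (p.1 - p.2) ^+ 2 < `|q p.1 - q p.2|].
  move=> n; apply: contrapT => np; apply: noC; exists n%:R => // x y x01 y01.
  by rewrite leNgt; apply/negP => lt; apply: np; exists (x, y).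
pose x n := (u n).1; pose y n := (u n).2.
have x01 n : 0 <= x n <= 1 by case: (hu n).
have y01 n : 0 <= y n <= 1 by case: (hu n).
have [M hM] : exists M : R, forall z : R, 0 <= z <= 1 -> `|q z| <= M.
  have := @continuous_compact _ _ q `[0, 1]%classic.
  move=> /(_ (continuous_subspaceT cq) (@segment_compact _ _ _)).
  move=> /compact_bounded[M [_ hM]]; exists (M + 1) => z z01.
  by apply: hM; [rewrite ltrDl|exists z => //=; rewrite in_itv].
have hxy n : n.+1%:R * (x n.+1 - y n.+1) ^+ 2 <= 2 * M.
  have [_ _ h] := hu n.+1; have := hM _ (x01 n.+1); have := hM _ (y01 n.+1).
  have := ler_normB (q (x n.+1)) (q (y n.+1)); rewrite -/(x _) -/(y _) in h *.
  lra.
have [f incf /cvg_ex[/= l xl]] : exists2 f : nat -> nat, increasing_seq f & cvgn (x \o f).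
  apply: bolzano_weierstrass; exists 1; split => // z z1 n _ /=.
  by rewrite ger0_norm; case/andP: (x01 n) => // _ /le_trans; apply; exact: ltW.
have flarge n : (n <= f n)%N.
  elim: n => // n IH; apply: (leq_ltn_trans IH).
  have h : (f n.+1 <= f n)%N = (n.+1 <= n)%N := incf n.+1 n.
  by rewrite ltnNge h ltnn.
have yl : y (f n) @[n --> \oo] --> l.
  have -> : (fun n => y (f n)) = (fun n => x (f n) - (x (f n) - y (f n))).
    by apply/funext => n; rewrite subKr.
  rewrite -[X in _ --> X]subr0; apply: cvgB; first exact: xl.
  apply/cvgr0Pnorm_lt => d d0.
  near=> n.
  have n0 : (0 < f n)%N by apply: (leq_trans _ (flarge n)); near: n; exact: nbhs_infty_gt.
  have := hxy (f n).-1; rewrite prednK// => hn.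
  have nbig : 2 * M / d ^+ 2 < (f n)%:R.
    apply: (@lt_le_trans _ _ n%:R); last by rewrite ler_nat.
    by near: n; exact: nbhs_infty_gtr.
  rewrite ltNge; apply/negP => dn.
  have d2 : d ^+ 2 <= (x (f n) - y (f n)) ^+ 2.
    by rewrite -[leRHS]real_normK ?num_real// ler_sqr ?nnegrE// ltW.
  move: nbig; rewrite ltr_pdivrMr ?exprn_gt0//.
  have : (f n)%:R * d ^+ 2 <= (f n)%:R * (x (f n) - y (f n)) ^+ 2 by rewrite ler_wpM2l.
  lra.
have lim0 : q (x (f n)) - q (y (f n)) @[n --> \oo] --> (0 : R).
  rewrite -(subrr (q l)); apply: cvgB.
    by apply: (cvg_comp _ _ xl); exact: cq.
  by apply: (cvg_comp _ _ yl); exact: cq.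
have /cvgr0Pnorm_lt/(_ _ e0)[N _ /(_ N (leqnn N))] := lim0.
have [_ _ h] := hu (f N); rewrite -/(x _) -/(y _) in h *.
have : 0 <= (f N)%:R * (x (f N) - y (f N)) ^+ 2 by rewrite mulr_ge0// sqr_ge0.
lra.
Unshelve. all: by end_near. Qed.

(** The expectation of [h] under the binomial law with parameters [N] and [y],
    presented by conditioning on the first trial. *)
Fixpoint binomial_mean (N : nat) h (y : R) : R :=
  match N with
  | 0 => h 0
  | N'.+1 => y * binomial_mean N' (h \o succn) y + (1 - y) * binomial_mean N' h y
  end.

Lemma binomial_mean_poly N h : exists p : {poly R}, forall y, binomial_mean N h y = p.[y].
Proof.
elim: N h => [|N IH] h /=; first by exists (h 0)%:P => y; rewrite hornerC.
have [p1 h1] := IH (h \o succn); have [p2 h2] := IH h.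
by exists ('X * p1 + (1 - 'X) * p2) => y; rewrite !hornerE h1 h2.
Qed.

Lemma le_binomial_mean N h h' y : 0 <= y <= 1 -> (forall i, h i <= h' i) ->
  binomial_mean N h y <= binomial_mean N h' y.
Proof.
move=> /andP[y0 y1]; elim: N h h' => [|N IH] h h' hh //=.
by rewrite lerD// ler_wpM2l ?subr_ge0// IH// => i; exact: hh.
Qed.

Lemma binomial_mean_affine N h y (a b : R) :
  binomial_mean N (fun i => a + b * h i) y = a + b * binomial_mean N h y.
Proof.
elim: N h => [|N IH] h //=.
by rewrite (IH h) (IH (h \o succn)); ring.
Qed.

Lemma binomial_mean_sqr N (c y : R) :
  binomial_mean N (fun i => (i%:R - c) ^+ 2) y =
  (N%:R * y - c) ^+ 2 + N%:R * y * (1 - y).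
Proof.
elim: N c => [|N IH] c /=; first by rewrite !mul0r addr0.
have -> : (fun i : nat => (i%:R - c) ^+ 2) \o succn = (fun i => (i%:R - (c - 1)) ^+ 2).
  by apply/funext => i /=; rewrite -[i.+1]addn1 natrD; ring.
by rewrite !IH -[N.+1]addn1 natrD; ring.
Qed.

(** Bernstein's proof of the Weierstrass approximation theorem. *)
Lemma polynomial_approximation q (e : R) : continuous q -> 0 < e ->
  exists p : {poly R}, forall y : R, 0 <= y <= 1 -> `|q y - p.[y]| <= e.
Proof.
move=> cq e0.
pose clamp (x : R) := Num.max 0 (Num.min x 1).
have clampP (x : R) : 0 <= clamp x <= 1.
  by rewrite /clamp le_max lexx/= ge_max ler01 ge_min lexx orbT.
have clampd (x y : R) : 0 <= y <= 1 -> (clamp x - y) ^+ 2 <= (x - y) ^+ 2.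
  move=> /andP[y0 y1]; rewrite /clamp; case: (leP x 1) => x1.
    by case: (leP 0 x) => x0//; nra.
  by rewrite (max_idPr _)//; nra.
have e2 : 0 < e / 2 by lra.
have [C C0 hC] := quadratic_modulus cq e2.
have [N hN] : exists N : nat, C / (e / 2) <= N.+1%:R.
  near \oo => N; exists N.
  apply: (@le_trans _ _ N%:R); last by rewrite ler_nat.
  by near: N; exact: nbhs_infty_ger.
pose h i := q (clamp (i%:R / N.+1%:R)).
have [p hp] := binomial_mean_poly N.+1 h.
exists p => y y01; rewrite -hp.
have N0 : 0 < N.+1%:R :> R by [].
have bound : C / N.+1%:R ^+ 2 * (N.+1%:R * y * (1 - y)) <= e / 2.
  rewrite ler_pdivrMr in hN => //; case/andP: y01 => y0 y1.
  have -> : C / N.+1%:R ^+ 2 * (N.+1%:R * y * (1 - y)) = C / N.+1%:R * (y * (1 - y)).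
    by field; rewrite gt_eqF.
  apply: (@le_trans _ _ (C / N.+1%:R * 1)).
    by rewrite ler_wpM2l// ?divr_ge0//; nra.
  by rewrite mulr1 ler_pdivrMr// mulrC.
have hi i : `|q y - h i| <= e / 2 + C / N.+1%:R ^+ 2 * (i%:R - N.+1%:R * y) ^+ 2.
  apply: (le_trans (hC _ _ y01 (clampP _))).
  rewrite lerD2l (_ : C / _ * _ = C * ((i%:R / N.+1%:R - y) ^+ 2)); last first.
    by field; rewrite gt_eqF.
  by rewrite ler_wpM2l// -[leLHS]sqrrN opprB clampd.
have mean0 : binomial_mean N.+1 (fun i => (i%:R - N.+1%:R * y) ^+ 2) y =
    N.+1%:R * y * (1 - y).
  by rewrite binomial_mean_sqr subrr expr0n add0r.
rewrite ler_norml; apply/andP; split.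
  have := @le_binomial_mean N.+1 h (fun i => (q y + e / 2) + C / N.+1%:R ^+ 2 * (i%:R - N.+1%:R * y) ^+ 2) y y01.
  rewrite binomial_mean_affine mean0 => H.
  have {}H : binomial_mean N.+1 h y <= q y + e / 2 + C / N.+1%:R ^+ 2 * (N.+1%:R * y * (1 - y)).
    by apply: H => i; have := hi i; rewrite distrC ler_distl addrA => /andP[].
  rewrite lerNl opprB lerBlDl; apply: (le_trans H); rewrite -addrA lerD2l.
  by rewrite [leRHS](splitr e) lerD2l.
have := @le_binomial_mean N.+1 (fun i => (q y - e / 2) + (- (C / N.+1%:R ^+ 2)) * (i%:R - N.+1%:R * y) ^+ 2) h y y01.
rewrite binomial_mean_affine mean0 => H.
have {}H : q y - e / 2 + - (C / N.+1%:R ^+ 2) * (N.+1%:R * y * (1 - y)) <= binomial_mean N.+1 h y.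
  by apply: H => i; rewrite mulNr; have := hi i; rewrite distrC ler_distl opprD addrA => /andP[].
rewrite lerBlDl -lerBlDr; apply: le_trans H.
rewrite mulNr -addrA lerD2l -opprD lerN2 [leRHS](splitr e).
by rewrite lerD2l.
Unshelve. all: by end_near. Qed.

End polynomial_approximation.

Section laplace.
Context {disp disp' : measure_display} {T : measurableType disp}
  {T' : measurableType disp'} {R : realType}.
Context (P : probability T R) (P' : probability T' R).
Context (Y : nat -> T -> R) (Z : T' -> R).
Hypotheses (mY : forall n, measurable_fun setT (Y n)) (mZ : measurable_fun setT Z).
Hypotheses (Y0 : forall n t, 0 <= Y n t) (Z0 : forall t, 0 <= Z t).
Hypothesis laplace : forall k : nat,
  expect P (fun t => expR (- (k%:R * Y n t))) @[n --> \oo] -->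
  expect P' (fun t => expR (- (k%:R * Z t))).

Local Lemma expRN_itv (y : R) : 0 <= y -> 0 <= expR (- y) <= 1.
Proof. by move=> y0; rewrite expR_ge0/= -expR0 ler_expR oppr_le0. Qed.

Local Lemma laplace_poly (p : {poly R}) :
  expect P (fun t => p.[expR (- Y n t)]) @[n --> \oo] -->
  expect P' (fun t => p.[expR (- Z t)]).
Proof.
have eqp d (S : measurableType d) (Q : probability S R) (V : S -> R) :
    measurable_fun setT V -> (forall t, 0 <= V t) ->
    expect Q (fun t => p.[expR (- V t)]) =
    \sum_(i < size p) p`_i * expect Q (fun t => expR (- (i%:R * V t))).
  move=> mV V0.
  have bV (i : nat) : bounded_measurable (fun t => expR (- (i%:R * V t))).
    apply: bm_expRN; first exact: measurable_funM.
    by move=> t; rewrite mulr_ge0.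
  under [RHS]eq_bigr => i _ do rewrite -expectZ//.
  rewrite -expect_sum; last by move=> i _; exact: bmZ.
  congr (expect Q _); apply/funext => t; rewrite horner_coef.
  by apply: eq_bigr => i _; rewrite -expRM_natl mulrN.
rewrite eqp//; under eq_fun do rewrite eqp//.
apply: cvg_finsum => i; apply: cvgM; first exact: cvg_cst.
exact: laplace.
Qed.

Local Lemma laplace_continuous (q : R -> R) : continuous q ->
  expect P (fun t => q (expR (- Y n t))) @[n --> \oo] -->
  expect P' (fun t => q (expR (- Z t))).
Proof.
move=> cq; apply/cvgrPdist_le => e e0.
have e3 : 0 < e / 3 by lra.
have [p hp] := polynomial_approximation cq e3.
have near_poly d (S : measurableType d) (Q : probability S R) (V : S -> R) :
    measurable_fun setT V -> (forall t, 0 <= V t) ->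
    `|expect Q (fun t => q (expR (- V t))) - expect Q (fun t => p.[expR (- V t)])| <= e / 3.
  move=> mV V0.
  have mE : measurable_fun setT (fun t => expR (- V t)).
    by case: (bm_expRN mV V0).
  have bp (g : R -> R) : continuous g -> bounded_measurable (fun t => g (expR (- V t))).
    move=> cg; split.
      by apply: measurableT_comp mE; exact: continuous_measurable_fun.
    have [C C0 hC] := quadratic_modulus cg (@ltr01 R).
    exists (`|g 0| + (1 + C)) => t; have t01 := expRN_itv (V0 t).
    have z01 : 0 <= (0 : R) <= 1 by rewrite lexx ler01.
    have := hC _ _ t01 z01; rewrite subr0 => h1.
    have := lerB_normD (g (expR (- V t))) (g 0).
    have : expR (- V t) ^+ 2 <= 1 by rewrite expr_le1//; case/andP: t01.
    have := ler_distD 0 (g (expR (- V t)) - g 0) (- g 0).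
    move: t01 => /andP[a b].
    have : `|g (expR (- V t))| <= `|g (expR (- V t)) - g 0| + `|g 0|.
      by rewrite -{1}(subrK (g 0) (g (expR (- V t)))) ler_normD.
    nra.
  have bq := bp q cq; have bpp := bp _ (@continuous_horner R p).
  rewrite -expectB//; apply: (le_trans (norm_expect _ (bmB bq bpp))).
  apply: expect_le_cst; first by apply: bm_norm; exact: bmB.
  by move=> t; exact: hp (expRN_itv (V0 t)).
have /cvgrPdist_le/(_ _ e3) := @laplace_poly p.
apply: filterS => n hn.
have h1 := near_poly _ _ P _ (mY n) (Y0 n).
have h2 := near_poly _ _ P' _ mZ Z0.
move: hn h1 h2; rewrite !ler_norml => /andP[? ?] /andP[? ?] /andP[? ?].
by apply/andP; split; lra.
Qed.

(** A bounded continuous [f] agrees with the continuous function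
    [f (- ln y) * (1 - (1 - y) ^+ k)] of [y = expR (- x)] up to
    [M (1 - y) ^+ k]; the expectation of this error is again controlled by
    Laplace transforms, so no tightness has to be proved separately. *)
Lemma laplace_cvg_in_distribution : cvg_in_distribution P P' Y Z.
Proof.
split => // f cf bf.
have [M hM] : exists M : R, forall x, `|f x| <= M.
  by case: bf => M [_ hM]; exists (M + 1) => x; apply: hM => //; rewrite ltrDl.
have M0 : 0 <= M := le_trans (normr_ge0 _) (hM 0).
have bfV d (S : measurableType d) (V : S -> R) : measurable_fun setT V ->
    bounded_measurable (f \o V).
  move=> mV; split; last by exists M => t; exact: hM.
  by apply: measurableT_comp mV; exact: continuous_measurable_fun.
rewrite (expect_EFin P' (bfV _ _ _ mZ)).
under eq_fun do rewrite (expect_EFin P (bfV _ _ _ (mY _))).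
apply: cvg_EFin; first exact: nearW.
pose q k (y : R) := if y <= 0 then 0 else f (- ln y) * (1 - (1 - y) ^+ k).
have cpow k : continuous (fun y : R => 1 - (1 - y) ^+ k).
  move=> y; apply: cvgB; first exact: cvg_cst.
  apply: (@cvg_comp _ _ _ (fun y : R => 1 - y) (fun z : R => z ^+ k)).
    by apply: cvgB; [exact: cvg_cst|exact: cvg_id].
  exact: exprn_continuous.
have cq k : continuous (q k).
  move=> y; have [y0|y0|->] := ltgtP y 0.
  - rewrite /continuous_at /q (ltW y0); apply: cvg_near_cst.
    near=> z; have : z < 0 by near: z; exact: lt_nbhsl.
    by move/ltW => ->.
  - have E : \forall z \near y, q k z = f (- ln z) * (1 - (1 - z) ^+ k).
      near=> z; rewrite /q leNgt; suff -> : 0 < z by [].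
      by near: z; exact: lt_nbhsr.
    have qy : q k y = f (- ln y) * (1 - (1 - y) ^+ k) by rewrite /q leNgt y0.
    rewrite /continuous_at qy; apply: cvg_trans; first by apply: near_eq_cvg; apply: filterS E => z ->.
    apply: cvgM; last exact: cpow.
    apply: (@cvg_comp _ _ _ (fun z => - ln z) f); last exact: cf.
    by apply: cvgN; exact: continuous_ln.
  - have q0 : q k 0 = 0 by rewrite /q lexx.
    rewrite /continuous_at q0.
    apply: norm_cvg0; apply: (@squeeze_cvgr _ _ _ _ (fun _ => 0)
      (fun z : R => M * `|1 - (1 - z) ^+ k|)).
    + apply: nearW => z; rewrite normr_ge0/= /q; case: ifP => _.
        by rewrite normr0 mulr_ge0.
      by rewrite normrM ler_wpM2r.
    + exact: cvg_cst.
    + rewrite -[X in _ --> X](mulr0 M); apply: cvgM; first exact: cvg_cst.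
      rewrite -[X in _ --> X](normr0 R); apply: cvg_norm.
      have e : 1 - (1 - 0) ^+ k = 0 :> R by rewrite subr0 expr1n subrr.
      by have := cpow k 0; rewrite /continuous_at e.
have cr k : continuous (fun y : R => (1 - y) ^+ k).
  move=> y; apply: (@cvg_comp _ _ _ (fun y : R => 1 - y) (fun z : R => z ^+ k)).
    by apply: cvgB; [exact: cvg_cst|exact: cvg_id].
  exact: exprn_continuous.
have approx k d (S : measurableType d) (Q : probability S R) (V : S -> R) :
    measurable_fun setT V -> (forall t, 0 <= V t) ->
    `|expect Q (f \o V) - expect Q (fun t => q k (expR (- V t)))| <=
    M * expect Q (fun t => (1 - expR (- V t)) ^+ k).
  move=> mV V0.
  have bE : bounded_measurable (fun t => expR (- V t)) by exact: bm_expRN.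
  have b1 : bounded_measurable (fun t => (1 - expR (- V t)) ^+ k).
    by apply: bmX; apply: bmB => //; exact: bm_cst.
  have qE t : q k (expR (- V t)) = f (V t) * (1 - (1 - expR (- V t)) ^+ k).
    by rewrite /q leNgt expR_gt0/= expRK opprK.
  have bq : bounded_measurable (fun t => q k (expR (- V t))).
    under eq_fun do rewrite qE; apply: bmM; first exact: (bfV _ _ _ mV).
    by apply: bmB => //; exact: bm_cst.
  rewrite -expectZ// -expectB//; last exact: bfV.
  apply: (le_trans (norm_expect _ (bmB (bfV _ _ _ mV) bq))).
  apply: le_expect; [by apply: bm_norm; apply: bmB => //; exact: bfV|exact: bmZ|].
  move=> t; rewrite qE /=.
  have -> : f (V t) - f (V t) * (1 - (1 - expR (- V t)) ^+ k) =
    f (V t) * (1 - expR (- V t)) ^+ k by ring.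
  rewrite normrM (ger0_norm (x := _ ^+ k)) ?ler_wpM2r ?exprn_ge0// subr_ge0.
    by have /andP[] := expRN_itv (V0 t).
  by have /andP[] := expRN_itv (V0 t).
have tail : M * expect P' (fun t => (1 - expR (- Z t)) ^+ k) @[k --> \oo] --> (0 : R).
  rewrite -[X in _ --> X](mulr0 M); apply: cvgM; first exact: cvg_cst.
  rewrite -[X in _ --> X](expect_cst P' 0).
  apply: (@expect_cvg _ _ _ _ _ _ 1) => //.
  - move=> k; apply: measurable_funX; apply: measurable_funB => //.
    by case: (bm_expRN mZ Z0).
  - move=> k t; have /andP[a b] := expRN_itv (Z0 t).
    by rewrite ger0_norm ?exprn_ge0 ?subr_ge0// exprn_ile1 ?subr_ge0// gerBl.
  - move=> t; apply: cvg_expr; have /andP[a b] := expRN_itv (Z0 t).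
    by rewrite ger0_norm ?subr_ge0// gtrBl expR_gt0.
apply/cvgrPdist_le => e e0.
have e4 : 0 < e / 4 by lra.
have /cvgr0Pnorm_lt/(_ _ e4)[k _ /(_ k (leqnn k)) hk] := tail.
have /cvgrPdist_le/(_ _ e4) h1 := laplace_continuous (cq k).
have h2 : M * expect P (fun t => (1 - expR (- Y n t)) ^+ k) @[n --> \oo] -->
    M * expect P' (fun t => (1 - expR (- Z t)) ^+ k).
  apply: cvgM; first exact: cvg_cst.
  exact: (laplace_continuous (cr k)).
have /cvgrPdist_le/(_ _ e4) {}h2 := h2.
near=> n.
have h3 := approx k _ _ P _ (mY n) (Y0 n).
have h4 := approx k _ _ P' _ mZ Z0.
have h5 : `|expect P' (fun t => q k (expR (- Z t))) - expect P (fun t => q k (expR (- Y n t)))| <= e / 4.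
  by near: n.
have h6 : `|M * expect P' (fun t => (1 - expR (- Z t)) ^+ k) -
    M * expect P (fun t => (1 - expR (- Y n t)) ^+ k)| <= e / 4.
  by near: n.
rewrite /=; move: hk h3 h4 h5 h6; rewrite !ler_norml ltr_norml.
move=> /andP[? ?] /andP[? ?] /andP[? ?] /andP[? ?] /andP[? ?].
by apply/andP; split; lra.
Unshelve. all: by end_near. Qed.

End laplace.

(** * Iterated expectations *)

Section expect_fubini.
Context {disp disp' : measure_display} {T : measurableType disp}
  {S : measurableType disp'} {R : realType}.
Context (P : probability T R) (Q : probability S R) (F : T -> S -> R).
Hypothesis bF : bounded_measurable (fun z : T * S => F z.1 z.2).

Local Lemma fubini_integrable :
  (P \x Q)%E.-integrable setT (EFin \o (fun z : T * S => F z.1 z.2)).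
Proof.
have [mF [M FM]] := bF; apply: measurable_bounded_integrable => //.
  have e : (P \x Q)%E setT = 1%E.
    by rewrite -setXTT product_measure1E//= !probability_setT mule1.
  by apply: (@le_lt_trans _ _ 1%E); [rewrite le_eqVlt; apply/orP; left; exact/eqP/e|exact: ltry].
by exists M; split; [exact: num_real | move=> x Mx t _ /=; rewrite (le_trans (FM t))// ltW].
Qed.

Local Lemma bm_sectionl t : bounded_measurable (F t).
Proof.
have [mF [M FM]] := bF; split; last by exists M => s; exact: (FM (t, s)).
exact: (measurableT_comp mF (measurable_pair1 t)).
Qed.

Local Lemma bm_sectionr s : bounded_measurable (F ^~ s).
Proof.
have [mF [M FM]] := bF; split; last by exists M => t; exact: (FM (t, s)).
exact: (measurableT_comp mF (measurable_pair2 s)).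
Qed.

Local Lemma integral_sectionl t : (\int[Q]_s (F t s)%:E = (expect Q (F t))%:E)%E.
Proof.
rewrite /expect /Rintegral fineK//; apply: integrable_fin_num => //.
by apply: bm_integrable; exact: bm_sectionl.
Qed.

Local Lemma integral_sectionr s : (\int[P]_t (F t s)%:E = (expect P (F ^~ s))%:E)%E.
Proof.
rewrite /expect /Rintegral fineK//; apply: integrable_fin_num => //.
by apply: bm_integrable; exact: bm_sectionr.
Qed.

Lemma bm_expectl : bounded_measurable (fun t => expect Q (F t)).
Proof.
have [mF [M FM]] := bF; split.
  apply/measurable_EFinP; have := measurable_fubini_F fubini_integrable.
  by apply: eq_measurable_fun => t _; rewrite /fubini_F/= -integral_sectionl.
exists M => t; apply: (le_trans (norm_expect _ (bm_sectionl t))).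
apply: expect_le_cst; first by apply: bm_norm; exact: bm_sectionl.
by move=> s; exact: (FM (t, s)).
Qed.

Lemma bm_expectr : bounded_measurable (fun s => expect P (F ^~ s)).
Proof.
have [mF [M FM]] := bF; split.
  apply/measurable_EFinP; have := measurable_fubini_G fubini_integrable.
  by apply: eq_measurable_fun => t _; rewrite /fubini_G/= -integral_sectionr.
exists M => s; apply: (le_trans (norm_expect _ (bm_sectionr s))).
apply: expect_le_cst; first by apply: bm_norm; exact: bm_sectionr.
by move=> t; exact: (FM (t, s)).
Qed.

Lemma expect_fubini :
  expect P (fun t => expect Q (F t)) = expect Q (fun s => expect P (F ^~ s)).
Proof.
rewrite {1}/expect [RHS]/expect /Rintegral; congr fine.
have := Fubini fubini_integrable => /=.
under eq_integral do rewrite integral_sectionl.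
by under [RHS]eq_integral do rewrite integral_sectionr.
Qed.

End expect_fubini.

(** * Quadratic functionals of asymptotically Gaussian families *)

Section quadratic_functionals.
Context {disp disp' : measure_display} {T : measurableType disp}
  {T' : measurableType disp'} {R : realType} {I : Type}.
Context (P : probability T R) (P' : probability T' R).
Context (V : nat -> I -> T -> R) (V' : I -> T' -> R).
Hypotheses (mV : forall n i, measurable_fun setT (V n i))
  (mV' : forall i, measurable_fun setT (V' i)).

Definition linear_form (x : I -> R) (s : seq (R * I)) : R :=
  \sum_(ai <- s) ai.1 * x ai.2.

Definition quadratic_form (x : I -> R) (s : seq (R * I)) : R :=
  \sum_(ci <- s) ci.1 * x ci.2 ^+ 2.

Hypothesis cos_cvg : forall (th : R) (s : seq (R * I)),
  expect P (fun t => cos (th + linear_form (fun i => V n i t) s)) @[n --> \oo] -->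
  expect P' (fun t => cos (th + linear_form (V' ^~ t) s)).

Lemma quadratic_form_ge0 (x : I -> R) s : all (fun ci => 0 <= ci.1) s ->
  0 <= quadratic_form x s.
Proof.
rewrite /quadratic_form; elim: s => [|c s IH] /=; first by rewrite big_nil.
by move=> /andP[c0 s0]; rewrite big_cons addr_ge0// ?IH// mulr_ge0 ?sqr_ge0.
Qed.

Lemma measurable_linear_form d (S : measurableType d) (W : I -> S -> R) s :
  (forall i, measurable_fun setT (W i)) ->
  measurable_fun setT (fun t => linear_form (W ^~ t) s).
Proof.
by move=> mW; apply: measurable_sum => ai; apply: measurable_funM.
Qed.

Lemma measurable_quadratic_form d (S : measurableType d) (W : I -> S -> R) s :
  (forall i, measurable_fun setT (W i)) ->
  measurable_fun setT (fun t => quadratic_form (W ^~ t) s).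
Proof.
by move=> mW; apply: measurable_sum => ai; apply: measurable_funM => //; exact: measurable_funX.
Qed.

(** The Hubbard-Stratonovich trick: [expR (- c x ^+ 2)] is the average of
    [cos (sqrt (2 c) z x)] over a standard normal [z]. It removes the squares
    one at a time and reduces quadratic functionals to characteristic
    functions. *)
Local Lemma hubbard_stratonovich d (S : measurableType d) (Q : probability S R)
    (W : I -> S -> R) (c : R) (i : I) (s : seq (R * I)) (th : R) (l : seq (R * I)) :
  (forall i, measurable_fun setT (W i)) -> 0 <= c -> all (fun ci => 0 <= ci.1) s ->
  expect Q (fun t => expR (- quadratic_form (W ^~ t) ((c, i) :: s)) *
                     cos (th + linear_form (W ^~ t) l)) =
  expect (normal_prob 0 1) (fun z =>
    expect Q (fun t => expR (- quadratic_form (W ^~ t) s) *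
                       cos (th + linear_form (W ^~ t) ((Num.sqrt (2 * c) * z, i) :: l)))) /\
  bounded_measurable (fun z : measurableTypeR R =>
    expect Q (fun t => expR (- quadratic_form (W ^~ t) s) *
                       cos (th + linear_form (W ^~ t) ((Num.sqrt (2 * c) * z, i) :: l)))).
Proof.
move=> mW c0 s0.
pose F (t : S) (z : measurableTypeR R) : R := expR (- quadratic_form (W ^~ t) s) *
   cos (th + linear_form (W ^~ t) ((Num.sqrt (2 * c) * z, i) :: l)).
have m1 : measurable_fun setT (fst : S * measurableTypeR R -> S) by exact: measurable_fst.
have m2 : measurable_fun setT (snd : S * measurableTypeR R -> measurableTypeR R).
  exact: measurable_snd.
have bF : bounded_measurable (fun z : S * measurableTypeR R => F z.1 z.2).
  apply: bmM.
    apply: bm_expRN; last by move=> t; exact: quadratic_form_ge0.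
    exact: (measurableT_comp (measurable_quadratic_form s mW) m1).
  apply: bm_cos; apply: measurable_funD => //.
  rewrite /linear_form; under eq_fun do rewrite big_cons/=.
  apply: measurable_funD; last first.
    exact: (measurableT_comp (measurable_linear_form l mW) m1).
  apply: measurable_funM; first exact: measurable_funM.
  exact: (measurableT_comp (mW i) m1).
split; last exact: (bm_expectr Q (normal_prob 0 1) bF).
rewrite -(expect_fubini _ _ bF); congr (expect Q _); apply/funext => t.
have bc : bounded_measurable (fun z : measurableTypeR R =>
    cos (th + linear_form (W ^~ t) l + Num.sqrt (2 * c) * W i t * (z - 0))).
  apply: bm_cos; apply: measurable_funD => //; apply: measurable_funM => //.
  exact: measurable_funB.
transitivity (expR (- quadratic_form (W ^~ t) s) *
    expect (normal_prob 0 1) (fun z =>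
    cos (th + linear_form (W ^~ t) l + Num.sqrt (2 * c) * W i t * (z - 0)))).
  rewrite normal_cos ?oner_neq0// {1}/quadratic_form big_cons/= opprD expRD.
  rewrite expr1n mul1r exprMn sqr_sqrtr ?mulr_ge0//.
  have -> : 2 * c * W i t ^+ 2 / 2 = c * W i t ^+ 2 by field.
  by rewrite -mulrA mulrCA [X in _ * X = _]mulrC.
rewrite -expectZ//; congr (expect _ _); apply/funext => z.
rewrite /F; congr (_ * cos _); rewrite {2}/linear_form big_cons/= subr0.
by rewrite /linear_form; ring.
Qed.

Lemma quadratic_form_cvg (s : seq (R * I)) : all (fun ci => 0 <= ci.1) s ->
  expect P (fun t => expR (- quadratic_form (fun i => V n i t) s)) @[n --> \oo] -->
  expect P' (fun t => expR (- quadratic_form (V' ^~ t) s)).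
Proof.
move=> s0.
suff H : forall th l,
    expect P (fun t => expR (- quadratic_form (fun i => V n i t) s) *
      cos (th + linear_form (fun i => V n i t) l)) @[n --> \oo] -->
    expect P' (fun t => expR (- quadratic_form (V' ^~ t) s) *
      cos (th + linear_form (V' ^~ t) l)).
  have E d (S : measurableType d) (Q : probability S R) (W : I -> S -> R) :
      expect Q (fun t => expR (- quadratic_form (W ^~ t) s) *
        cos (0 + linear_form (W ^~ t) [::])) =
      expect Q (fun t => expR (- quadratic_form (W ^~ t) s)).
    congr (expect Q _); apply/funext => t.
    by rewrite /linear_form big_nil addr0 cos0 mulr1.
  by have := H 0 [::]; rewrite E; under eq_fun do rewrite E.
elim: s s0 => [_ th l|[c i] s IH /= /andP[c0 s0] th l].
  have E d (S : measurableType d) (Q : probability S R) (W : I -> S -> R) :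
      expect Q (fun t => expR (- quadratic_form (W ^~ t) [::]) *
        cos (th + linear_form (W ^~ t) l)) =
      expect Q (fun t => cos (th + linear_form (W ^~ t) l)).
    congr (expect Q _); apply/funext => t.
    by rewrite /quadratic_form big_nil oppr0 expR0 mul1r.
  by rewrite E; under eq_fun do rewrite E; exact: cos_cvg.
have [-> mlim] := hubbard_stratonovich P' i th l mV' c0 s0.
under eq_fun => n do rewrite (hubbard_stratonovich P i th l (mV n) c0 s0).1.
apply: (@expect_cvg _ _ _ _ _ _ 1).
- by move=> n; case: (hubbard_stratonovich P i th l (mV n) c0 s0).2.
- by case: mlim.
- move=> n z.
  have bW : bounded_measurable (fun t => expR (- quadratic_form (fun i => V n i t) s) *
      cos (th + linear_form (fun i => V n i t) ((Num.sqrt (2 * c) * z, i) :: l))).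
    apply: bmM.
      apply: bm_expRN; last by move=> t; exact: quadratic_form_ge0.
      exact: measurable_quadratic_form.
    by apply: bm_cos; apply: measurable_funD => //; exact: measurable_linear_form.
  apply: (le_trans (norm_expect _ bW)).
  apply: expect_le_cst; first exact: bm_norm.
  move=> t; rewrite normrM -[leRHS]mulr1 ler_pM ?cos_max//.
  by rewrite ger0_norm ?expR_ge0// -expR0 ler_expR oppr_le0 quadratic_form_ge0.
- by move=> z; exact: IH.
Qed.

End quadratic_functionals.

(** * The central limit theorem for characteristic functions *)

Section trigonometric_bounds.
Context {R : realType}.
Implicit Types x y : R.

Local Lemma mvt0 (f f' : R -> R) x : (forall z, is_derive z (1 : R) f (f' z)) ->
  f 0 = 0 -> exists2 c : R, `|c| <= `|x| & f x = f' c * x.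
Proof.
move=> df f0.
have cf : continuous f.
  move=> z; apply: differentiable_continuous; apply/derivable1_diffP.
  exact: (@ex_derive _ _ _ _ _ _ _ (df z)).
have [x0|x0] := leP 0 x.
  have [|c] := @MVT_segment _ f f' 0 x x0; first exact: continuous_subspaceT.
  rewrite in_itv/= => /andP[c0 cx]; rewrite f0 !subr0 => ->.
  by exists c => //; rewrite !ger0_norm.
have [|c] := @MVT_segment _ f f' x 0 (ltW x0); first exact: continuous_subspaceT.
rewrite in_itv/= => /andP[xc c0]; rewrite f0 !sub0r => fx.
exists c; first by rewrite !ler0_norm ?lerN2// ltW.
by rewrite -[LHS]opprK fx mulrN opprK.
Qed.

Lemma norm_sin_le x : `|sin x| <= `|x|.
Proof.
have [c _ ->] := @mvt0 sin cos x (fun z => is_derive_sin z) (sin0 R).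
by rewrite normrM ler_piMl// cos_max.
Qed.

Lemma norm_1Bcos_le x : `|1 - cos x| <= x ^+ 2.
Proof.
have d z : is_derive z (1 : R) (fun x => 1 - cos x) (sin z).
  by apply: is_derive_eq; ring.
have [|c cx ->] := @mvt0 _ _ x d; first by rewrite cos0 subrr.
rewrite normrM -[x ^+ 2]real_normK ?num_real// expr2 ler_wpM2r//.
exact: (le_trans (norm_sin_le c)).
Qed.

Lemma norm_xBsin_le x : `|x - sin x| <= `|x| ^+ 3.
Proof.
have d z : is_derive z (1 : R) (fun x => x - sin x) (1 - cos z).
  exact: is_derive_eq.
have [|c cx ->] := @mvt0 _ _ x d; first by rewrite sin0 subrr.
rewrite normrM exprSr ler_wpM2r//.
apply: (le_trans (norm_1Bcos_le c)).
by rewrite -[c ^+ 2]real_normK ?num_real// ler_sqr ?nnegrE.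
Qed.

Lemma norm_cos_taylor x : `|cos x - (1 - x ^+ 2 / 2)| <= `|x| ^+ 4.
Proof.
have d z : is_derive z (1 : R) (fun x => cos x - (1 - x ^+ 2 / 2)) (z - sin z).
  by apply: is_derive_eq; rewrite /GRing.scale/=; field.
have [|c cx ->] := @mvt0 _ _ x d; first by rewrite cos0 expr0n/= mul0r subr0 subrr.
rewrite normrM exprSr ler_wpM2r//.
apply: (le_trans (norm_xBsin_le c)).
by rewrite lerXn2r ?nnegrE.
Qed.

Lemma norm_expRN_taylor y : 0 <= y -> `|expR (- y) - (1 - y)| <= y ^+ 2.
Proof.
move=> y0; have h1 := expR_ge1Dx (- y); have h2 := expR_ge1Dx y.
have e := expRxMexpNx_1 y; have p := expR_gt0 (- y).
by rewrite ger0_norm; nra.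
Qed.

Lemma cvg_inv_sqrt : (Num.sqrt (n%:R : R))^-1 @[n --> \oo] --> (0 : R).
Proof.
apply/cvgr0Pnorm_lt => e e0; near=> n.
have n0 : 0 < n%:R :> R by rewrite ltr0n; near: n; exact: nbhs_infty_gt.
rewrite ger0_norm ?invr_ge0 ?sqrtr_ge0// invf_plt ?posrE ?sqrtr_gt0//.
have -> : e^-1 = Num.sqrt (e^-1 ^+ 2) by rewrite sqrtr_sqr ger0_norm ?invr_ge0 ?ltW.
rewrite ltr_sqrt//; near: n; exact: nbhs_infty_gtr.
Unshelve. all: by end_near. Qed.

End trigonometric_bounds.

Section clt.
Context {disp disp' : measure_display} {T : measurableType disp}
  {T' : measurableType disp'} {R : realType}.
Context (P : probability T R) (X : nat -> T -> T').
Hypotheses (mX : forall i, measurable_fun setT (X i))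
  (indX : mutually_independent P X).
Context (h : T' -> R) (v : R).
Hypothesis bh : bounded_measurable h.
Hypothesis mean0 : forall i, expect P (fun t => h (X i t)) = 0.
Hypothesis variance : forall i, expect P (fun t => h (X i t) ^+ 2) = v.

Local Lemma bm_hX i : bounded_measurable (fun t => h (X i t)).
Proof. by apply: bm_comp bh; exact: mX. Qed.

Lemma iid_second_moment (n : nat) :
  expect P (fun t => (\sum_(i < n) h (X i t)) ^+ 2) = n%:R * v.
Proof.
elim: n => [|n IH].
  under eq_fun do rewrite big_ord0 expr0n.
  by rewrite expect_cst mul0r.
have bS : bounded_measurable (fun t => \sum_(i < n) h (X i t)).
  by apply: bm_sum => i _; exact: bm_hX.
have bX := bm_hX n.
have J12 : [set i | (i < n)%N] `&` [set n] = set0.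
  by apply/seteqP; split => // i [/= ik ki]; move: ik; rewrite ki ltnn.
have E0 : expect P (fun t => (\sum_(i < n) h (X i t)) * h (X n t)) = 0.
  have -> : expect P (fun t => (\sum_(i < n) h (X i t)) * h (X n t)) =
      expect P (fun t => \sum_(i < n) h (X i t)) * expect P (fun t => h (X n t)).
    apply: (expectM_subfamilies mX indX J12).
      apply: bm_sum => i _; apply: bm_comp bh.
      by apply: measurable_subfamily; exact: ltn_ord.
    by apply: bm_comp bh; apply: measurable_subfamily.
  by rewrite mean0 mulr0.
transitivity (expect P (fun t => (\sum_(i < n) h (X i t)) ^+ 2 +
    (2 * ((\sum_(i < n) h (X i t)) * h (X n t)) + h (X n t) ^+ 2))).
  congr (expect P _); apply/funext => t.
  by rewrite big_ord_recr/=; ring.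
have bSX : bounded_measurable (fun t => (\sum_(i < n) h (X i t)) * h (X n t)).
  exact: bmM.
rewrite expectD ?expectD ?expectZ ?E0 ?IH ?variance//; first by rewrite -[n.+1]addn1 natrD; ring.
- exact: bmZ.
- exact: bmX.
- exact: bmX.
- by apply: bmD; [exact: bmZ|exact: bmX].
Qed.

(** By independence the addition formula of the cosine splits off one summand at
    a time. The mean of its cosine is [expR (- (c ^+ 2 * v / 2))] up to Taylor
    errors, and the mean of its sine is of third order by centring. *)
Local Lemma cos_partial_sum (K c th : R) (k : nat) :
  (forall x, `|h x| <= K) -> 0 <= c ->
  `|expect P (fun t => cos (th + c * \sum_(i < k) h (X i t))) -
    expR (- (c ^+ 2 * v / 2)) ^+ k * cos th| <=
  k%:R * ((c * K) ^+ 4 + (c * K) ^+ 3 + (c ^+ 2 * v / 2) ^+ 2).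
Proof.
move=> hK c0; set r := expR _; set e := _ + _ + _.
have v0 : 0 <= v by rewrite -(variance 0); apply: expect_ge0 => t; exact: sqr_ge0.
have K0 (t : T) : 0 <= K by exact: le_trans (normr_ge0 _) (hK (X 0 t)).
have ch i t : `|c * h (X i t)| <= c * K by rewrite normrM ger0_norm// ler_wpM2l.
have bY i : bounded_measurable (fun t => c * h (X i t)) by apply: bmZ; exact: bm_hX.
have r01 : 0 <= r <= 1.
  by rewrite expR_ge0/= -expR0 ler_expR oppr_le0 divr_ge0// mulr_ge0// sqr_ge0.
have Ecos i : `|expect P (fun t => cos (c * h (X i t))) - r| <=
    (c * K) ^+ 4 + (c ^+ 2 * v / 2) ^+ 2.
  have b1 : bounded_measurable (fun t => 1 - (c ^+ 2 / 2) * h (X i t) ^+ 2).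
    by apply: bmB; [exact: bm_cst|apply: bmZ; apply: bmX; exact: bm_hX].
  have bc : bounded_measurable (fun t => cos (c * h (X i t))) by apply: bm_cos; case: (bY i).
  have E1 : expect P (fun t => 1 - (c ^+ 2 / 2) * h (X i t) ^+ 2) = 1 - c ^+ 2 * v / 2.
    rewrite expectB; [|exact: bm_cst|by apply: bmZ; apply: bmX; exact: bm_hX].
    rewrite expect_cst expectZ; last by apply: bmX; exact: bm_hX.
    by rewrite variance mulrAC.
  have := norm_expRN_taylor (y := c ^+ 2 * v / 2); rewrite -/r => /(_ _) hr.
  have {}hr : `|r - (1 - c ^+ 2 * v / 2)| <= (c ^+ 2 * v / 2) ^+ 2.
    by apply: hr; rewrite divr_ge0// mulr_ge0// sqr_ge0.
  have hc : `|expect P (fun t => cos (c * h (X i t))) - (1 - c ^+ 2 * v / 2)| <= (c * K) ^+ 4.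
    rewrite -E1 -expectB//; apply: (le_trans (norm_expect _ (bmB bc b1))).
    apply: expect_le_cst; first by apply: bm_norm; exact: bmB.
    move=> t; have -> : c ^+ 2 / 2 * h (X i t) ^+ 2 = (c * h (X i t)) ^+ 2 / 2.
      by rewrite exprMn mulrAC.
    apply: (le_trans (norm_cos_taylor _)).
    by rewrite lerXn2r ?nnegrE ?mulr_ge0 ?(K0 t).
  rewrite (_ : expect _ _ - r = (expect P (fun t => cos (c * h (X i t))) - (1 - c ^+ 2 * v / 2)) -
    (r - (1 - c ^+ 2 * v / 2))); last by ring.
  by rewrite (le_trans (ler_normB _ _))// lerD.
have Esin i : `|expect P (fun t => sin (c * h (X i t)))| <= (c * K) ^+ 3.
  have bs : bounded_measurable (fun t => sin (c * h (X i t))) by apply: bm_sin; case: (bY i).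
  have E0 : expect P (fun t => c * h (X i t)) = 0.
    by rewrite expectZ ?mean0 ?mulr0//; exact: bm_hX.
  rewrite -[X in `|X|]subr0 -E0 -expectB//.
  apply: (le_trans (norm_expect _ (bmB bs (bY i)))).
  apply: expect_le_cst; first by apply: bm_norm; exact: bmB.
  move=> t; rewrite distrC; apply: (le_trans (norm_xBsin_le _)).
  by rewrite lerXn2r ?nnegrE ?mulr_ge0 ?(K0 t).
elim: k => [|k IH].
  rewrite mul0r expr0 mul1r.
  under eq_fun do rewrite big_ord0 mulr0 addr0.
  by rewrite expect_cst subrr normr0.
pose J1 : set nat := [set i | (i < k)%N].
pose J2 : set nat := [set i | i = k].
have J12 : J1 `&` J2 = set0.
  by apply/seteqP; split => // i [/= ik ki]; move: ik; rewrite ki /J1/= ltnn.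
have mS : measurable_fun setT
    ((fun t => th + c * \sum_(i < k) h (X i t)) : subfamily X J1 -> R).
  apply: measurable_funD => //; apply: measurable_funM => //.
  apply: measurable_sum => i; apply: (measurableT_comp bh.1).
  by apply: measurable_subfamily; exact: ltn_ord.
have mk : measurable_fun setT ((fun t => c * h (X k t)) : subfamily X J2 -> R).
  apply: measurable_funM => //; apply: (measurableT_comp bh.1).
  exact: measurable_subfamily.
have mS' := measurable_of_subfamily mX mS.
have split_cos : expect P (fun t => cos (th + c * \sum_(i < k.+1) h (X i t))) =
    expect P (fun t => cos (th + c * \sum_(i < k) h (X i t))) *
      expect P (fun t => cos (c * h (X k t))) -
    expect P (fun t => sin (th + c * \sum_(i < k) h (X i t))) *
      expect P (fun t => sin (c * h (X k t))).
  rewrite -(expectM_subfamilies mX indX J12 (bm_cos mS) (bm_cos mk)).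
  rewrite -(expectM_subfamilies mX indX J12 (bm_sin mS) (bm_sin mk)).
  rewrite -expectB.
  - congr (expect P _); apply/funext => t.
    by rewrite big_ord_recr/= mulrDr addrA (cosD (th + _)).
  - by apply: bmM; apply: bm_cos => //; case: (bY k).
  - by apply: bmM; apply: bm_sin => //; case: (bY k).
rewrite split_cos exprS.
move: IH (Ecos k) (Esin k); set A := expect P _; set B := expect P _.
set D := expect P (fun t => sin (c * _)) => IH EB ED.
have A1 : `|A| <= 1.
  apply: (le_trans (norm_expect _ (bm_cos mS'))); apply: expect_le_cst.
    by apply: bm_norm; exact: bm_cos.
  by move=> t; exact: cos_max.
have S1 : `|expect P (fun t => sin (th + c * \sum_(i < k) h (X i t)))| <= 1.
  apply: (le_trans (norm_expect _ (bm_sin mS'))); apply: expect_le_cst.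
    by apply: bm_norm; exact: bm_sin.
  by move=> t; exact: sin_max.
move: S1; set U := expect P _ => S1.
have -> : A * B - U * D - r * r ^+ k * cos th =
  (A * (B - r) - U * D) + r * (A - r ^+ k * cos th) by ring.
rewrite -addn1 natrD mulrDl mul1r addrC; apply: (le_trans (ler_normD _ _)); apply: lerD.
  rewrite normrM; case/andP: r01 => r0 r1; rewrite (ger0_norm r0).
  by apply: le_trans IH; rewrite ler_piMl.
apply: (le_trans (ler_normB _ _)); rewrite !normrM /e addrAC; apply: lerD.
  by apply: le_trans EB; rewrite ler_piMl.
by apply: le_trans ED; rewrite ler_piMl.
Qed.

(** The errors of the [n] factors are of order [n ^ (- 3 / 2)] each. *)
Lemma clt_cos (th : R) :
  expect P (fun t => cos (th + (Num.sqrt n%:R)^-1 * \sum_(i < n) h (X i t)))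
    @[n --> \oo] --> cos th * expR (- (v / 2)).
Proof.
have [mh [K hK]] := bh.
have hK' x : `|h x| <= `|K| by exact: le_trans (hK x) (ler_norm _).
have v0 : 0 <= v by rewrite -(variance 0); apply: expect_ge0 => t; exact: sqr_ge0.
pose C := `|K| ^+ 4 + `|K| ^+ 3 + (v / 2) ^+ 2.
have C0 : 0 <= C by rewrite /C !addr_ge0 ?sqr_ge0 ?exprn_ge0.
apply/cvgrPdist_le => e e0.
have /cvgr0Pnorm_lt lim0 : C * (Num.sqrt (n%:R : R))^-1 @[n --> \oo] --> (0 : R).
  rewrite -[X in _ --> X](mulr0 C); apply: cvgM; first exact: cvg_cst.
  exact: cvg_inv_sqrt.
have {}lim0 := lim0 _ e0.
near=> n.
have lime : `|C * (Num.sqrt (n%:R : R))^-1| < e by near: n; exact: lim0.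
have n1 : 1 <= n%:R :> R by rewrite ler1n; near: n; exact: nbhs_infty_gt.
have n0 : 0 < n%:R :> R by apply: lt_le_trans n1.
pose c := (Num.sqrt (n%:R : R))^-1.
have c0 : 0 <= c by rewrite invr_ge0 sqrtr_ge0.
have c1 : c <= 1.
  by rewrite invf_le1 ?sqrtr_gt0// -[leLHS](sqrtr1 R) ler_sqrt// ltW.
have c2 : n%:R * c ^+ 2 = 1.
  by rewrite exprVn sqr_sqrtr ?ltW// divff// gt_eqF.
have := @cos_partial_sum `|K| c th n hK' c0.
have -> : expR (- (c ^+ 2 * v / 2)) ^+ n = expR (- (v / 2)).
  rewrite -expRM_natl; congr expR.
  transitivity (- (n%:R * c ^+ 2 * v / 2)); last by rewrite c2 mul1r.
  by rewrite mulrN !mulrA.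
rewrite distrC [_ * cos th]mulrC => /le_trans; apply.
apply: (@le_trans _ _ (C * c)); last first.
  move: lime; rewrite -/c.
  by rewrite ger0_norm ?mulr_ge0// => /ltW.
have c3 : c ^+ 2 <= c by rewrite expr2 ler_piMl.
have -> : n%:R * ((c * `|K|) ^+ 4 + (c * `|K|) ^+ 3 + (c ^+ 2 * v / 2) ^+ 2) =
  (n%:R * c ^+ 2) * (`|K| ^+ 4 * c ^+ 2 + `|K| ^+ 3 * c + (v / 2) ^+ 2 * c ^+ 2) by ring.
rewrite c2 mul1r /C !mulrDl !lerD// ler_wpM2l ?sqr_ge0 ?exprn_ge0.
Unshelve. all: by end_near. Qed.

End clt.

(** * The array of observations under independence *)

Lemma measurable_eqset {disp : measure_display} {T : measurableType disp}
  (A B : set T) : A = B -> measurable A -> measurable B.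
Proof. by move=> ->. Qed.

Section observations.
Context {R : realType} {d : nat}.
Context {disp0 : measure_display} {Omega0 : measurableType disp0}
  {P0 : probability Omega0 R} (X : {RV P0 >-> d.-tuple R}).
Context {disp : measure_display} {Omega : measurableType disp}
  (P : probability Omega R) (Xs : nat -> {RV P >-> d.-tuple R}).
Hypothesis hF : forall j : 'I_d, continuous (marginal_cdf X j).
Hypothesis hX_ind : mutually_independent P0 (fun (j : 'I_d) t => tnth (X t) j).
Hypothesis hXs_law : forall i, same_distribution (Xs i) X.
Hypothesis hXs_ind : mutually_independent P (fun i t => Xs i t).

Definition entry (ij : nat * 'I_d) (t : Omega) : R := tnth (Xs ij.1 t) ij.2.

Lemma measurable_entry ij : measurable_fun setT (entry ij).
Proof.
apply: (measurableT_comp (measurable_tnth (T := R) ij.2)).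
exact: measurable_funPT.
Qed.

Local Lemma entry_law (i : nat) (j : 'I_d) (A : set R) : measurable A ->
  P (entry (i, j) @^-1` A) = P0 ((fun t => tnth (X t) j) @^-1` A).
Proof.
move=> mA; have mB : measurable [set x : d.-tuple R | A (tnth x j)].
  by have := measurable_tnth (T := R) j measurableT mA; rewrite setTI.
exact: (hXs_law i mB).
Qed.

Lemma row_box (i : nat) (A : 'I_d -> set R) : (forall j, measurable (A j)) ->
  P [set t | forall j, A j (entry (i, j) t)] =
  (\prod_(j < d) P (entry (i, j) @^-1` A j))%E.
Proof.
move=> mA; transitivity (P0 [set t | forall j, A j (tnth (X t) j)]).
  exact: (hXs_law i (measurable_box mA)).
have -> : [set t | forall j, A j (tnth (X t) j)] =
    \bigcap_(j in [set` index_enum 'I_d]) ((fun t => tnth (X t) j) @^-1` A j).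
  apply/seteqP; split => t h j => [_|]; first exact: h.
  by apply: h => /=; rewrite mem_index_enum.
rewrite hX_ind ?index_enum_uniq//.
by apply: eq_bigr => j _; rewrite entry_law.
Qed.

Lemma entry_independent : mutually_independent P entry.
Proof.
move=> s A us mA.
pose A' ij := if ij \in s then A ij else setT.
have mA' ij : measurable (A' ij) by rewrite /A'; case: ifP => // /mA.
pose u := undup [seq ij.1 | ij <- s].
pose box i := [set x : d.-tuple R | forall j, A' (i, j) (tnth x j)].
have -> : \bigcap_(ij in [set` s]) (entry ij @^-1` A ij) =
    \bigcap_(i in [set` u]) ((fun t => Xs i t) @^-1` box i).
  apply/seteqP; split => t h.
    move=> i /= iu j; rewrite /A'; case: ifP => // ijs.
    exact: (h (i, j)).
  move=> [i j] /= ijs; have iu : i \in u.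
    by rewrite mem_undup; apply/mapP; exists (i, j).
  by have := h i iu j; rewrite /A' ijs.
rewrite hXs_ind ?undup_uniq//; last by move=> i _; exact: (measurable_box (fun j => mA' (i, j))).
under eq_bigr => i _.
  rewrite (_ : P _ = (\prod_(j < d) P (entry (i, j) @^-1` A' (i, j)))%E); last first.
    by rewrite -row_box.
  over.
rewrite -(big_allpairs (F := fun ij => P (entry ij @^-1` A' ij))).
set r := (X in (\big[_/_]_(i <- X) _)%E).
have ur : uniq r.
  apply: allpairs_uniq; [exact: undup_uniq|exact: index_enum_uniq|].
  by move=> [a b] [a' b'] _ _ /= [-> ->].
rewrite (bigID (fun ij => ij \in s))/= [X in (_ * X)%E]big1 ?mule1; last first.
  by move=> ij /negbTE ijs; rewrite /A' ijs preimage_setT probability_setT.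
rewrite -big_filter (perm_big s)/=; last first.
  apply: uniq_perm => //; first exact: filter_uniq.
  move=> [i j]; rewrite mem_filter; apply: andb_idr => ijs.
  apply/allpairsP; exists (i, j); split => //=; last exact: mem_index_enum.
  by rewrite mem_undup; apply/mapP; exists (i, j).
by rewrite big_seq [RHS]big_seq; apply: eq_bigr => ij ijs; rewrite /A' ijs.
Qed.

Local Notation F := (marginal_cdf X).

Local Lemma cdf_prob (i : nat) (j : 'I_d) x :
  P [set t | entry (i, j) t <= x] = (F j x)%:E.
Proof.
rewrite /marginal_cdf fineK; last by rewrite fin_num_measure.
rewrite (_ : [set t | _] = entry (i, j) @^-1` `]-oo, x]%classic); last first.
  by apply/seteqP; split => t; rewrite /= in_itv.
by rewrite entry_law.
Qed.

Lemma marginal_cdf_itv j x : 0 <= F j x <= 1.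
Proof.
have h := cdf_prob 0 j x.
rewrite -!lee_fin -h measure_ge0 probability_le1//.
have := measurable_entry (0%N, j) measurableT (measurable_itv `]-oo, x]).
by rewrite setTI; apply: measurable_eqset; apply/seteqP; split => t; rewrite /= in_itv.
Qed.

Lemma marginal_cdf_le j x y : x <= y -> F j x <= F j y.
Proof.
move=> xy; rewrite /marginal_cdf fine_le ?fin_num_measure//.
exact: cdf_nondecreasing.
Qed.

Lemma measurable_marginal_cdf j : measurable_fun setT (F j).
Proof. exact: continuous_measurable_fun. Qed.

Local Lemma marginal_cdf_onto j (u : R) : 0 < u < 1 -> exists x, F j x = u.
Proof.
move=> /andP[u0 u1].
pose Y : {RV P0 >-> R} := (@tuple_coord R d j \o X : {mfun _ >-> R}).
have [a ha] : exists a, F j a < u.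
  have : cdf Y @ -oo%R --> (0 : \bar R)%E by exact: cvg_cdfNy0.
  move=> /fine_cvgP[_ /cvgr0Pnorm_lt/(_ _ u0)] [M [_ hM]].
  exists (M - 1); have := hM (M - 1); rewrite gtrBl ltr01 => /(_ isT).
  by move/(le_lt_trans (ler_norm _)).
have [b hb] : exists b, u < F j b.
  have : cdf Y @ +oo%R --> (1 : \bar R)%E by exact: cvg_cdfy1.
  move=> /fine_cvgP[_ h1].
  have e0 : 0 < 1 - u by rewrite subr_gt0.
  move/cvgrPdist_lt : h1 => /(_ _ e0)[M [_ hM]].
  exists (M + 1); have := hM (M + 1); rewrite ltrDl ltr01 => /(_ isT).
  by move/(le_lt_trans (ler_norm _)); rewrite /=/marginal_cdf -/Y; lra.
have ab : a <= b.
  rewrite leNgt; apply/negP => /ltW/(marginal_cdf_le j); lra.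
have [|c _ <-] := @IVT R (F j) a b u ab (continuous_subspaceT (@hF j)).
  by rewrite ge_min le_max (ltW ha) (ltW hb) orbT.
by exists c.
Qed.

Lemma measurable_cdf_event (i : nat) (j : 'I_d) u :
  measurable [set t | F j (entry (i, j) t) <= u].
Proof.
have mFe : measurable_fun setT (fun t => F j (entry (i, j) t)).
  by apply: measurableT_comp; [exact: measurable_marginal_cdf|exact: measurable_entry].
have := mFe measurableT _ (measurable_itv `]-oo, u]).
by rewrite setTI; apply: measurable_eqset; apply/seteqP; split => t; rewrite /= in_itv.
Qed.

(** The probability integral transform. *)
Lemma cdf_entry_uniform (i : nat) (j : 'I_d) (u : R) : 0 <= u <= 1 ->
  P [set t | F j (entry (i, j) t) <= u] = u%:E.
Proof.
move=> /andP[u0 u1].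
have mle x : measurable [set t | entry (i, j) t <= x].
  have := measurable_entry (i, j) measurableT (measurable_itv `]-oo, x]).
  by rewrite setTI; apply: measurable_eqset; apply/seteqP; split => t; rewrite /= in_itv.
move: u1; rewrite le_eqVlt => /orP[/eqP ->|u1].
  rewrite (_ : [set t | _] = setT) ?probability_setT//.
  by apply/seteqP; split => // t _ /=; case/andP: (marginal_cdf_itv j (entry (i, j) t)).
apply/eqP; rewrite eq_le; apply/andP; split.
  apply/lee_addgt0Pr => e e0.
  pose u' := Num.min (u + e) ((u + 1) / 2).
  have u'1 : 0 < u' < 1.
    by rewrite /u' lt_min gt_min; apply/andP; split; [apply/andP; split; lra|apply/orP; right; lra].
  have uu' : u < u' by rewrite /u' lt_min; apply/andP; split; lra.
  have [x hx] := marginal_cdf_onto j u'1.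
  apply: (@le_trans _ _ u'%:E); last by rewrite -EFinD lee_fin /u' ge_min lexx.
  rewrite -hx -(cdf_prob i); apply: le_measure; rewrite ?inE//; first exact: measurable_cdf_event.
  move=> t /= h; rewrite leNgt; apply/negP => /ltW /(marginal_cdf_le j); lra.
have [u00|u0'] := leP u 0.
  by apply: le_trans (measure_ge0 _ _); rewrite lee_fin.
have [x hx] := marginal_cdf_onto j (introT andP (conj u0' u1)).
rewrite -{1}hx -(cdf_prob i); apply: le_measure; rewrite ?inE//; first exact: measurable_cdf_event.
by move=> t /= /(marginal_cdf_le j); rewrite hx.
Qed.

Lemma measurable_tie i i' j :
  measurable [set t | entry (i, j) t = entry (i', j) t].
Proof.
have mD : measurable_fun setT (fun t => entry (i, j) t - entry (i', j) t).
  by apply: measurable_funB; exact: measurable_entry.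
have := mD measurableT [set 0] (measurable_set1 0).
rewrite setTI; apply: measurable_eqset; apply/seteqP; split => t /=.
  by move/eqP; rewrite subr_eq0 => /eqP.
by move=> ->; rewrite subrr.
Qed.

(** Two tied observations fall into the same of [N] cells of probability
    [1 / N], which has probability [1 / N]. *)
Lemma tie_null (i i' : nat) (j : 'I_d) : i != i' ->
  P [set t | entry (i, j) t = entry (i', j) t] = 0%E.
Proof.
move=> ii'; apply/eqP; rewrite eq_le measure_ge0 andbT.
apply/lee_addgt0Pr => e e0; rewrite add0e.
have [N hN] : exists N : nat, e^-1 <= N.+1%:R.
  near \oo => N; exists N; apply: (@le_trans _ _ N%:R); last by rewrite ler_nat.
  by near: N; exact: nbhs_infty_ger.
have N0 : 0 < N.+1%:R :> R by [].
pose c (k : nat) : set R := [set x | k%:R / N.+1%:R < F j x <= k.+1%:R / N.+1%:R].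
have mFj := measurable_marginal_cdf j.
have mc k : measurable (c k).
  have := mFj measurableT _ (measurable_itv `]k%:R / N.+1%:R, k.+1%:R / N.+1%:R]).
  by rewrite setTI; apply: measurable_eqset; apply/seteqP; split => x; rewrite /= in_itv.
have Pc l k : (k < N.+1)%N -> P (entry (l, j) @^-1` c k) = (N.+1%:R^-1)%:E.
  move=> kN; have k0 : 0 <= k%:R / N.+1%:R :> R by rewrite divr_ge0.
  have k1 : k.+1%:R / N.+1%:R <= 1 :> R by rewrite ler_pdivrMr// mul1r ler_nat.
  have kk : k.+1%:R / N.+1%:R = k%:R / N.+1%:R + N.+1%:R^-1 :> R.
    by rewrite -[k.+1]addn1 natrD mulrDl mul1r.
  have Ni : 0 <= N.+1%:R^-1 :> R by rewrite invr_ge0.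
  have -> : entry (l, j) @^-1` c k =
      [set t | F j (entry (l, j) t) <= k.+1%:R / N.+1%:R] `\`
      [set t | F j (entry (l, j) t) <= k%:R / N.+1%:R].
    apply/seteqP; split => t /=; first by move=> /andP[h ->]; rewrite leNgt h.
    by move=> [h /negP]; rewrite -ltNge => h'; rewrite /c/= h' h.
  rewrite measureD; [|exact: measurable_cdf_event|exact: measurable_cdf_event|]; last first.
    by rewrite ltey_eq fin_num_measure//; exact: measurable_cdf_event.
  rewrite setIidr; last by move=> t /= h; apply: (le_trans h); rewrite kk lerDl.
  transitivity ((k.+1%:R / N.+1%:R : R)%:E - (k%:R / N.+1%:R : R)%:E)%E.
    congr (_ - _)%E; apply: cdf_entry_uniform.
      by rewrite k1 kk addr_ge0.
    by rewrite k0/= (le_trans _ k1)// kk lerDl.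
  by rewrite -EFinB kk addrAC subrr add0r.
pose Z := [set t | F j (entry (i, j) t) <= 0].
pose D k := (entry (i, j) @^-1` c k) `&` (entry (i', j) @^-1` c k).
have mcE l k : measurable (entry (l, j) @^-1` c k).
  by have := measurable_entry (l, j) measurableT (mc k); rewrite setTI.
have mD k : measurable (D k) by exact: measurableI.
have sub : [set t | entry (i, j) t = entry (i', j) t] `<=` Z `|` \big[setU/set0]_(k < N.+1) D k.
  move=> t /= tie; have /andP[F0 F1] := marginal_cdf_itv j (entry (i, j) t).
  have [|Fpos] := leP (F j (entry (i, j) t)) 0; first by left.
  right; rewrite -bigcup_mkord.
  have ex : exists k : nat, F j (entry (i, j) t) <= k%:R / N.+1%:R.
    by exists N.+1; rewrite divff// gt_eqF.
  have exb : exists k : nat, (fun k : nat => F j (entry (i, j) t) <= k%:R / N.+1%:R) k by [].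
  case: (ex_minnP exb) => -[|k] hk hmin.
    by move: hk; rewrite mul0r leNgt Fpos.
  exists k => /=.
    by apply: hmin; rewrite divff// gt_eqF.
  have ck : c k (entry (i, j) t).
    rewrite /c/= hk andbT ltNge; apply/negP => /hmin; by rewrite ltnn.
  by split => //; rewrite /preimage/= -tie.
apply: (@le_trans _ _ (P (Z `|` \big[setU/set0]_(k < N.+1) D k))).
  apply: le_measure => //; rewrite inE; first exact: measurable_tie.
  by apply: measurableU; [exact: measurable_cdf_event|exact: bigsetU_measurable].
apply: (le_trans (measureU2 _ _ _)); [exact: measurable_cdf_event|exact: bigsetU_measurable|].
rewrite [X in (X + _)%E]cdf_entry_uniform ?lexx ?ler01// add0e.
apply: (le_trans (Boole_inequality _ _)) => //.
rewrite (eq_bigr (fun _ => (N.+1%:R^-1 * N.+1%:R^-1)%:E)); last first.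
  move=> k _; rewrite EFinM -{1}(Pc i k (ltn_ord k)) -(Pc i' k (ltn_ord k)).
  have := entry_independent (s := [:: (i, j); (i', j)]) (A := fun _ => c k).
  rewrite !big_cons big_nil mule1 => <-//.
  - congr (P _); apply/seteqP; split => t.
      by move=> [h1 h2] ij /=; rewrite !inE => /orP[/eqP ->|/eqP ->].
    by move=> h; split; apply: h; rewrite /= !inE eqxx ?orbT.
  - by rewrite /= inE xpair_eqE (negbTE ii').
rewrite sumEFin lee_fin sumr_const card_ord -[X in X <= _]mulr_natr mulfVK ?gt_eqF//.
by rewrite -[leRHS]invrK lef_pV2// ?posrE ?invr_gt0.
Unshelve. all: by end_near. Qed.

End observations.

(** * Algebra of products of indicators *)

Section product_expansions.
Context {R : realType}.

Lemma sqr_sum_le (I : finType) (x : I -> R) :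
  (\sum_i x i) ^+ 2 <= #|I|%:R * \sum_i x i ^+ 2.
Proof.
have -> : (\sum_i x i) ^+ 2 = \sum_i \sum_j x i * x j.
  by rewrite expr2 mulr_suml; apply: eq_bigr => i _; rewrite mulr_sumr.
apply: (@le_trans _ _ (\sum_i \sum_j (x i ^+ 2 + x j ^+ 2) / 2)).
  apply: ler_sum => i _; apply: ler_sum => j _.
  by have := sqr_ge0 (x i - x j); rewrite sqrrB; lra.
have e : \sum_i \sum_j (x i ^+ 2 + x j ^+ 2) / 2 = #|I|%:R * \sum_i x i ^+ 2.
  under eq_bigr do rewrite -mulr_suml big_split/= sumr_const.
  rewrite -mulr_suml big_split/= sumr_const sumrMnl -mulr_natl.
  by field.
by rewrite e.
Qed.

Lemma telescope_prod (n : nat) (x y : 'I_n -> R) :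
  \prod_j x j - \prod_j y j =
  \sum_l (x l - y l) * \prod_(j | j != l) (if (j < l)%N then x j else y j).
Proof.
elim: n x y => [|n IH] x y; first by rewrite !big_ord0 subrr.
rewrite !big_ord_recr/= [X in _ + _ * X](_ : _ = \prod_(i < n) x (widen_ord (leqnSn n) i)); last first.
  rewrite big_mkcond big_ord_recr/= eqxx/= mulr1; apply: eq_bigr => i _.
  rewrite -val_eqE/= ltn_eqF ?ltn_ord//=.
pose X := \prod_(i < n) x (widen_ord (leqnSn n) i).
pose Y := \prod_(i < n) y (widen_ord (leqnSn n) i).
rewrite -/X -/Y (_ : _ - _ = y ord_max * (X - Y) + (x ord_max - y ord_max) * X); last by ring.
congr (_ + _); rewrite /X /Y IH mulr_sumr; apply: eq_bigr => l _.
rewrite mulrCA; congr (_ * _).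
rewrite [RHS]big_mkcond big_ord_recr/= -[ord_max == _]val_eqE/= gtn_eqF ?ltn_ord//=.
rewrite ltnNge ltnW ?ltn_ord//= mulrC; congr (_ * _).
by rewrite big_mkcond; apply: eq_bigr => i _; rewrite -val_eqE.
Qed.

(** What remains of [\prod_j c j] after subtracting its value at [p] and its
    first-order expansion around [p]. *)
Definition taylor_remainder (n : nat) (p c : 'I_n -> R) : R :=
  \prod_j c j - \prod_j p j -
  \sum_k (\prod_(j | j != k) p j) * (c k - p k).

(** The hybrids of [a] and [b] through which the two products telescope. *)
Definition mix (n : nat) (a b : 'I_n -> R) (k j : 'I_n) : R :=
  if (j < k)%N then a j else b j.

Definition mix_weight (n : nat) (p a b : 'I_n -> R) (k l : 'I_n) : R :=
  \prod_(j | j != l) (if j == k then 1 else if (j < l)%N then mix a b k j else p j).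

(** Each term carries two small factors sitting in different coordinates
    [k != l], which is why the remainder is insensitive to replacing [b] by
    [a]. *)
Lemma taylor_remainderB (n : nat) (p a b : 'I_n -> R) :
  taylor_remainder p a - taylor_remainder p b =
  \sum_k \sum_(l | l != k) (mix a b k l - p l) *
    ((a k - b k) * mix_weight p a b k l).
Proof.
have -> : taylor_remainder p a - taylor_remainder p b =
    (\prod_j a j - \prod_j b j) - \sum_k (\prod_(j | j != k) p j) * (a k - b k).
  have -> : \sum_k (\prod_(j | j != k) p j) * (a k - b k) =
      \sum_k (\prod_(j | j != k) p j) * (a k - p k)
      - \sum_k (\prod_(j | j != k) p j) * (b k - p k).
    by rewrite -sumrB; apply: eq_bigr => k _; ring.
  by rewrite /taylor_remainder; ring.
rewrite telescope_prod -sumrB; apply: eq_bigr => k _.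
rewrite [_ * (a k - b k)]mulrC -mulrBr.
pose x j := if j == k then 1 else mix a b k j.
pose y j := if j == k then 1 else p j.
rewrite [X in _ * (X - _)](_ : _ = \prod_j x j); last first.
  by rewrite big_mkcond; apply: eq_bigr => j _; rewrite /x/mix; case: eqP.
rewrite [X in _ * (_ - X)](_ : _ = \prod_j y j); last first.
  by rewrite big_mkcond; apply: eq_bigr => j _; rewrite /y; case: eqP.
rewrite telescope_prod mulr_sumr (bigD1 k)//= {1}/x {1}/y eqxx subrr mul0r mulr0 add0r.
apply: eq_bigr => l lk; rewrite {1}/x {1}/y (negbTE lk) mulrCA.
congr (_ * (_ * _)); apply: eq_bigr => j _.
by rewrite /x /y; case: eqP => //; case: ifP.
Qed.

Lemma mix_weight_itv (n : nat) (p a b : 'I_n -> R) (k l : 'I_n) :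
  (forall j, 0 <= p j <= 1) -> (forall j, 0 <= a j <= 1) ->
  (forall j, 0 <= b j <= 1) -> 0 <= mix_weight p a b k l <= 1.
Proof.
move=> p01 a01 b01.
have f01 j : 0 <= (if j == k then 1 else if (j < l)%N then mix a b k j else p j) <= 1.
  case: ifP => _; first by rewrite ler01 lexx.
  by rewrite /mix; case: ifP => _ //; case: ifP.
apply/andP; split; first by apply: prodr_ge0 => j _; case/andP: (f01 j).
by apply: prodr_ile1 => j _; exact: f01.
Qed.

End product_expansions.

(** * Ranks *)

Section ranks.
Context {R : realType}.

Definition rank_below (n : nat) (x : 'I_n -> R) (u : R) (i : 'I_n) : bool :=
  n%:R^-1 * \sum_(k < n) (x k <= x i)%R%:R <= u.

Lemma count_nat_le (n : nat) (y : R) : 0 <= y <= n%:R ->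
  `|\sum_(k < n) (k.+1%:R <= y)%R%:R - y| <= 1.
Proof.
move=> /andP[y0 yn].
pose S (m : nat) : R := \sum_(k < m) (k.+1%:R <= y)%R%:R.
have Sm m : S m <= m%:R.
  rewrite /S; apply: (@le_trans _ _ (\sum_(k < m) 1)).
    by apply: ler_sum => k _; rewrite (ler_nat _ _ 1) leq_b1.
  by rewrite sumr_const card_ord.
have H m : S m <= y /\ (y < S m + 1 \/ S m = m%:R).
  elim: m => [|m [IH1 IH2]]; first by rewrite /S big_ord0; split => //; right.
  have -> : S m.+1 = S m + (m.+1%:R <= y)%R%:R by rewrite /S big_ord_recr.
  case: (leP m.+1%:R y) => my /=; last first.
    rewrite addr0; split => //; left; case: IH2 => // ->.
    by rewrite natr1.
  have -> : S m = m%:R.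
    case: IH2 => // h; apply/eqP; rewrite eq_le Sm/=.
    by rewrite -natr1 in my; lra.
  by rewrite natr1; split => //; right.
have [h1 h2] := H n; rewrite -/(S n) ler_norml; apply/andP; split; last by lra.
by case: h2 => [h2|h2]; lra.
Qed.

(** Without ties, ranks enumerate [1, ..., n], so exactly the integer part of
    [n u] of them are at most [n u]. *)
Lemma sum_rank_below (n : nat) (x : 'I_n -> R) (u : R) : injective x ->
  0 <= u <= 1 -> `|\sum_i (rank_below x u i)%:R - n%:R * u| <= 1.
Proof.
case: n x => [|n] x injx /andP[u0 u1]; first by rewrite big_ord0 mul0r subrr normr0.
pose rk (i : 'I_n.+1) := #|[pred k | x k <= x i]|.
have rkE i : \sum_(k < n.+1) (x k <= x i)%R%:R = (rk i)%:R :> R.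
  rewrite /rk -sum1_card natr_sum [RHS]big_mkcond/=.
  by apply: eq_bigr => k _; rewrite inE; case: ifP => // ->.
have rk0 i : (0 < rk i)%N by apply/card_gt0P; exists i; rewrite inE.
have rkn i : ((rk i).-1 < n.+1)%N.
  by rewrite prednK ?rk0// (leq_trans (max_card _))// card_ord.
pose f i := Ordinal (rkn i).
have rk_lt i i' : x i < x i' -> (rk i < rk i')%N.
  move=> ii'; apply: proper_card; apply/properP; split.
    by apply/fintype.subsetP => k; rewrite !inE => /le_trans; apply; exact: ltW.
  by exists i'; rewrite !inE ?lexx// -ltNge.
have injf : injective f.
  move=> i i' /(congr1 val)/=/(congr1 succn); rewrite !prednK ?rk0// => e.
  apply: injx; apply/eqP; rewrite eq_le !leNgt; apply/andP; split; apply/negP => /rk_lt.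
    by rewrite e ltnn.
  by rewrite e ltnn.
have -> : \sum_i (rank_below x u i)%:R = \sum_(k < n.+1) (k.+1%:R <= n.+1%:R * u)%R%:R :> R.
  rewrite [RHS](reindex_inj injf)/=; apply: eq_bigr => i _.
  rewrite /rank_below rkE prednK ?rk0//.
  by congr (_%:R); rewrite -ler_pdivrMl.
by apply: count_nat_le; rewrite mulr_ge0//= ler_piMr.
Qed.

(** Two sets of observations that are closed downwards are nested. *)
Lemma sum_norm_nested (n : nat) (x : 'I_n -> R) (a b : 'I_n -> bool) :
  (forall i k, x k <= x i -> a i -> a k) -> (forall i k, x k <= x i -> b i -> b k) ->
  \sum_i `|(a i)%:R - (b i)%:R| = `|\sum_i (a i)%:R - \sum_i (b i)%:R| :> R.
Proof.
move=> da db.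
have sub (p q : 'I_n -> bool) : (forall i, p i -> q i) ->
    \sum_i `|(q i)%:R - (p i)%:R| = `|\sum_i (q i)%:R - \sum_i (p i)%:R| :> R.
  move=> pq; rewrite -sumrB ger0_norm ?sumr_ge0// => [|i _].
    apply: eq_bigr => i _; rewrite ger0_norm// subr_ge0 ler_nat.
    by case: (p i) (pq i) => // ->.
  by rewrite subr_ge0 ler_nat; case: (p i) (pq i) => // ->.
have [ab|nab] := pselect (forall i, a i -> b i).
  rewrite distrC -(sub a b ab); apply: eq_bigr => i _; exact: distrC.
apply: sub => k bk; apply/negPn/negP => nak; apply: nab => i ai.
have [xx|/ltW xx] := leP (x k) (x i).
  by move: nak; rewrite (da i k).
exact: (db k i).
Qed.

Lemma rank_below_down (n : nat) (x : 'I_n -> R) u i k :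
  x k <= x i -> rank_below x u i -> rank_below x u k.
Proof.
move=> ki; apply: le_trans; rewrite ler_wpM2l// ler_sum// => l _.
by rewrite ler_nat; case: (leP (x l) (x k)) => // /le_trans/(_ ki) ->.
Qed.

Lemma rank_below_perm (n : nat) (x : 'I_n -> R) u (s : 'S_n) i :
  rank_below (fun k => x (s k)) u i = rank_below x u (s i).
Proof.
rewrite /rank_below; congr (_ * _ <= _).
by rewrite [RHS](reindex_inj (@perm_inj _ s)).
Qed.

Lemma measurable_rank_below {disp : measure_display} {T : measurableType disp}
    (n : nat) (Z : 'I_n -> T -> R) (u : R) (i : 'I_n) :
  (forall k, measurable_fun setT (Z k)) ->
  measurable_fun setT (fun t => rank_below (Z ^~ t) u i).
Proof.
move=> mZ; apply: measurable_fun_ler; last exact: measurable_cst.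
apply: measurable_funM; first exact: measurable_cst.
apply: measurable_sum => k.
by apply: (bm_bool _).1; exact: measurable_fun_ler.
Qed.

End ranks.

(** * Decoupling *)

Section decoupling.
Context {R : realType} {disp : measure_display} {T : measurableType disp}.
Context (P : probability T R).

(** Centred, nearly uncorrelated variables [Z i] with an independent family of
    weights [G i]: the second moment of [\sum_i Z i * G i] is controlled by the
    diagonal, that is by the size of the weights. *)
Lemma decoupled_second_moment (n : nat) (Z G : 'I_n -> T -> R) (c : R) :
  (forall i, bounded_measurable (Z i)) -> (forall i, bounded_measurable (G i)) ->
  (forall i t, `|Z i t| <= 1) -> (forall i t, `|G i t| <= 1) ->
  (forall i i', expect P (fun t => (Z i t * Z i' t) * (G i t * G i' t)) =
    expect P (fun t => Z i t * Z i' t) * expect P (fun t => G i t * G i' t)) ->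
  (forall i i', i != i' -> expect P (fun t => Z i t * Z i' t) = c) ->
  expect P (fun t => (\sum_i Z i t) ^+ 2) <= n%:R ->
  expect P (fun t => (\sum_i Z i t * G i t) ^+ 2) <=
  2 * \sum_i expect P (fun t => `|G i t|).
Proof.
move=> bZ bG Z1 G1 ind hc hn.
have bZZ i i' : bounded_measurable (fun t => Z i t * Z i' t) by exact: bmM.
have bGG i i' : bounded_measurable (fun t => G i t * G i' t) by exact: bmM.
have sq (V : 'I_n -> T -> R) : (forall i i', bounded_measurable (fun t => V i t * V i' t)) ->
    expect P (fun t => (\sum_i V i t) ^+ 2) = \sum_i \sum_i' expect P (fun t => V i t * V i' t).
  move=> bV; rewrite -[RHS](eq_bigr _ (fun i _ => expect_sum _ _ (fun i' _ => bV i i'))).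
  rewrite -expect_sum; last by move=> i _; apply: bm_sum.
  congr (expect P _); apply/funext => t.
  by rewrite expr2 mulr_suml; apply: eq_bigr => i _; rewrite mulr_sumr.
have diag (h : 'I_n -> 'I_n -> R) i : \sum_i' h i i' = h i i + \sum_(i' | i' != i) h i i'.
  by rewrite (bigD1 i).
have offZ i : \sum_(i' | i' != i) expect P (fun t => Z i t * Z i' t) = n.-1%:R * c.
  rewrite (eq_bigr (fun _ => c)) => [|i' ii']; last by rewrite hc// eq_sym.
  by rewrite sumr_const cardC1 card_ord mulr_natl.
pose S := \sum_i expect P (fun t => Z i t * Z i t).
have S0 : 0 <= S <= n%:R.
  have b01 i : 0 <= expect P (fun t => Z i t * Z i t) <= 1.
    rewrite expect_ge0 /=; last by move=> t; rewrite -expr2 sqr_ge0.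
    apply: expect_le_cst => // t; apply: (le_trans (ler_norm _)).
    by rewrite normrM -[leRHS]mulr1 ler_pM.
  apply/andP; split; first by apply: sumr_ge0 => i _; case/andP: (b01 i).
  apply: (@le_trans _ _ (\sum_(i < n) 1)); last by rewrite sumr_const card_ord.
  by apply: ler_sum => i _; case/andP: (b01 i).
have nE : n%:R * (n.-1%:R * c) = (n.-1%:R * c) *+ n by rewrite [LHS]mulr_natl.
have hS : S + n%:R * (n.-1%:R * c) <= n%:R.
  apply: le_trans hn; rewrite sq//.
  under [leRHS]eq_bigr do rewrite (diag (fun i i' => expect P (fun t => Z i t * Z i' t))) offZ.
  by rewrite big_split/= sumr_const card_ord nE.
have hS' : 0 <= S + n%:R * (n.-1%:R * c).
  have <- : expect P (fun t => (\sum_i Z i t) ^+ 2) = S + n%:R * (n.-1%:R * c).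
    rewrite sq//.
    under eq_bigr do rewrite (diag (fun i i' => expect P (fun t => Z i t * Z i' t))) offZ.
    by rewrite big_split/= sumr_const card_ord nE.
  by apply: expect_ge0 => t; exact: sqr_ge0.
(* The common off-diagonal covariance is at most 1 / (n - 1). *)
have cn : `|c| * n.-1%:R <= 1 \/ n = 0%N.
  case: (posnP n) => [->|n0]; [by right|left].
  have n0' : 0 < n%:R :> R by rewrite ltr0n.
  rewrite -(ger0_norm (x := n.-1%:R))// -normrM ler_norml.
  case/andP: S0 => S0 S1.
  have h1 : n%:R * (c * n.-1%:R) <= n%:R * 1 by rewrite [c * _]mulrC mulr1; lra.
  have h2 : n%:R * (- 1) <= n%:R * (c * n.-1%:R) by rewrite [c * _]mulrC mulrN1; lra.
  by move: h1 h2; rewrite !ler_pM2l// => -> ->.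
case: cn => [cn|n0]; last first.
  subst n; rewrite !big_ord0 mulr0.
  under eq_fun do rewrite big_ord0 expr0n.
  by rewrite expect_cst.
rewrite (sq (fun i t => Z i t * G i t)); last first.
  by move=> i i'; apply: bmM; exact: bmM.
have indE i i' : expect P (fun t => Z i t * G i t * (Z i' t * G i' t)) =
    expect P (fun t => Z i t * Z i' t) * expect P (fun t => G i t * G i' t).
  rewrite -ind; congr (expect P _); apply/funext => t; ring.
have nG i i' : `|expect P (fun t => G i t * G i' t)| <= expect P (fun t => `|G i t|).
  apply: (le_trans (norm_expect _ (bGG i i'))).
  apply: le_expect; [exact: bm_norm|exact: bm_norm|] => t.
  by rewrite normrM ler_piMr.
have G0 i : 0 <= expect P (fun t => `|G i t|) by exact: expect_ge0.
rewrite mulr_sumr; apply: ler_sum => i _.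
rewrite (diag (fun i i' => expect P (fun t => Z i t * G i t * (Z i' t * G i' t)))).
set e := expect P (fun t => `|G i t|).
rewrite (_ : 2 * e = e + e); last by ring.
apply: lerD.
  rewrite indE; apply: (le_trans (ler_norm _)); rewrite normrM.
  rewrite -[leRHS]mul1r ler_pM//.
  apply: (le_trans (norm_expect _ (bZZ i i))).
  apply: expect_le_cst; first exact: bm_norm.
  by move=> t; rewrite normrM -[leRHS]mulr1 ler_pM.
apply: (@le_trans _ _ (\sum_(i' < n | i' != i) `|c| * e)).
  apply: ler_sum => i' ii'; rewrite indE hc ?[i == _]eq_sym//.
  by apply: (le_trans (ler_norm _)); rewrite normrM ler_wpM2l.
rewrite sumr_const cardC1 card_ord -mulr_natr mulrAC.
by rewrite -[leRHS]mul1r ler_wpM2r//; exact: G0.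
Qed.

End decoupling.

(** * Exchangeability within a coordinate *)

Section boxes.
Context {R : realType} (n : nat).

Definition boxes : set (set (n.-tuple R)) :=
  [set B | exists2 A : 'I_n -> set R, (forall i, measurable (A i)) &
    B = [set x | forall i, A i (tnth x i)]].

Local Lemma measurable_boxes : measurable = <<s boxes >>.
Proof.
apply/seteqP; split.
  apply: smallest_sub; first exact: smallest_sigma_algebra.
  apply: (@big_ind _ (fun S => S `<=` <<s boxes >>)) => //.
    by move=> A B hA hB x [/hA|/hB].
  move=> i _ _ [A mA <-]; apply: sub_sigma_algebra.
  exists (fun k => if k == i then A else setT); first by move=> k; case: ifP.
  rewrite setTI; apply/seteqP; split => x /=.
    by move=> xA k; case: eqP => // ->.
  by move=> /(_ i); rewrite eqxx.
apply: smallest_sub; first exact: sigma_algebra_measurable.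
by move=> _ [A mA ->]; exact: measurable_box.
Qed.

Local Lemma boxes_setI : setI_closed boxes.
Proof.
move=> _ _ [A mA ->] [A' mA' ->]; exists (fun i => A i `&` A' i).
  by move=> i; exact: measurableI.
apply/seteqP; split => x /=; first by move=> [h h'] i; split; [exact: h|exact: h'].
by move=> h; split => i; case: (h i).
Qed.

Lemma probability_boxes_unique (m1 m2 : probability (n.-tuple R) R) :
  (forall A : 'I_n -> set R, (forall i, measurable (A i)) ->
    m1 [set x | forall i, A i (tnth x i)] = m2 [set x | forall i, A i (tnth x i)]) ->
  forall B, measurable B -> m1 B = m2 B.
Proof.
move=> m12 B mB; apply: (measure_unique boxes (fun=> setT)) => //.
- exact: measurable_boxes.
- exact: boxes_setI.
- by move=> _; exists (fun=> setT) => //; apply/seteqP; split.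
- by rewrite bigcup_const.
- by move=> _ [A mA ->]; exact: m12.
- by move=> k; apply: (le_lt_trans (probability_le1 m1 measurableT)); rewrite ltry.
Qed.

End boxes.

Section rank_process.
Context {R : realType} {d : nat}.
Context {disp0 : measure_display} {Omega0 : measurableType disp0}
  {P0 : probability Omega0 R} (X : {RV P0 >-> d.-tuple R}).
Context {disp : measure_display} {Omega : measurableType disp}
  (P : probability Omega R) (Xs : nat -> {RV P >-> d.-tuple R}).
Hypothesis hF : forall j : 'I_d, continuous (marginal_cdf X j).
Hypothesis hX_ind : mutually_independent P0 (fun (j : 'I_d) t => tnth (X t) j).
Hypothesis hXs_law : forall i, same_distribution (Xs i) X.
Hypothesis hXs_ind : mutually_independent P (fun i t => Xs i t).
Local Notation F := (marginal_cdf X).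
Local Notation entry := (entry Xs).
Local Notation mE := (measurable_entry Xs).
Local Notation indE := (entry_independent hX_ind hXs_law hXs_ind).

Local Definition column (n : nat) (l : 'I_d) (t : Omega) : 'I_n -> R :=
  fun i => entry (val i, l) t.

Local Lemma column_exchange (n : nat) (l : 'I_d) (s : {perm 'I_n})
    (g : n.-tuple R -> R) : bounded_measurable g ->
  expect P (fun t => g [tuple column l t (s i) | i < n]) =
  expect P (fun t => g [tuple column l t i | i < n]).
Proof.
move=> bg.
have mV (r : {perm 'I_n}) : measurable_fun setT (fun t => [tuple column l t (r i) | i < n]).
  apply/measurable_fun_tnthP => i; apply: (eq_measurable_fun (entry (val (r i), l))).
    by move=> t _; rewrite /= tnth_mktuple.
  exact: mE.
pose V (r : {perm 'I_n}) : {RV P >-> n.-tuple R} :=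
  HB.pack (fun t => [tuple column l t (r i) | i < n]) (isMeasurableFun.Build _ _ _ _ _ (mV r)).
have lawV (r : {perm 'I_n}) (A : 'I_n -> set R) : (forall i, measurable (A i)) ->
    distribution P (V r) [set x | forall i, A i (tnth x i)] =
    (\prod_(i < n) P0 ((fun t => tnth (X t) l) @^-1` A i))%E.
  move=> mA; pose s' := [seq (val (r i), l) | i <- index_enum 'I_n].
  pose A' (ij : nat * 'I_d) := \bigcap_(i in [set i | val (r i) = ij.1]) A i.
  have A'E i : A' (val (r i), l) = A i.
    rewrite /A' (_ : [set _ | _] = [set i]) ?bigcap_set1//.
    by apply/seteqP; split => k /= => [/val_inj/perm_inj //|->].
  have us' : uniq s'.
    rewrite map_inj_uniq ?index_enum_uniq// => i i' [] /val_inj.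
    exact: perm_inj.
  have mA' ij : ij \in s' -> measurable (A' ij).
    by move=> /mapP[i _ ->]; rewrite A'E.
  transitivity (P (\bigcap_(ij in [set` s']) (entry ij @^-1` A' ij))).
    congr (P _); apply/seteqP; split => t /= h.
      by move=> ij /= /mapP[i _ ->]; rewrite A'E; have := h i; rewrite tnth_mktuple.
    move=> i; rewrite tnth_mktuple -A'E; apply: (h (val (r i), l)) => /=.
    by apply/mapP; exists i => //; rewrite mem_index_enum.
  rewrite indE// big_map; apply: eq_bigr => i _.
  rewrite A'E; have mB : measurable [set x : d.-tuple R | A i (tnth x l)].
    by have := measurable_tnth (T := R) l measurableT (mA i); rewrite setTI.
  exact: (hXs_law _ mB).
have VE (r : {perm 'I_n}) : expect P (fun t => g [tuple column l t (r i) | i < n]) =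
    expect (distribution P (V r)) g.
  by rewrite -(expect_distribution (V r)).
have -> : (fun t => g [tuple column l t i | i < n]) =
    (fun t => g [tuple column l t ((1%g : {perm 'I_n}) i) | i < n]).
  by apply/funext => t; congr g; apply: eq_mktuple => i; rewrite perm1.
rewrite !VE /expect /Rintegral; congr fine; apply: eq_measure_integral => A mA _.
by apply: probability_boxes_unique => // B mB; exact: (etrans (lawV _ _ mB) (esym (lawV _ _ mB))).
Qed.

(** Any ordered pair of distinct indices can be moved to any other one by a
    permutation. *)
Local Lemma pair_exchange (n : nat) (l : 'I_d) (z : ('I_n -> R) -> 'I_n -> R)
    (i i' k k' : 'I_n) :
  (forall x (s : {perm 'I_n}) q, z (fun q => x (s q)) q = z x (s q)) ->
  (forall q, bounded_measurable (fun x : n.-tuple R => z (tnth x) q)) ->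
  i != i' -> k != k' ->
  expect P (fun t => z (column l t) i * z (column l t) i') =
  expect P (fun t => z (column l t) k * z (column l t) k').
Proof.
move=> zs bz ii' kk'.
pose s : {perm 'I_n} := (tperm i k * tperm (tperm i k i') k')%g.
have si : s i = k.
  have ne : tperm i k i' != k.
    by rewrite -[X in _ != X](tpermL i k) (inj_eq (@perm_inj _ _)) eq_sym.
  have kk2 : k' != k by rewrite eq_sym.
  by rewrite permM tpermL (tpermD ne kk2).
have si' : s i' = k' by rewrite permM tpermL.
have := column_exchange l s (bmM (bz i) (bz i')).
have tn (f : 'I_n -> R) : tnth [tuple f i | i < n] = f.
  by apply/funext => q; rewrite tnth_mktuple.
under eq_fun do rewrite !tn !zs si si'.
by under [X in _ = expect _ X -> _]eq_fun do rewrite !tn.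
Qed.

(** * The rank-based empirical process *)

Definition centred_indicator (v x : d.-tuple R) : R :=
  \prod_(j < d) (F j (tnth x j) <= tnth v j)%R%:R - prod_coords v.

Definition empirical_process (n : nat) (t : Omega) (v : d.-tuple R) : R :=
  (Num.sqrt n%:R)^-1 * \sum_(i < n) centred_indicator v (Xs i t).

Lemma bm_centred_indicator v : bounded_measurable (centred_indicator v).
Proof.
apply: bmB; last exact: bm_cst.
apply: bm_prod => j _; apply: bm_bool; apply: measurable_fun_ler => //.
apply: measurableT_comp; first exact: (measurable_marginal_cdf hF).
exact: measurable_tnth.
Qed.

Section fixed_point.
Variables (n : nat) (u : d.-tuple R).
Hypotheses (n0 : (0 < n)%N) (hu : unit_cube u).
Local Notation p := (tnth u).

Local Definition below (i : 'I_n) (t : Omega) (j : 'I_d) : R :=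
  (F j (entry (val i, j) t) <= p j)%R%:R.

Local Definition rbelow (i : 'I_n) (t : Omega) (j : 'I_d) : R :=
  (rank_below (column j t) (p j) i)%:R.

Local Lemma bm_below (J : set (nat * 'I_d)) (i : 'I_n) (j : 'I_d) : J (val i, j) ->
  bounded_measurable (below i ^~ j : subfamily entry J -> R).
Proof.
move=> Jij; apply: bm_bool; apply: measurable_fun_ler => //.
apply: measurableT_comp; first exact: (measurable_marginal_cdf hF).
exact: (measurable_subfamily (Z := entry)).
Qed.

Local Lemma bm_rbelow (J : set (nat * 'I_d)) (i : 'I_n) (j : 'I_d) :
  (forall k, J (k, j)) ->
  bounded_measurable (rbelow i ^~ j : subfamily entry J -> R).
Proof.
move=> Jj; apply: bm_bool.
apply: (measurable_rank_below (T := subfamily entry J)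
  (Z := fun (k : 'I_n) t => entry (val k, j) t)) => k.
exact: (measurable_subfamily (Z := entry)).
Qed.

Local Lemma bm_below_full i j : bounded_measurable (below i ^~ j).
Proof. by apply: (bm_of_subfamily mE (J := setT)); exact: bm_below. Qed.

Local Lemma bm_rbelow_full i j : bounded_measurable (rbelow i ^~ j).
Proof. by apply: (bm_of_subfamily mE (J := setT)); exact: bm_rbelow. Qed.

Local Lemma bool_itv (b : bool) : 0 <= (b%:R : R) <= 1.
Proof. by case: b; rewrite ?lexx ?ler01. Qed.

Local Lemma no_ties : exists N : set Omega, [/\ measurable N, P N = 0%E &
  forall t, ~ N t -> forall j : 'I_d, injective (@column n j t)].
Proof.
pose tie (q : 'I_n * 'I_n * 'I_d) : set Omega :=
  [set t | entry (val q.1.1, q.2) t = entry (val q.1.2, q.2) t].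
pose N := \big[setU/set0]_(q | q.1.1 != q.1.2) tie q.
have [mN PN] : measurable N /\ P N = 0%E.
  rewrite /N; apply: (@big_ind _ (fun A => measurable A /\ P A = 0%E)).
  - by split; [exact: measurable0|exact: measure0].
  - move=> A B [mA PA] [mB PB]; split; first exact: measurableU.
    apply/eqP; rewrite eq_le measure_ge0 andbT.
    by apply: (le_trans (measureU2 _ mA mB)); rewrite /= PA PB adde0.
  - move=> [[i i'] j] /= ii'; split; first exact: measurable_tie.
    by apply: (tie_null hF hX_ind hXs_law hXs_ind).
exists N; split => // t Nt j i i' e; apply/eqP/negPn/negP => ii'; apply: Nt.
by rewrite /N (bigD1 (i, i', j))//=; left.
Qed.

Local Lemma sum_below_second_moment (j : 'I_d) :
  expect P (fun t => (\sum_i below i t j - n%:R * p j) ^+ 2) <= n%:R.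
Proof.
have pj := hu j.
pose h (x : d.-tuple R) : R := (F j (tnth x j) <= p j)%R%:R - p j.
have mFj : measurable_fun setT (fun x : d.-tuple R => F j (tnth x j)).
  apply: measurableT_comp; first exact: (measurable_marginal_cdf hF).
  exact: measurable_tnth.
have bI : bounded_measurable (fun x : d.-tuple R => (F j (tnth x j) <= p j)%R%:R : R).
  by apply: bm_bool; exact: measurable_fun_ler.
have bh : bounded_measurable h by apply: bmB => //; exact: bm_cst.
have mX i : measurable_fun setT (Xs i : Omega -> d.-tuple R) by exact: measurable_funPT.
have bIi i : bounded_measurable (fun t => (F j (tnth (Xs i t) j) <= p j)%R%:R : R).
  exact: (bm_comp (mX i) bI).
have EI i : expect P (fun t => (F j (tnth (Xs i t) j) <= p j)%R%:R) = p j.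
  rewrite expect_bool.
    by have := cdf_entry_uniform hF hXs_law i j pj; rewrite /entry/= => ->.
  exact: (measurableT_comp (measurable_fun_ler mFj (measurable_cst _)) (mX i)).
have mean0 i : expect P (fun t => h (Xs i t)) = 0.
  by rewrite /h expectB ?EI ?expect_cst ?subrr//; exact: bm_cst.
have var i : expect P (fun t => h (Xs i t) ^+ 2) = p j * (1 - p j).
  transitivity (expect P (fun t => (1 - 2 * p j) * (F j (tnth (Xs i t) j) <= p j)%R%:R + p j ^+ 2)).
    congr (expect P _); apply/funext => t; rewrite /h.
    by case: (_ <= _); rewrite ?mulr1n ?mulr0n; ring.
  rewrite (expectD P (bmZ _ (bIi i)) (bm_cst _)) (expectZ P _ (bIi i)) EI expect_cst.
  by ring.
have := iid_second_moment mX hXs_ind bh mean0 var n.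
rewrite (_ : (fun t => _) = (fun t => (\sum_i below i t j - n%:R * p j) ^+ 2)).
  move=> ->; rewrite ler_piMr//.
  by case/andP: pj => p0 p1; nra.
apply/funext => t; congr (_ ^+ 2); rewrite /h sumrB sumr_const card_ord mulr_natl.
by [].
Qed.

(** The observations of rank at most [n * p j] and those with [F j] at most
    [p j] are two down-sets of the same sample. Hence the number of their
    disagreements is the difference of their sizes, and both sizes are
    [n * p j] up to order [sqrt n]. *)
Local Lemma sum_norm_rbelowB (j : 'I_d) :
  \sum_i expect P (fun t => `|rbelow i t j - below i t j|) <= Num.sqrt n%:R + 1.
Proof.
have s0 : 0 < Num.sqrt (n%:R : R) by rewrite sqrtr_gt0 ltr0n.
have b1 i : bounded_measurable (fun t => `|rbelow i t j - below i t j|).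
  by apply: bm_norm; apply: bmB; [exact: bm_rbelow_full|exact: bm_below_full].
have bS : bounded_measurable (fun t => \sum_i below i t j - n%:R * p j).
  by apply: bmB; [apply: bm_sum => i _; exact: bm_below_full|exact: bm_cst].
have bS2 := bmX 2 bS.
rewrite -expect_sum//.
have [N [mN PN inj]] := no_ties.
set s := Num.sqrt n%:R in s0 *.
have ss : s ^+ 2 = n%:R by rewrite sqr_sqrtr.
apply: (@le_trans _ _ (expect P (fun t =>
    (2 * s)^-1 * (\sum_i below i t j - n%:R * p j) ^+ 2 + (s / 2 + 1)))).
  apply: (le_expect_ae _ _ mN PN); first exact: bm_sum.
    by apply: bmD; [exact: bmZ|exact: bm_cst].
  move=> t Nt; have injx := inj t Nt j.
  rewrite (@sum_norm_nested _ _ (@column n j t) (rank_below (column j t) (p j))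
    (fun i => F j (entry (val i, j) t) <= p j)); last first.
  - by move=> i k ki; apply: le_trans; exact: marginal_cdf_le.
  - by move=> i k; exact: rank_below_down.
  have h1 := sum_rank_below injx (hu j).
  have h2 := ler_distD (n%:R * p j) (\sum_i rbelow i t j) (\sum_i below i t j).
  apply: (le_trans h2); rewrite addrC addrA; apply: lerD; last exact: h1.
  rewrite distrC; set y := _ - _.
  have : 0 <= (`|y| - s) ^+ 2 by exact: sqr_ge0.
  have -> : (2 * s)^-1 * y ^+ 2 + s / 2 = (y ^+ 2 + s ^+ 2) / (2 * s).
    by field; rewrite gt_eqF.
  rewrite ler_pdivlMr ?mulr_gt0// -[y ^+ 2]real_normK ?num_real// sqrrB.
  by move: `|y| => z; lra.
rewrite expectD ?expectZ ?expect_cst//; [|exact: bmZ|exact: bm_cst].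
rewrite addrA lerD2r.
have := sum_below_second_moment j; set e := expect P _ => he.
have : (2 * s)^-1 * e <= (2 * s)^-1 * n%:R by rewrite ler_wpM2l// invr_ge0 mulr_ge0// ltW.
rewrite -ss (_ : (2 * s)^-1 * s ^+ 2 = s / 2); first lra.
by field; rewrite gt_eqF.
Qed.

Local Lemma sum_rbelow_second_moment (j : 'I_d) :
  expect P (fun t => (\sum_i rbelow i t j - n%:R * p j) ^+ 2) <= n%:R.
Proof.
have [N [mN PN inj]] := no_ties.
apply: (@le_trans _ _ 1); last by rewrite ler1n.
rewrite -[leRHS](expect_cst P); apply: (le_expect_ae _ _ mN PN).
- apply: bmX; apply: bmB; last exact: bm_cst.
  by apply: bm_sum => i _; exact: bm_rbelow_full.
- exact: bm_cst.
- move=> t Nt; have := sum_rank_below (inj t Nt j) (hu j).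
  rewrite -[X in _ -> X <= _]real_normK ?num_real// => h.
  by rewrite expr_le1.
Qed.

(* The terms of the difference of Taylor remainders, for ranks and for
   distribution functions, summed over the sample. *)
Local Definition cross_sum (k l : 'I_d) (t : Omega) : R :=
  \sum_i (mix (rbelow i t) (below i t) k l - p l) *
    ((rbelow i t k - below i t k) * mix_weight p (rbelow i t) (below i t) k l).

Local Lemma bm_mix (J : set (nat * 'I_d)) i k l : (forall q, J (q, l)) ->
  bounded_measurable ((fun t => mix (rbelow i t) (below i t) k l) : subfamily entry J -> R).
Proof.
by move=> Jl; rewrite /mix; case: (l < k)%N; [exact: bm_rbelow|exact: bm_below].
Qed.

Local Lemma bm_cross_weight (J : set (nat * 'I_d)) i k l :
  (forall q j, j != l -> J (q, j)) -> l != k ->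
  bounded_measurable ((fun t => (rbelow i t k - below i t k) *
    mix_weight p (rbelow i t) (below i t) k l) : subfamily entry J -> R).
Proof.
move=> Jl lk; apply: bmM.
  have kl : k != l by rewrite eq_sym.
  by apply: bmB; [apply: bm_rbelow => q|apply: bm_below]; exact: Jl.
apply: bm_prod => j jl; case: (j == k); first exact: bm_cst.
case: (j < l)%N; last exact: bm_cst.
by apply: bm_mix => q; exact: Jl.
Qed.

Local Lemma bm_cross_sum k l : l != k -> bounded_measurable (cross_sum k l).
Proof.
move=> lk; apply: bm_sum => i _; apply: bmM.
  apply: bmB; last exact: bm_cst.
  by apply: (bm_of_subfamily mE (J := setT)); exact: bm_mix.
by apply: (bm_of_subfamily mE (J := setT)); exact: bm_cross_weight.
Qed.

(** The coordinate [l] is independent of the others and exchangeable. *)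
Local Lemma cross_sum_second_moment (k l : 'I_d) : l != k ->
  expect P (fun t => cross_sum k l t ^+ 2) <= 2 * (Num.sqrt n%:R + 1).
Proof.
move=> lk.
pose J1 : set (nat * 'I_d) := [set ij | ij.2 = l].
pose J2 : set (nat * 'I_d) := [set ij | ij.2 != l].
have J12 : J1 `&` J2 = set0.
  by apply/seteqP; split => // -[i j] []; rewrite /J1/J2/= => ->; rewrite eqxx.
pose Z i t := mix (rbelow i t) (below i t) k l - p l.
pose G i t := (rbelow i t k - below i t k) * mix_weight p (rbelow i t) (below i t) k l.
have bZ1 i : bounded_measurable (Z i : subfamily entry J1 -> R).
  by apply: bmB; [exact: bm_mix|exact: bm_cst].
have bG2 i : bounded_measurable (G i : subfamily entry J2 -> R).
  by apply: bm_cross_weight.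
have bZ i := bm_of_subfamily mE (bZ1 i).
have bG i := bm_of_subfamily mE (bG2 i).
have p01 j : 0 <= p j <= 1 by exact: hu.
have r01 i t j : 0 <= rbelow i t j <= 1 by exact: bool_itv.
have b01 i t j : 0 <= below i t j <= 1 by exact: bool_itv.
have dist1 (x y : R) : 0 <= x <= 1 -> 0 <= y <= 1 -> `|x - y| <= 1.
  by move=> /andP[? ?] /andP[? ?]; rewrite ler_norml; apply/andP; split; lra.
have G1 i t : `|G i t| <= `|rbelow i t k - below i t k|.
  rewrite normrM ler_piMr//; have /andP[w0 w1] := mix_weight_itv k l p01 (r01 i t) (b01 i t).
  by rewrite ger0_norm.
have [c hc] : exists c, forall i i', i != i' -> expect P (fun t => Z i t * Z i' t) = c.
  pose z (x : 'I_n -> R) i : R := mix (fun j => (rank_below x (p j) i)%:R)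
    (fun j => (F j (x i) <= p j)%R%:R) k l - p l.
  have zs x (s : {perm 'I_n}) q : z (fun q => x (s q)) q = z x (s q).
    by rewrite /z /mix; case: ifP => //; rewrite rank_below_perm.
  have bz q : bounded_measurable (fun x : n.-tuple R => z (tnth x) q).
    apply: bmB; last exact: bm_cst.
    rewrite /mix; case: (l < k)%N; apply: bm_bool.
      apply: (@measurable_rank_below _ _ _ _ (fun k (x : n.-tuple R) => tnth x k)).
      by move=> i; exact: measurable_tnth.
    apply: measurable_fun_ler => //; apply: measurableT_comp.
      exact: (measurable_marginal_cdf hF).
    exact: measurable_tnth.
  have [[[i0 i1] i01]|none] := pselect (exists q : 'I_n * 'I_n, q.1 != q.2).
    exists (expect P (fun t => Z i0 t * Z i1 t)) => i i' ii'.
    exact: (pair_exchange l zs bz ii' i01).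
  by exists 0 => i i' ii'; exfalso; apply: none; exists (i, i').
apply: (@le_trans _ _ (2 * \sum_i expect P (fun t => `|G i t|))).
  apply: (decoupled_second_moment bZ bG _ _ _ hc).
  - move=> i t; apply: dist1 => //; rewrite /mix; by case: ifP.
  - by move=> i t; apply: (le_trans (G1 i t)); exact: dist1.
  - move=> i i'; apply: (expectM_subfamilies mE indE J12).
      exact: bmM.
    exact: bmM.
  - rewrite /Z /mix; case: (l < k)%N.
      apply: le_trans (sum_rbelow_second_moment l); rewrite le_eqVlt; apply/orP; left.
      apply/eqP; congr (expect P _); apply/funext => t.
      by rewrite sumrB sumr_const card_ord mulr_natl.
    apply: le_trans (sum_below_second_moment l); rewrite le_eqVlt; apply/orP; left.
    apply/eqP; congr (expect P _); apply/funext => t.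
    by rewrite sumrB sumr_const card_ord mulr_natl.
rewrite ler_wpM2l//; apply: le_trans (sum_norm_rbelowB k).
apply: ler_sum => i _; apply: le_expect => //; first exact: bm_norm.
by apply: bm_norm; apply: bmB; [exact: bm_rbelow_full|exact: bm_below_full].
Qed.

(** The limit map subtracts the first-order expansion of the product of
    indicators around its mean. *)
Local Lemma limit_process_empirical t :
  limit_process (empirical_process n t) u =
  (Num.sqrt n%:R)^-1 * \sum_i taylor_remainder p (below i t).
Proof.
have main k : empirical_process n t (set_coord (@ones R d) k (p k)) =
    (Num.sqrt n%:R)^-1 * \sum_i (below i t k - p k).
  congr (_ * _); apply: eq_bigr => i _; rewrite /centred_indicator /prod_coords.
  congr (_ - _).
    rewrite (bigD1 k)//= big1 ?mulr1; first by rewrite tnth_mktuple eqxx.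
    move=> j jk; rewrite tnth_mktuple (negbTE jk) tnth_mktuple.
    by case/andP: (marginal_cdf_itv hXs_law j (tnth (Xs i t) j)) => _ ->.
  rewrite (bigD1 k)//= big1 ?mulr1; first by rewrite tnth_mktuple eqxx.
  by move=> j jk; rewrite tnth_mktuple (negbTE jk) tnth_mktuple.
rewrite /limit_process; under eq_bigr do rewrite main.
rewrite /empirical_process /taylor_remainder.
under eq_bigr do rewrite mulrCA.
rewrite -mulr_sumr -mulrBr; congr (_ * _).
rewrite [RHS]sumrB; congr (_ - _).
by rewrite exchange_big/=; apply: eq_bigr => k _; rewrite mulr_sumr.
Qed.

Local Lemma empirical_copula_expansion t :
  Num.sqrt n%:R * (empirical_copula (fun i : 'I_n => Xs i t) u - prod_coords u) -
    limit_process (empirical_process n t) u =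
  (Num.sqrt n%:R)^-1 * (\sum_k \sum_(l | l != k) cross_sum k l t +
    \sum_k (\prod_(j | j != k) p j) * (\sum_i rbelow i t k - n%:R * p k)).
Proof.
have s0 : Num.sqrt (n%:R : R) != 0 by rewrite gt_eqF// sqrtr_gt0 ltr0n.
have nn : n%:R = Num.sqrt (n%:R : R) ^+ 2 by rewrite sqr_sqrtr.
rewrite limit_process_empirical /empirical_copula.
have -> : \sum_(i < n) \prod_(j < d) (empirical_cdf (fun i : 'I_n => Xs i t) j
    (tnth (Xs i t) j) <= p j)%R%:R = \sum_i \prod_j rbelow i t j by [].
have -> : Num.sqrt n%:R * (n%:R^-1 * (\sum_i \prod_j rbelow i t j) - prod_coords u) =
    (Num.sqrt n%:R)^-1 * (\sum_i \prod_j rbelow i t j - n%:R * prod_coords u).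
  by move: (Num.sqrt n%:R) s0 nn => s s0 ->; field.
rewrite -mulrBr; congr (_ * _).
have -> : \sum_i \prod_j rbelow i t j - n%:R * prod_coords u =
  \sum_i taylor_remainder p (rbelow i t) +
  \sum_k (\prod_(j | j != k) p j) * (\sum_i rbelow i t k - n%:R * p k).
  rewrite /taylor_remainder !sumrB sumr_const card_ord mulr_natl.
  rewrite [X in _ = _ - X + _](_ : _ = \sum_k (\prod_(j | j != k) p j) * (\sum_i rbelow i t k - n%:R * p k)); first by rewrite subrK.
  rewrite exchange_big/=; apply: eq_bigr => k _; rewrite -mulr_sumr; congr (_ * _).
  by rewrite sumrB sumr_const card_ord mulr_natl.
rewrite addrAC; congr (_ + _); rewrite -sumrB.
under eq_bigr do rewrite taylor_remainderB.
rewrite exchange_big/=; apply: eq_bigr => k _.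
by rewrite exchange_big.
Qed.

(** The first-order part of the rank process is deterministic up to [O(1)]
    because ranks are a permutation of [1, ..., n]; what is left are
    [cross_sum]s, which are of order [n ^ (1 / 4)] by decoupling. *)
Lemma rank_process_approx_at :
  expect P (fun t => (Num.sqrt n%:R *
    (empirical_copula (fun i : 'I_n => Xs i t) u - prod_coords u) -
    limit_process (empirical_process n t) u) ^+ 2) <=
  2 * d%:R ^+ 2 * (4 * d%:R ^+ 2 + 1) * (Num.sqrt n%:R)^-1.
Proof.
set s := Num.sqrt n%:R.
have s0 : 0 < s by rewrite sqrtr_gt0 ltr0n.
have s1 : 1 <= s by rewrite -[leLHS](sqrtr1 R) ler_sqrt// ler1n.
pose T k l t := if l != k then cross_sum k l t else 0.
pose e k t := (\prod_(j | j != k) p j) * (\sum_i rbelow i t k - n%:R * p k).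
have bT k l : bounded_measurable (T k l).
  by rewrite /T; case lk : (l != k); [exact: bm_cross_sum|exact: bm_cst].
have be k : bounded_measurable (e k).
  apply: bmZ; apply: bmB; last exact: bm_cst.
  by apply: bm_sum => i _; exact: bm_rbelow_full.
have [N [mN PN inj]] := no_ties.
have e1 t k : ~ N t -> `|e k t| <= 1.
  move=> Nt; rewrite normrM -[leRHS]mulr1 ler_pM//; last first.
    exact: sum_rank_below (inj t Nt k) (hu k).
  rewrite ger0_norm; last by apply: prodr_ge0 => j _; case/andP: (hu j).
  by apply: prodr_ile1 => j _; exact: hu.
under eq_fun do rewrite empirical_copula_expansion -/s.
have TE t : \sum_k \sum_(l | l != k) cross_sum k l t = \sum_k \sum_l T k l t.
  by apply: eq_bigr => k _; rewrite big_mkcond.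
have bTT : bounded_measurable (fun t => \sum_k \sum_l T k l t).
  by apply: bm_sum => k _; apply: bm_sum.
have bTT2 : bounded_measurable (fun t => \sum_k \sum_l T k l t ^+ 2).
  by apply: bm_sum => k _; apply: bm_sum => l _; exact: bmX.
have bee : bounded_measurable (fun t => \sum_k e k t) by exact: bm_sum.
apply: (@le_trans _ _ (expect P (fun t => (s ^+ 2)^-1 * (2 * d%:R ^+ 2) * (\sum_k \sum_l T k l t ^+ 2)
    + (s ^+ 2)^-1 * (2 * d%:R ^+ 2)))).
  apply: (le_expect_ae _ _ mN PN).
  - under eq_fun do rewrite TE.
    by apply: bmX; apply: bmZ; exact: bmD.
  - by apply: bmD; [exact: bmZ|exact: bm_cst].
  move=> t Nt; rewrite TE exprMn exprVn -!mulrA -mulrDr ler_wpM2l ?invr_ge0 ?sqr_ge0//.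
  rewrite -mulrDr.
  set A := \sum_k \sum_l T k l t; set B := \sum_k _ * _.
  have hB : B ^+ 2 <= d%:R ^+ 2.
    apply: (le_trans (sqr_sum_le _)); rewrite card_ord expr2 ler_wpM2l//.
    apply: (@le_trans _ _ (\sum_(k < d) 1)); last by rewrite sumr_const card_ord.
    apply: ler_sum => k _; rewrite -[X in X <= _]real_normK ?num_real// expr_le1//.
    exact: e1.
  have hA : A ^+ 2 <= d%:R ^+ 2 * \sum_k \sum_l T k l t ^+ 2.
    apply: (le_trans (sqr_sum_le _)); rewrite card_ord expr2 -mulrA ler_wpM2l//.
    rewrite mulr_sumr; apply: ler_sum => k _.
    by apply: (le_trans (sqr_sum_le _)); rewrite card_ord.
  have := sqr_ge0 (A - B); rewrite sqrrB sqrrD; lra.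
rewrite expectD ?expect_cst ?expectZ//; [|exact: bmZ|exact: bm_cst].
have hT : expect P (fun t => \sum_k \sum_l T k l t ^+ 2) <= d%:R ^+ 2 * (4 * s).
  rewrite expect_sum; last by move=> k _; apply: bm_sum => l _; exact: bmX.
  apply: (@le_trans _ _ (\sum_(k < d) d%:R * (4 * s))); last first.
    by rewrite sumr_const card_ord -[_ *+ d]mulr_natl expr2 mulrA.
  apply: ler_sum => k _; rewrite expect_sum; last by move=> l _; exact: bmX.
  apply: (@le_trans _ _ (\sum_(l < d) 4 * s)); last first.
    by rewrite sumr_const card_ord -[_ *+ d]mulr_natl.
  apply: ler_sum => l _; rewrite /T; case lk : (l != k).
    apply: (le_trans (cross_sum_second_moment lk)); rewrite -/s; lra.
  by rewrite expr0n/= expect_cst; lra.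
rewrite -{2}[(s ^+ 2)^-1 * _]mulr1 -mulrDr.
have d0 : (0 : R) <= d%:R ^+ 2 by exact: sqr_ge0.
apply: (@le_trans _ _ ((s ^+ 2)^-1 * (2 * d%:R ^+ 2) * (s * (4 * d%:R ^+ 2 + 1)))).
  apply: ler_wpM2l; first by rewrite mulr_ge0 ?invr_ge0 ?sqr_ge0// mulr_ge0.
  by nra.
rewrite le_eqVlt; apply/orP; left; apply/eqP.
by field; rewrite gt_eqF.
Qed.

End fixed_point.
End rank_process.

(** * Integrals of possibly non-measurable non-negative functions *)

Section lower_integral.
Import HBNNSimple.
Context {disp : measure_display} {T : measurableType disp} {R : realType}.
Context (P : probability T R).
Local Open Scope ereal_scope.

(* The integral of a non-negative function is a supremum over measurable
   simple minorants, whether or not the function is measurable; paths of a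
   tight process need not be measurable. *)
Local Lemma le_lower_integral (f g : T -> R) : (forall t, 0 <= f t)%R ->
  (forall t, f t <= g t)%R -> \int[P]_t (f t)%:E <= \int[P]_t (g t)%:E.
Proof.
move=> f0 fg; have g0 t : (0 <= g t)%R := le_trans (f0 t) (fg t).
rewrite !ge0_integralTE//; apply: le_ereal_sup => _ [h hf <-]; exists h => //.
by move=> t; apply: (le_trans (hf t)); rewrite lee_fin.
Qed.

Local Lemma lower_integral_ub (f : T -> R) (b : \bar R) : (forall t, 0 <= f t)%R ->
  (forall s : T -> R, measurable_fun setT s -> (forall t, 0 <= s t <= f t)%R ->
    \int[P]_t (s t)%:E <= b) -> \int[P]_t (f t)%:E <= b.
Proof.
move=> f0 hb; rewrite [leLHS]ge0_integralTE//; apply: ge_ereal_sup => _ [h hf <-].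
rewrite -integralT_nnsfun; apply: hb => [|t]; first exact: measurable_funPT.
by apply/andP; split; [exact: fun_ge0|rewrite -lee_fin; exact: hf].
Qed.

Lemma lower_integral_shift (f : T -> R) (c : R) : (forall t, 0 <= f t)%R ->
  (0 <= c)%R -> \int[P]_t (f t + c)%:E <= \int[P]_t (f t)%:E + c%:E.
Proof.
move=> f0 c0; apply: lower_integral_ub => [t|s ms sf]; first by rewrite addr_ge0.
pose s' t : R := Num.max (s t - c)%R 0%R.
have ms' : measurable_fun setT s'.
  by apply: measurable_maxr => //; exact: measurable_funB.
have s'0 t : (0 <= s' t)%R by rewrite /s' le_max lexx orbT.
have s'f t : (s' t <= f t)%R.
  by rewrite /s' ge_max f0 andbT lerBlDr; case/andP: (sf t).
apply: (@le_trans _ _ (\int[P]_t ((s' t)%:E + c%:E))).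
  apply: ge0_le_integral => //.
  - by move=> t _; rewrite lee_fin; case/andP: (sf t).
  - exact/measurable_EFinP.
  - apply: emeasurable_funD => //; exact/measurable_EFinP.
  - by move=> t _; rewrite -EFinD lee_fin -lerBlDr /s' le_max lexx.
rewrite ge0_integralD//; [|by move=> t _; rewrite lee_fin|exact/measurable_EFinP].
rewrite integral_cst//= probability_setT mule1 leeD2r//.
exact: le_lower_integral.
Qed.

Lemma lower_integral_ae (f g : T -> R) (N : set T) : (forall t, 0 <= f t)%R ->
  (forall t, 0 <= g t)%R -> measurable N -> P N = 0 ->
  (forall t, ~ N t -> f t = g t) -> \int[P]_t (f t)%:E = \int[P]_t (g t)%:E.
Proof.
have half (f' g' : T -> R) : (forall t, 0 <= f' t)%R -> (forall t, 0 <= g' t)%R ->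
    measurable N -> P N = 0 -> (forall t, ~ N t -> f' t = g' t) ->
    \int[P]_t (f' t)%:E <= \int[P]_t (g' t)%:E.
  move=> f0 g0 mN PN fg; apply: lower_integral_ub => // s ms sf.
  pose s' t := (s t * \1_(~` N) t)%R.
  have ms' : measurable_fun setT s'.
    by apply: measurable_funM => //; apply: measurable_indic; exact: measurableC.
  have s'0 t : (0 <= s' t)%R.
    by rewrite mulr_ge0// ?indicE//; case/andP: (sf t).
  apply: (@le_trans _ _ (\int[P]_t (s' t)%:E)).
    rewrite le_eqVlt; apply/orP; left; apply/eqP; apply: ge0_ae_eq_integral => //.
    - exact/measurable_EFinP.
    - exact/measurable_EFinP.
    - by move=> t _; rewrite lee_fin; case/andP: (sf t).
    - by move=> t _; rewrite lee_fin.
    - exists N; split => // t /= nst; apply: contrapT => Nt; apply: nst => _.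
      by rewrite /s' indicE mem_set// mulr1.
  apply: le_lower_integral => // t; rewrite /s' indicE.
  have [tN|tN] := pselect (N t).
    by rewrite memNset ?mulr0//; exact.
  by rewrite mem_set// mulr1 -fg//; case/andP: (sf t).
move=> f0 g0 mN PN fg; apply/eqP; rewrite eq_le !half// => t Nt.
by rewrite fg.
Qed.

End lower_integral.

Section lower_expectation.
Context {disp : measure_display} {T : measurableType disp} {R : realType}.
Context (P : probability T R).

(** The supremum over simple minorants is monotone and increases by at most [c]
    when [c] is added to the integrand; hence this estimate does not use
    measurability. *)
Lemma expect_dist_le (f g : T -> R) (M c : R) :
  (forall t, 0 <= f t <= M) -> (forall t, 0 <= g t <= M) ->
  (forall t, `|f t - g t| <= c) -> `|expect P f - expect P g| <= c.
Proof.
move=> fM gM fgc.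
have [t0|nT] := pselect (exists t : T, True); last first.
  have f0 : f = (fun=> 0) by apply/funext => t; exfalso; apply: nT; exists t.
  have g0 : g = (fun=> 0) by apply/funext => t; exfalso; apply: nT; exists t.
  have := probability_setT P; rewrite (_ : setT = set0); last first.
    by apply/seteqP; split => // t _; apply: nT; exists t.
  by rewrite measure0 => /eqP; rewrite eqe eq_sym oner_eq0.
case: t0 => t0 _.
have c0 : 0 <= c := le_trans (normr_ge0 _) (fgc t0).
have M0 : 0 <= M by case/andP: (fM t0) => /le_trans; apply.
have fin (h : T -> R) : (forall t, 0 <= h t <= M) ->
    (\int[P]_t (h t)%:E = (expect P h)%:E)%E.
  move=> hM; rewrite /expect /Rintegral fineK// ge0_fin_numE.
    apply: (@le_lt_trans _ _ (\int[P]_t (cst M%:E t))%E).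
      by apply: (@le_lower_integral _ _ _ P h (fun=> M)) => t; case/andP: (hM t).
    by rewrite integral_cst//= probability_setT mule1 ltry.
  by apply: integral_ge0 => t _; rewrite lee_fin; case/andP: (hM t).
have half (h k : T -> R) : (forall t, 0 <= h t <= M) -> (forall t, 0 <= k t <= M) ->
    (forall t, h t <= k t + c) -> expect P h <= expect P k + c.
  move=> hM kM hk; rewrite -lee_fin EFinD -!fin//.
  apply: (@le_trans _ _ (\int[P]_t (k t + c)%:E)%E).
    by apply: le_lower_integral => // t; case/andP: (hM t).
  by apply: lower_integral_shift => // t; case/andP: (kM t).
rewrite ler_distl; apply/andP; split.
  rewrite lerBlDr; apply: half => // t.
  by have := fgc t; rewrite distrC ler_distl => /andP[].
by apply: half => // t; have := fgc t; rewrite ler_distl => /andP[].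
Qed.

End lower_expectation.

(** * Lebesgue measure on the unit cube *)

Section cube.
Context {R : realType} (d : nat).

Lemma measurable_unit_cube : measurable (@unit_cube R d).
Proof.
rewrite (_ : @unit_cube R d = [set u | forall j : 'I_d, `[0, 1]%classic (tnth u j)]).
  by apply: (@measurable_box _ _ (fun=> `[0, 1]%classic)) => j; exact: measurable_itv.
by apply/seteqP; split => u h j; have := h j; rewrite /= in_itv.
Qed.

Lemma lebesgue_unit_cube : lebesgue_tuple R d (@unit_cube R d) = 1%E.
Proof.
rewrite (_ : @unit_cube R d = [set u | forall j : 'I_d, `[0, 1]%classic (tnth u j)]).
  rewrite (@lebesgue_tuple_box R d (fun=> `[0, 1]%classic)); last by move=> j; exact: measurable_itv.
  by rewrite big1// => j _; rewrite lebesgue_measure_itv/= lte01 oppr0 adde0.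
by apply/seteqP; split => u h j; have := h j; rewrite /= in_itv.
Qed.

Definition cube_measure : set (d.-tuple R) -> \bar R :=
  mrestr (lebesgue_tuple R d) measurable_unit_cube.

HB.instance Definition _ := Measure.on cube_measure.

Local Lemma cube_measure_setT : cube_measure setT = 1%E.
Proof. by rewrite /cube_measure /mrestr setTI lebesgue_unit_cube. Qed.

HB.instance Definition _ :=
  @Measure_isProbability.Build _ _ R cube_measure cube_measure_setT.

(** A null set is invisible to a supremum over simple minorants even if [h] is
    not measurable, so the Borel version of the weight gives the same integrals.
    Clipping it at a bound of [w] makes it bounded. *)
Lemma borel_weight (w : d.-tuple R -> R) :
  [bounded w u | u in @unit_cube R d] -> (forall u, @unit_cube R d u -> 0 <= w u) ->
  lebesgue_integrable (@unit_cube R d) w ->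
  exists M : R, exists w' : d.-tuple R -> R,
  [/\ bounded_measurable w', (forall u, 0 <= w' u <= M),
      (forall u, ~ unit_cube u -> w' u = 0) &
      forall h : d.-tuple R -> R, (forall u, 0 <= h u) ->
        \int[lebesgue_tuple R d]_(u in @unit_cube R d) (h u * w u) =
        expect cube_measure (fun u => h u * w' u)].
Proof.
move=> [M0 [_ hM0]] w0 [g [ig [N [mN N0 gN]]]].
pose M := `|M0| + 1.
have wM u : unit_cube u -> w u <= M.
  by move=> hu; apply: (le_trans (ler_norm _)); apply: hM0 => //; rewrite /M (le_lt_trans (ler_norm _))// ltrDl.
have M1 : 0 <= M by rewrite addr_ge0.
pose w' u := (fun u => Num.max 0 (Num.min M (g u))) \_ (@unit_cube R d) u.
have mg : measurable_fun (@unit_cube R d) g.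
  by apply/measurable_EFinP; exact: measurable_int ig.
have mw' : measurable_fun setT w'.
  apply/(measurable_restrictT _ measurable_unit_cube).
  by apply: measurable_maxr => //; exact: measurable_minr.
have w'M u : 0 <= w' u <= M.
  rewrite /w' patchE; case: ifP => _; last by rewrite lexx.
  by rewrite le_max lexx/= ge_max M1 ge_min lexx.
have w'0 u : ~ unit_cube u -> w' u = 0.
  by move=> hu; rewrite /w' patchE memNset.
have w'E u : unit_cube u -> ~ N u -> w' u = w u.
  move=> hu Nu; rewrite /w' patchE mem_set//.
  have <- : w u = g u.
    by apply: contrapT => ne; apply: Nu; apply: gN => /= /(_ hu).
  by rewrite (min_idPr (wM u hu)) (max_idPr (w0 u hu)).
exists M, w'; split => //.
  by split => //; exists M => u; case/andP: (w'M u) => a b; rewrite ger0_norm.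
move=> h h0.
have supp (f : d.-tuple R -> R) : (forall u, ~ unit_cube u -> f u = 0) ->
    (\int[cube_measure]_u (f u)%:E = \int[lebesgue_tuple R d]_(u in @unit_cube R d) (f u)%:E)%E.
  move=> f0; transitivity (\int[cube_measure]_(u in @unit_cube R d) (f u)%:E)%E.
    rewrite [RHS]integral_mkcond; apply: eq_integral => u _; rewrite patchE.
    by case: ifPn => // /negP uD; rewrite f0// => hu; apply: uD; exact: mem_set.
  apply: eq_measure_integral => A mA AD.
  exact: (congr1 (lebesgue_tuple R d) (setIidl AD)).
pose f u := (h u * w u) * \1_(@unit_cube R d) u.
have f0 u : 0 <= f u.
  rewrite /f indicE; have [hu|hu] := pselect (unit_cube u).
    by rewrite mem_set// mulr1 mulr_ge0// w0.
  by rewrite memNset// mulr0.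
rewrite /expect /Rintegral; congr fine.
transitivity (\int[lebesgue_tuple R d]_(u in @unit_cube R d) (f u)%:E)%E.
  by apply: eq_integral => u uD; rewrite /f indicE uD mulr1.
rewrite -supp; last by move=> u hu; rewrite /f indicE memNset// mulr0.
apply: (@lower_integral_ae _ _ _ _ _ _ N) => //.
- by move=> u; rewrite mulr_ge0//; case/andP: (w'M u).
- apply/eqP; rewrite eq_le measure_ge0 andbT -N0.
  apply: le_measure; rewrite ?inE//; first by apply: measurableI => //; exact: measurable_unit_cube.
- move=> u Nu; rewrite /f indicE; have [hu|hu] := pselect (unit_cube u).
    by rewrite mem_set// mulr1 w'E.
  by rewrite memNset// mulr0 w'0// mulr0.
Qed.

(** For [x] in the unit interval [grid_count m x] is the integer part of [m x];
    the sum form makes its measurability immediate. *)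
Definition grid_count (m : nat) (x : R) : nat :=
  \sum_(k < m) (k.+1%:R <= m%:R * x)%R.

Definition grid_point (m : nat) (p : {ffun 'I_d -> 'I_m.+1}) : d.-tuple R :=
  [tuple (p j)%:R / m%:R | j < d].

Definition grid_round (m : nat) (u : d.-tuple R) : d.-tuple R :=
  [tuple (grid_count m (tnth u j))%:R / m%:R | j < d].

Local Lemma grid_count_lt (m : nat) x : (grid_count m x < m.+1)%N.
Proof.
rewrite ltnS /grid_count; apply: (@leq_trans (\sum_(k < m) 1)).
  by apply: leq_sum => k _; exact: leq_b1.
by rewrite sum_nat_const card_ord muln1.
Qed.

Lemma grid_pointP (m : nat) (p : {ffun 'I_d -> 'I_m.+1}) :
  (0 < m)%N -> unit_cube (grid_point p).
Proof.
move=> m0 j; rewrite tnth_mktuple divr_ge0//= ler_pdivrMr ?ltr0n// mul1r ler_nat.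
by rewrite -ltnS.
Qed.

Lemma grid_round_point (m : nat) (u : d.-tuple R) :
  exists p : {ffun 'I_d -> 'I_m.+1}, grid_round m u = grid_point p.
Proof.
exists [ffun j => Ordinal (grid_count_lt m (tnth u j))].
by apply: eq_mktuple => j; rewrite ffunE.
Qed.

Lemma grid_point_inj (m : nat) : (0 < m)%N -> injective (@grid_point m).
Proof.
move=> m0 p q /(congr1 (fun u => tnth u)) e; apply/ffunP => j.
have := congr1 (fun f => f j) e; rewrite !tnth_mktuple => /(congr1 (fun x => x * m%:R)).
by rewrite !divfK ?pnatr_eq0 -?lt0n// => /eqP; rewrite eqr_nat => /eqP/val_inj.
Qed.

Lemma grid_round_near (m : nat) (u : d.-tuple R) (j : 'I_d) : (0 < m)%N ->
  unit_cube u -> `|tnth u j - tnth (grid_round m u) j| <= m%:R^-1.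
Proof.
move=> m0 /(_ j)/andP[u0 u1]; rewrite tnth_mktuple.
have mp : 0 < m%:R :> R by rewrite ltr0n.
have := @count_nat_le R m (m%:R * tnth u j).
rewrite mulr_ge0//= ler_piMr// => /(_ isT).
rewrite -natr_sum -/(grid_count m (tnth u j)) => h.
have -> : tnth u j - (grid_count m (tnth u j))%:R / m%:R =
    - ((grid_count m (tnth u j))%:R - m%:R * tnth u j) * m%:R^-1.
  by field; rewrite gt_eqF.
rewrite normrM normrN -[leRHS]mul1r [X in _ * X]ger0_norm ?invr_ge0//.
by rewrite ler_wpM2r// invr_ge0.
Qed.

Lemma measurable_grid_cell (m : nat) (p : {ffun 'I_d -> 'I_m.+1}) :
  measurable_fun setT (fun u : d.-tuple R => grid_round m u == grid_point p).
Proof.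
have mc j : measurable_fun setT (fun u : d.-tuple R => tnth (grid_round m u) j).
  under eq_fun do rewrite tnth_mktuple /grid_count natr_sum.
  apply: measurable_funM => //; apply: measurable_sum => k.
  apply: (bm_bool _).1; apply: measurable_fun_ler => //.
  by apply: measurable_funM => //; exact: measurable_tnth.
rewrite (_ : (fun u => _) = (fun u => [forall j, tnth (grid_round m u) j == tnth (grid_point p) j])).
  have -> : (fun u => [forall j, tnth (grid_round m u) j == tnth (grid_point p) j]) =
      (fun u => \big[andb/true]_(j < d) (tnth (grid_round m u) j == tnth (grid_point p) j)).
    by apply/funext => u; rewrite big_andE.
  elim: (index_enum _) => [|j s IH].
    by under eq_fun do rewrite big_nil; exact: measurable_cst.
  under eq_fun do rewrite big_cons.
  by apply: measurable_and => //; apply: measurable_fun_eqr.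
apply/funext => u; apply/eqP/forallP => [-> j//|h].
by apply: eq_from_tnth => j; exact/eqP.
Qed.

(** This linearization makes [h (grid_round m u)] jointly measurable when [h] is
    random, and turns its integrals into finite sums. *)
Lemma grid_sum (m : nat) (h : d.-tuple R -> R) (u : d.-tuple R) : (0 < m)%N ->
  h (grid_round m u) =
  \sum_(p : {ffun 'I_d -> 'I_m.+1}) h (grid_point p) * (grid_round m u == grid_point p)%:R.
Proof.
move=> m0; have [p ->] := grid_round_point m u.
rewrite (bigD1 p)//= eqxx mulr1 big1 ?addr0// => q qp.
case: eqP => [/(grid_point_inj m0) pq|_]; last by rewrite mulr0.
by rewrite pq eqxx in qp.
Qed.

End cube.

(** * Covariances *)

Section covariance.
Context {R : realType} {d : nat}.

Definition cube_point : Type := {v : d.-tuple R | unit_cube v}.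

Definition bridge_cov (u v : d.-tuple R) : R :=
  \prod_(j < d) Num.min (tnth u j) (tnth v j) - \prod_(j < d) (tnth u j * tnth v j).

Definition cov_form (s : seq (R * cube_point)) : R :=
  \sum_(a <- s) \sum_(b <- s) a.1 * b.1 * bridge_cov (sval a.2) (sval b.2).

Definition dist1 (u v : d.-tuple R) : R := \sum_(j < d) `|tnth u j - tnth v j|.

Lemma prodB_le (n : nat) (p : pred 'I_n) (x y : 'I_n -> R) :
  (forall j, 0 <= x j <= 1) -> (forall j, 0 <= y j <= 1) ->
  `|\prod_(j | p j) x j - \prod_(j | p j) y j| <= \sum_j `|x j - y j|.
Proof.
move=> x01 y01; rewrite (big_mkcond p) [X in _ - X]big_mkcond telescope_prod.
apply: (le_trans (ler_norm_sum _ _ _)); apply: ler_sum => l _.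
set w := \prod_(_ | _) _.
have w01 : 0 <= w <= 1.
  have f01 (j : 'I_n) : 0 <= (if (j < l)%N then if p j then x j else 1 else if p j then y j else 1) <= 1.
    by case: ifP => _; case: ifP => _ //; rewrite ler01 lexx.
  apply/andP; split; first by apply: prodr_ge0 => j _; case/andP: (f01 j).
  by apply: prodr_ile1 => j _; exact: f01.
case/andP: w01 => w0 w1; rewrite normrM (ger0_norm w0).
by case: ifP => _; [rewrite ler_piMr|rewrite subrr normr0 mul0r].
Qed.

Lemma bridge_cov_le1 u v : unit_cube u -> unit_cube v -> bridge_cov u v <= 1.
Proof.
move=> hu hv; rewrite /bridge_cov lerBlDr.
apply: (@le_trans _ _ 1).
  apply: prodr_ile1 => j _; case/andP: (hu j) => u0 u1; case/andP: (hv j) => v0 v1.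
  by rewrite le_min u0 v0/= ge_min u1.
rewrite lerDl prodr_ge0// => j _; case/andP: (hu j) => u0 u1; case/andP: (hv j) => v0 v1.
by rewrite mulr_ge0.
Qed.

Lemma bridge_covC u v : bridge_cov u v = bridge_cov v u.
Proof.
by congr (_ - _); apply: eq_bigr => j _; [exact: minC|exact: mulrC].
Qed.

(** The left-hand side is the second moment of an increment of the bridge. A
    product of numbers in the unit interval is 1-Lipschitz in each factor. *)
Lemma bridge_cov_increment u v : unit_cube u -> unit_cube v ->
  bridge_cov u u - 2 * bridge_cov u v + bridge_cov v v <= dist1 u v.
Proof.
move=> hu hv; rewrite /bridge_cov !big_split/=.
have eqm (x : d.-tuple R) : \prod_(j < d) Num.min (tnth x j) (tnth x j) = \prod_(j < d) tnth x j.
  by apply: eq_bigr => j _; rewrite minxx.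
rewrite !eqm; set U := \prod_(j < d) tnth u j; set V := \prod_(j < d) tnth v j.
set W := \prod_(j < d) Num.min _ _.
have m01 j : 0 <= Num.min (tnth u j) (tnth v j) <= 1.
  case/andP: (hu j) => u0 u1; case/andP: (hv j) => v0 v1.
  by rewrite le_min u0 v0/= ge_min u1.
have h1 := @prodB_le d predT _ _ hu m01; have h2 := @prodB_le d predT _ _ hv m01.
rewrite -/U -/V -/W in h1 h2.
have h3 : dist1 u v = \sum_j `|tnth u j - Num.min (tnth u j) (tnth v j)| +
    \sum_j `|tnth v j - Num.min (tnth u j) (tnth v j)|.
  rewrite -big_split/=; apply: eq_bigr => j _.
  case: (leP (tnth u j) (tnth v j)) => uv.
    by rewrite subrr normr0 add0r distrC.
  by rewrite subrr normr0 addr0.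
have := sqr_ge0 (U - V); have := ler_norm (U - W); have := ler_norm (V - W).
rewrite h3 sqrrB; move: h1 h2; nra.
Qed.

Local Lemma cube_ones_coordP (u : cube_point) (i : 'I_d) :
  unit_cube (set_coord (@ones R d) i (tnth (sval u) i)).
Proof.
move=> j; rewrite tnth_mktuple; case: ifP => _; first exact: (svalP u).
by rewrite tnth_mktuple ler01 lexx.
Qed.

Definition cube_ones_coord (u : cube_point) (i : 'I_d) : cube_point :=
  exist _ _ (cube_ones_coordP u i).

(** The coefficients of [limit_process b u] as a linear form in [b], which
    transfers Gaussian limits from [b] to [limit_process b]. *)
Definition limit_coeffs (u : cube_point) : seq (R * cube_point) :=
  (1, u) :: [seq (- \prod_(j < d | j != i) tnth (sval u) j, cube_ones_coord u i)
            | i <- index_enum 'I_d].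

Lemma limit_process_linear (b : d.-tuple R -> R) (u : cube_point) :
  limit_process b (sval u) = linear_form (fun v : cube_point => b (sval v)) (limit_coeffs u).
Proof.
rewrite /linear_form big_cons/= mul1r big_map; congr (_ + _).
by rewrite -sumrN; apply: eq_bigr => i _; rewrite mulNr.
Qed.

Lemma limit_process_linear_form (b : d.-tuple R -> R) (s : seq (R * cube_point)) :
  linear_form (fun v : cube_point => limit_process b (sval v)) s =
  linear_form (fun v : cube_point => b (sval v))
    (flatten [seq [seq (c.1 * a.1, a.2) | a <- limit_coeffs c.2] | c <- s]).
Proof.
rewrite {1}/linear_form [in RHS]/linear_form big_flatten big_map.
apply: eq_bigr => c _; rewrite limit_process_linear big_map /linear_form mulr_sumr.
by apply: eq_bigr => a _; rewrite mulrA.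
Qed.

Local Notation weight u i := (\prod_(j < d | j != i) tnth (sval u) j).

Lemma weight_itv (u : cube_point) i : 0 <= weight u i <= 1.
Proof.
apply/andP; split; first by apply: prodr_ge0 => j _; case/andP: (svalP u j).
by apply: prodr_ile1 => j _; exact: (svalP u j).
Qed.

Local Lemma weightB (u v : cube_point) i :
  (weight u i - weight v i) ^+ 2 <= dist1 (sval u) (sval v).
Proof.
have h := @prodB_le d (fun j => j != i) _ _ (svalP u) (svalP v).
apply: le_trans h; rewrite -[leLHS]real_normK ?num_real// expr2 ler_piMr//.
have /andP[a b] := weight_itv u i; have /andP[a' b'] := weight_itv v i.
by rewrite ler_norml; apply/andP; split; lra.
Qed.

Lemma dist1_ge0 u v : 0 <= dist1 u v.
Proof. exact: sumr_ge0. Qed.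

Lemma dist1_coord u v j : `|tnth u j - tnth v j| <= dist1 u v.
Proof. by rewrite /dist1 (bigD1 j)//= lerDl sumr_ge0. Qed.

Lemma dist1_ones_coord (u v : cube_point) (i : 'I_d) :
  dist1 (sval (cube_ones_coord u i)) (sval (cube_ones_coord v i)) =
  `|tnth (sval u) i - tnth (sval v) i|.
Proof.
rewrite /dist1 (bigD1 i)//= !tnth_mktuple eqxx big1 ?addr0// => j ji.
by rewrite !tnth_mktuple (negbTE ji) subrr normr0.
Qed.

Local Lemma sqrD_le (x y : R) : (x + y) ^+ 2 <= 2 * x ^+ 2 + 2 * y ^+ 2.
Proof. by have := sqr_ge0 (x - y); rewrite sqrrB sqrrD; lra. Qed.

(** Bounds on [limit_process] that are uniform in the path, so that only second
    moments of the path remain to be inserted. *)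
Lemma limit_process_sqr (b : d.-tuple R -> R) (u : cube_point) :
  limit_process b (sval u) ^+ 2 <= 2 * b (sval u) ^+ 2 +
    2 * (d%:R * \sum_i b (sval (cube_ones_coord u i)) ^+ 2).
Proof.
apply: (le_trans (sqrD_le _ _)); rewrite lerD2l ler_wpM2l// sqrrN.
apply: (le_trans (sqr_sum_le _)); rewrite card_ord ler_wpM2l//.
apply: ler_sum => i _; rewrite exprMn ler_piMl ?sqr_ge0// expr_le1//.
  by case/andP: (weight_itv u i).
by case/andP: (weight_itv u i).
Qed.

Lemma limit_processB_sqr (b : d.-tuple R -> R) (u v : cube_point) :
  (limit_process b (sval u) - limit_process b (sval v)) ^+ 2 <=
  2 * (b (sval u) - b (sval v)) ^+ 2 + 2 * (d%:R * \sum_i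
    (2 * (b (sval (cube_ones_coord u i)) - b (sval (cube_ones_coord v i))) ^+ 2 +
     2 * (dist1 (sval u) (sval v) * b (sval (cube_ones_coord v i)) ^+ 2))).
Proof.
have -> : limit_process b (sval u) - limit_process b (sval v) =
    (b (sval u) - b (sval v)) + - \sum_i
    (weight u i * (b (sval (cube_ones_coord u i)) - b (sval (cube_ones_coord v i))) +
     (weight u i - weight v i) * b (sval (cube_ones_coord v i))).
  have -> : \sum_i (weight u i * (b (sval (cube_ones_coord u i)) - b (sval (cube_ones_coord v i))) +
      (weight u i - weight v i) * b (sval (cube_ones_coord v i))) =
      \sum_i weight u i * b (sval (cube_ones_coord u i)) -
      \sum_i weight v i * b (sval (cube_ones_coord v i)).
    by rewrite -sumrB; apply: eq_bigr => i _; ring.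
  by rewrite /limit_process /=; ring.
apply: (le_trans (sqrD_le _ _)); rewrite lerD2l ler_wpM2l// sqrrN.
apply: (le_trans (sqr_sum_le _)); rewrite card_ord ler_wpM2l//.
apply: ler_sum => i _; apply: (le_trans (sqrD_le _ _)).
rewrite !exprMn lerD// ler_wpM2l//.
  rewrite ler_piMl ?sqr_ge0// expr_le1//; first by case/andP: (weight_itv u i).
  by case/andP: (weight_itv u i).
by rewrite ler_wpM2r ?sqr_ge0// weightB.
Qed.

End covariance.

(** * Moments and limit law of the empirical process *)

Section empirical_moments.
Context {R : realType} {d : nat}.
Context {disp0 : measure_display} {Omega0 : measurableType disp0}
  {P0 : probability Omega0 R} (X : {RV P0 >-> d.-tuple R}).
Context {disp : measure_display} {Omega : measurableType disp}
  (P : probability Omega R) (Xs : nat -> {RV P >-> d.-tuple R}).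
Hypothesis hF : forall j : 'I_d, continuous (marginal_cdf X j).
Hypothesis hX_ind : mutually_independent P0 (fun (j : 'I_d) t => tnth (X t) j).
Hypothesis hXs_law : forall i, same_distribution (Xs i) X.
Hypothesis hXs_ind : mutually_independent P (fun i t => Xs i t).
Local Notation F := (marginal_cdf X).
Local Notation ci := (centred_indicator X).
Local Notation beta := (empirical_process X Xs).

Local Lemma mXs i : measurable_fun setT (Xs i : Omega -> d.-tuple R).
Proof. exact: measurable_funPT. Qed.

Local Lemma bm_ci i v : bounded_measurable (fun t => ci v (Xs i t)).
Proof. exact: (bm_comp (mXs i) (bm_centred_indicator hF v)). Qed.

Local Lemma bm_orthant v : bounded_measurable (fun x : d.-tuple R =>
  \prod_(j < d) (F j (tnth x j) <= tnth v j)%R%:R : R).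
Proof.
apply: bm_prod => j _; apply: bm_bool; apply: measurable_fun_ler => //.
apply: measurableT_comp; first exact: (measurable_marginal_cdf hF).
exact: measurable_tnth.
Qed.

Local Lemma orthant_prob i v : unit_cube v ->
  expect P (fun t => \prod_(j < d) (F j (tnth (Xs i t) j) <= tnth v j)%R%:R) =
  \prod_(j < d) tnth v j.
Proof.
move=> hv; pose A (j : 'I_d) := [set x : R | F j x <= tnth v j].
have mA j : measurable (A j).
  have := measurable_marginal_cdf hF j measurableT (measurable_itv `]-oo, tnth v j]).
  by rewrite setTI; apply: measurable_eqset; apply/seteqP; split => x; rewrite /= in_itv.
pose E := [set t : Omega | forall j, A j (tnth (Xs i t) j)].
have -> : (fun t => \prod_(j < d) (F j (tnth (Xs i t) j) <= tnth v j)%R%:R) =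
    (\1_E : Omega -> R).
  apply/funext => t; rewrite indicE; have [tE|tE] := pselect (E t).
    by rewrite mem_set// big1// => j _; have := tE j; rewrite /A/= => ->.
  rewrite memNset//; have [j] : exists j, ~ A j (tnth (Xs i t) j).
    by apply/existsNP.
  by rewrite /A/= => /negP/negbTE h; rewrite (bigD1 j)//= h mul0r.
have mE : measurable E.
  have := mXs i measurableT (measurable_box mA); by rewrite setTI.
rewrite expect_indic//.
have -> : P E = (\prod_(j < d) (tnth v j)%:E)%E.
  rewrite (_ : P E = (\prod_(j < d) P (entry Xs (i, j) @^-1` A j))%E).
    by apply: eq_bigr => j _; exact: (cdf_entry_uniform hF hXs_law).
  exact: (row_box hX_ind hXs_law).
by rewrite -(big_morph EFin EFinM (erefl 1%:E)).
Qed.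

Lemma centred_indicator_mean i v : unit_cube v -> expect P (fun t => ci v (Xs i t)) = 0.
Proof.
move=> hv; rewrite /centred_indicator expectB; last exact: bm_cst.
  by rewrite orthant_prob// expect_cst subrr.
exact: (bm_comp (mXs i) (bm_orthant v)).
Qed.

Lemma centred_indicator_cov i u v : unit_cube u -> unit_cube v ->
  expect P (fun t => ci u (Xs i t) * ci v (Xs i t)) = bridge_cov u v.
Proof.
move=> hu hv; pose m : d.-tuple R := [tuple Num.min (tnth u j) (tnth v j) | j < d].
have hm : unit_cube m.
  move=> j; rewrite tnth_mktuple; case/andP: (hu j) => u0 u1; case/andP: (hv j) => v0 v1.
  by rewrite le_min u0 v0/= ge_min u1.
pose O (w x : d.-tuple R) : R := \prod_(j < d) (F j (tnth x j) <= tnth w j)%R%:R.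
have bO w : bounded_measurable (fun t => O w (Xs i t)) := bm_comp (mXs i) (bm_orthant w).
have EO w : unit_cube w -> expect P (fun t => O w (Xs i t)) = prod_coords w.
  exact: orthant_prob.
transitivity (expect P (fun t => (O m (Xs i t) + - prod_coords v * O u (Xs i t)) +
    (- prod_coords u * O v (Xs i t) + prod_coords u * prod_coords v))).
  congr (expect P _); apply/funext => t.
  have -> : O m (Xs i t) = O u (Xs i t) * O v (Xs i t).
    rewrite /O -big_split/=; apply: eq_bigr => j _.
    by rewrite tnth_mktuple le_min -natrM mulnb.
  by rewrite /centred_indicator -/(O _ _) -/(O _ _); ring.
rewrite expectD; [|by apply: bmD => //; exact: bmZ|by apply: bmD; [exact: bmZ|exact: bm_cst]].
rewrite expectD//; last exact: bmZ.
rewrite (expectD P (bmZ _ (bO v)) (bm_cst _)) expect_cst !expectZ// !EO//.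
rewrite /bridge_cov big_split/= -/(prod_coords u) -/(prod_coords v).
have -> : prod_coords m = \prod_(j < d) Num.min (tnth u j) (tnth v j).
  by apply: eq_bigr => j _; rewrite tnth_mktuple.
ring.
Qed.

Local Definition row_form (s : seq (R * cube_point)) (x : d.-tuple R) : R :=
  linear_form (fun v : cube_point => ci (sval v) x) s.

Local Lemma bm_row_form s : bounded_measurable (row_form s).
Proof. by apply: bm_sum => a _; apply: bmZ; exact: (bm_centred_indicator hF). Qed.

Local Lemma empirical_linear_form n t s :
  linear_form (fun v : cube_point => beta n t (sval v)) s =
  (Num.sqrt n%:R)^-1 * \sum_(i < n) row_form s (Xs i t).
Proof.
rewrite /row_form /linear_form exchange_big/= mulr_sumr; apply: eq_bigr => a _.
by rewrite /empirical_process mulrCA -mulr_sumr.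
Qed.

Local Lemma row_form_mean s i : expect P (fun t => row_form s (Xs i t)) = 0.
Proof.
rewrite /row_form /linear_form expect_sum; last by move=> a _; apply: bmZ; exact: bm_ci.
apply: big1 => a _; rewrite expectZ; last exact: bm_ci.
by rewrite centred_indicator_mean ?mulr0//; exact: (svalP a.2).
Qed.

Local Lemma row_form_variance s i : expect P (fun t => row_form s (Xs i t) ^+ 2) = cov_form s.
Proof.
have b2 (a b : R * cube_point) : bounded_measurable (fun t =>
    (a.1 * b.1) * (ci (sval a.2) (Xs i t) * ci (sval b.2) (Xs i t))).
  by apply: bmZ; apply: bmM; exact: bm_ci.
transitivity (expect P (fun t => \sum_(a <- s) \sum_(b <- s)
    (a.1 * b.1) * (ci (sval a.2) (Xs i t) * ci (sval b.2) (Xs i t)))).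
  congr (expect P _); apply/funext => t.
  rewrite expr2 /row_form /linear_form mulr_suml; apply: eq_bigr => a _.
  by rewrite mulr_sumr; apply: eq_bigr => b _; ring.
rewrite expect_sum; last by move=> a _; apply: bm_sum.
apply: eq_bigr => a _; rewrite expect_sum//; apply: eq_bigr => b _.
rewrite expectZ; last by apply: bmM; exact: bm_ci.
by rewrite centred_indicator_cov//; [exact: (svalP a.2)|exact: (svalP b.2)].
Qed.

Lemma bm_empirical_process n v : bounded_measurable (fun t => beta n t v).
Proof. by apply: bmZ; apply: bm_sum => i _; exact: bm_ci. Qed.

Lemma bm_limit_process n v :
  bounded_measurable (fun t => limit_process (beta n t) v).
Proof.
apply: bmB; first exact: bm_empirical_process.
by apply: bm_sum => i _; apply: bmZ; exact: bm_empirical_process.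
Qed.

Lemma empirical_cos_cvg (th : R) (s : seq (R * cube_point)) :
  expect P (fun t => cos (th + linear_form (fun v : cube_point => beta n t (sval v)) s))
    @[n --> \oo] --> cos th * expR (- (cov_form s / 2)).
Proof.
under eq_fun do under eq_fun do rewrite empirical_linear_form.
apply: (clt_cos mXs hXs_ind (bm_row_form s)).
- by move=> i; exact: row_form_mean.
- by move=> i; exact: row_form_variance.
Qed.

Lemma empirical_form_second_moment n s : (0 < n)%N ->
  expect P (fun t => linear_form (fun v : cube_point => beta n t (sval v)) s ^+ 2) =
  cov_form s.
Proof.
move=> n0; under eq_fun do rewrite empirical_linear_form exprMn.
have b : bounded_measurable (fun t => \sum_(i < n) row_form s (Xs i t)).
  by apply: bm_sum => i _; exact: (bm_comp (mXs i) (bm_row_form s)).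
rewrite expectZ; last exact: bmX.
rewrite (iid_second_moment mXs hXs_ind (bm_row_form s) (row_form_mean s) (row_form_variance s)).
by rewrite exprVn sqr_sqrtr// mulKf// pnatr_eq0 -lt0n.
Qed.

Local Lemma empirical_sqr n (u : cube_point) : (0 < n)%N ->
  expect P (fun t => beta n t (sval u) ^+ 2) <= 1.
Proof.
move=> n0; have := empirical_form_second_moment [:: (1, u)] n0.
rewrite /cov_form !big_seq1/= !mul1r => h.
have -> : (fun t => beta n t (sval u) ^+ 2) =
    (fun t => linear_form (fun v : cube_point => beta n t (sval v)) [:: (1, u)] ^+ 2).
  by apply/funext => t; rewrite /linear_form big_seq1 mul1r.
by rewrite h; apply: bridge_cov_le1; exact: (svalP u).
Qed.

Local Lemma empirical_increment n (u v : cube_point) : (0 < n)%N ->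
  expect P (fun t => (beta n t (sval u) - beta n t (sval v)) ^+ 2) <=
  dist1 (sval u) (sval v).
Proof.
move=> n0; have := empirical_form_second_moment [:: (1, u); (-1, v)] n0.
rewrite /cov_form !big_cons !big_nil/= !addr0 => h.
have -> : (fun t => (beta n t (sval u) - beta n t (sval v)) ^+ 2) =
    (fun t => linear_form (fun v : cube_point => beta n t (sval v)) [:: (1, u); (-1, v)] ^+ 2).
  by apply/funext => t; rewrite /linear_form !big_cons big_nil/= addr0 mul1r mulN1r.
rewrite h (bridge_covC (sval v)).
by apply: le_trans (bridge_cov_increment (svalP u) (svalP v)); rewrite le_eqVlt; apply/orP; left; apply/eqP; ring.
Qed.

Lemma empirical_limit_sqr n (u : cube_point) : (0 < n)%N ->
  expect P (fun t => limit_process (beta n t) (sval u) ^+ 2) <= 2 + 2 * d%:R ^+ 2.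
Proof.
move=> n0.
have b2 (v : cube_point) : bounded_measurable (fun t => beta n t (sval v) ^+ 2).
  by apply: bmX; exact: bm_empirical_process.
have bS : bounded_measurable (fun t => \sum_i beta n t (sval (cube_ones_coord u i)) ^+ 2).
  by apply: bm_sum => i _; exact: b2.
apply: (le_trans (le_expect P _ _ (fun t => limit_process_sqr (beta n t) u))).
- by apply: bmX; exact: bm_limit_process.
- by apply: bmD; [exact: bmZ|apply: bmZ; exact: bmZ].
rewrite (expectD P (bmZ _ (b2 u)) (bmZ _ (bmZ _ bS))) expectZ// (expectZ P _ (bmZ _ bS)) (expectZ P _ bS).
rewrite lerD//; first by rewrite -[leRHS]mulr1 ler_wpM2l// empirical_sqr.
rewrite ler_wpM2l// expr2 ler_wpM2l// expect_sum; last by move=> i _; exact: b2.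
apply: (@le_trans _ _ (\sum_(i < d) 1)); last by rewrite sumr_const card_ord.
by apply: ler_sum => i _; exact: empirical_sqr.
Qed.

Lemma empirical_limit_increment n (u v : cube_point) : (0 < n)%N ->
  expect P (fun t => (limit_process (beta n t) (sval u) -
    limit_process (beta n t) (sval v)) ^+ 2) <=
  (2 + 8 * d%:R ^+ 2) * dist1 (sval u) (sval v).
Proof.
move=> n0; set D := dist1 (sval u) (sval v).
have D0 : 0 <= D by exact: dist1_ge0.
have bb (a : cube_point) : bounded_measurable (fun t => beta n t (sval a)).
  exact: bm_empirical_process.
have b2 (a b : cube_point) : bounded_measurable (fun t => (beta n t (sval a) - beta n t (sval b)) ^+ 2).
  by apply: bmX; exact: bmB.
have b3 (a : cube_point) : bounded_measurable (fun t => beta n t (sval a) ^+ 2).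
  exact: bmX.
have bi i : bounded_measurable (fun t => 2 * (beta n t (sval (cube_ones_coord u i)) -
    beta n t (sval (cube_ones_coord v i))) ^+ 2 +
    2 * (D * beta n t (sval (cube_ones_coord v i)) ^+ 2)).
  by apply: bmD; [exact: bmZ|apply: bmZ; exact: bmZ].
have bS : bounded_measurable (fun t => \sum_i (2 * (beta n t (sval (cube_ones_coord u i)) -
    beta n t (sval (cube_ones_coord v i))) ^+ 2 +
    2 * (D * beta n t (sval (cube_ones_coord v i)) ^+ 2))).
  by apply: bm_sum => i _; exact: bi.
apply: (le_trans (le_expect P _ _ (fun t => limit_processB_sqr (beta n t) u v))).
- by apply: bmX; apply: bmB; exact: bm_limit_process.
- by apply: bmD; [exact: bmZ|apply: bmZ; exact: bmZ].
rewrite (expectD P (bmZ _ (b2 u v)) (bmZ _ (bmZ _ bS))) expectZ// (expectZ P _ (bmZ _ bS)) (expectZ P _ bS).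
rewrite [leRHS]mulrDl lerD//.
  by rewrite ler_wpM2l// empirical_increment.
rewrite expect_sum; last by move=> i _; exact: bi.
apply: (@le_trans _ _ (2 * (d%:R * (\sum_(i < d) 4 * D)))); last first.
  by rewrite sumr_const card_ord -[_ *+ d]mulr_natl le_eqVlt; apply/orP; left; apply/eqP; ring.
rewrite ler_wpM2l// ler_wpM2l//; apply: ler_sum => i _.
rewrite (expectD P (bmZ _ (b2 _ _)) (bmZ _ (bmZ _ (b3 _)))) (expectZ P _ (b2 _ _)).
rewrite (expectZ P _ (bmZ _ (b3 _))) (expectZ P _ (b3 _)).
rewrite (_ : 4 * D = 2 * D + 2 * (D * 1)); last by ring.
rewrite lerD// ler_wpM2l//.
  apply: (le_trans (empirical_increment _ _ n0)); rewrite dist1_ones_coord.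
  exact: dist1_coord.
by rewrite ler_wpM2l// empirical_sqr.
Qed.

End empirical_moments.

(** * Uniform bounds on the limit map *)

Section limit_process_bounds.
Context {R : realType} {d : nat}.
Implicit Types (b c : d.-tuple R -> R) (u v : d.-tuple R).

Lemma limit_process_bound b (k : R) u : (forall v, unit_cube v -> `|b v| <= k) ->
  unit_cube u -> `|limit_process b u| <= (1 + d%:R) * k.
Proof.
move=> bk hu; pose U : cube_point := exist _ u hu.
rewrite mulrDl mul1r; apply: (le_trans (ler_normB _ _)); apply: lerD; first exact: bk.
apply: (le_trans (ler_norm_sum _ _ _)).
apply: (@le_trans _ _ (\sum_(i < d) k)); last by rewrite sumr_const card_ord mulr_natl.
apply: ler_sum => i _; rewrite normrM -[leRHS]mul1r.
have /andP[w0 w1] := weight_itv U i.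
apply: ler_pM => //; first by rewrite ger0_norm.
exact: (bk _ (svalP (cube_ones_coord U i))).
Qed.

Lemma limit_process_distl b c (k : R) u :
  (forall v, unit_cube v -> `|b v - c v| <= k) -> unit_cube u ->
  `|limit_process b u - limit_process c u| <= (1 + d%:R) * k.
Proof.
move=> bck hu; have -> : limit_process b u - limit_process c u =
    limit_process (fun v => b v - c v) u.
  rewrite /limit_process; under [in RHS]eq_bigr do rewrite mulrBr.
  by rewrite sumrB; ring.
exact: limit_process_bound.
Qed.

Lemma limit_process_distr b (k e : R) u v : (forall x, unit_cube x -> `|b x| <= k) ->
  unit_cube u -> unit_cube v ->
  (forall x y, unit_cube x -> unit_cube y -> dist1 x y <= dist1 u v -> `|b x - b y| <= e) ->
  `|limit_process b u - limit_process b v| <= (1 + d%:R) * e + d%:R * (dist1 u v * k).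
Proof.
move=> bk hu hv be; pose U : cube_point := exist _ u hu; pose V : cube_point := exist _ v hv.
pose bu i := b (sval (cube_ones_coord U i)); pose bv i := b (sval (cube_ones_coord V i)).
pose wu i := \prod_(j < d | j != i) tnth u j; pose wv i := \prod_(j < d | j != i) tnth v j.
have -> : limit_process b u - limit_process b v = (b u - b v) -
    \sum_(i < d) (wu i * (bu i - bv i) + (wu i - wv i) * bv i).
  rewrite /limit_process -/(wu _) -/(wv _).
  have -> : \sum_(i < d) (wu i * (bu i - bv i) + (wu i - wv i) * bv i) =
     \sum_(i < d) wu i * bu i - \sum_(i < d) wv i * bv i.
    by rewrite -sumrB; apply: eq_bigr => i _; ring.
  by rewrite /bu /bv /=; ring.
rewrite (_ : (1 + _) * e + _ = e + d%:R * (e + dist1 u v * k)); last by ring.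
apply: (le_trans (ler_normB _ _)); apply: lerD; first exact: be.
apply: (le_trans (ler_norm_sum _ _ _)).
apply: (@le_trans _ _ (\sum_(i < d) (e + dist1 u v * k))); last first.
  by rewrite sumr_const card_ord mulr_natl.
apply: ler_sum => i _; apply: (le_trans (ler_normD _ _)); rewrite !normrM.
have /andP[w0 w1] := weight_itv U i; apply: lerD.
  rewrite -[leRHS]mul1r; apply: ler_pM => //; first by rewrite ger0_norm.
  apply: be.
  - exact: (svalP (cube_ones_coord U i)).
  - exact: (svalP (cube_ones_coord V i)).
  - by rewrite (dist1_ones_coord U V); exact: dist1_coord.
rewrite ler_pM//; last exact: (bk _ (svalP (cube_ones_coord V i))).
exact: (prodB_le (fun j => j != i) hu hv).
Qed.

End limit_process_bounds.

(** * Finite-dimensional laws of the bridge *)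

Section bridge_marginals.
Context {R : realType} {d : nat}.
Context {dispB : measure_display} {OmegaB : measurableType dispB}.
Context (PB : probability OmegaB R) (B : OmegaB -> d.-tuple R -> R).
Hypothesis hB : tied_down_brownian_bridge PB B.

Lemma measurable_bridge u : unit_cube u -> measurable_fun setT (fun t => B t u).
Proof.
move=> hu; case: hB => _ + _ _ => /(_ 1%N (fun=> 1) (fun=> u) (fun=> hu)) [+ _].
by apply: eq_measurable_fun => t _; rewrite big_ord1 mul1r.
Qed.

Lemma measurable_limit_bridge u : unit_cube u ->
  measurable_fun setT (fun t => limit_process (B t) u).
Proof.
move=> hu; pose U : cube_point := exist _ u hu; apply: measurable_funB.
  exact: measurable_bridge.
apply: measurable_sum => i; apply: measurable_funM => //.
exact: (measurable_bridge (svalP (cube_ones_coord U i))).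
Qed.

Lemma bridge_expectM u v : unit_cube u -> unit_cube v ->
  (\int[PB]_t (B t u * B t v)%:E = (bridge_cov u v)%:E)%E.
Proof. by move=> hu hv; case: hB => _ _ _ /(_ u v hu hv); rewrite unlock. Qed.

Lemma bridge_integrableM u v : unit_cube u -> unit_cube v ->
  PB.-integrable setT (fun t => (B t u * B t v)%:E).
Proof.
have i2 w : unit_cube w -> PB.-integrable setT (fun t => (B t w * B t w)%:E).
  move=> hw; apply/integrableP; split.
    apply/measurable_EFinP; apply: measurable_funM; exact: measurable_bridge.
  rewrite (eq_integral (fun t => (B t w * B t w)%:E)).
    by rewrite bridge_expectM// ltry.
  by move=> t _; rewrite gee0_abs// lee_fin -expr2 sqr_ge0.
move=> hu hv.
apply: (@le_integrable _ _ _ PB setT _ _ (fun t => (B t u * B t u + B t v * B t v)%:E)) => //.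
- by apply/measurable_EFinP; apply: measurable_funM; exact: measurable_bridge.
- move=> t _; rewrite lee_fin -!expr2 [leRHS]ger0_norm ?addr_ge0 ?sqr_ge0// normrM.
  rewrite -[B t u ^+ 2]real_normK ?num_real// -[B t v ^+ 2]real_normK ?num_real//.
  by move: `|B t u| `|B t v| (normr_ge0 (B t u)) (normr_ge0 (B t v)) => x y x0 y0; nra.
- by under eq_fun do rewrite EFinD; apply: integrableD => //; exact: i2.
Qed.

Lemma bridge_integrable u : unit_cube u -> PB.-integrable setT (fun t => (B t u)%:E).
Proof.
move=> hu.
apply: (@le_integrable _ _ _ PB setT _ _ (fun t => (1 + B t u * B t u)%:E)) => //.
- by apply/measurable_EFinP; exact: measurable_bridge.
- move=> t _; rewrite lee_fin -expr2 [leRHS]ger0_norm ?addr_ge0 ?sqr_ge0//.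
  by rewrite -[B t u ^+ 2]real_normK ?num_real//; move: `|_| => z; nra.
- under eq_fun do rewrite EFinD; apply: integrableD => //.
    by apply: bm_integrable; exact: bm_cst.
  exact: bridge_integrableM.
Qed.

Local Notation form s t := (linear_form (fun v : cube_point => B t (sval v)) s).

Local Lemma form_gaussian (s : seq (R * cube_point)) : is_gaussian PB (fun t => form s t).
Proof.
case: hB => _ /(_ (size s) (fun k => (tnth (in_tuple s) k).1)
  (fun k => sval (tnth (in_tuple s) k).2) (fun k => svalP (tnth (in_tuple s) k).2)) + _ _.
rewrite (_ : (fun t => \sum_(k < size s) _) = (fun t => form s t))//.
by apply/funext => t; rewrite /linear_form [RHS]big_tnth.
Qed.

Local Lemma form_mean (s : seq (R * cube_point)) : ('E_PB[fun t => form s t] = 0)%E.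
Proof.
have E0 u : unit_cube u -> (\int[PB]_t (B t u)%:E = 0)%E.
  by move=> hu; case: hB => _ _ /(_ u hu) + _; rewrite unlock.
rewrite unlock /linear_form; under eq_integral do rewrite -sumEFin.
rewrite integral_sum//; last first.
  move=> a; under eq_fun do rewrite EFinM; apply: integrableZl => //.
  exact: (bridge_integrable (svalP a.2)).
rewrite big1// => a _; under eq_integral do rewrite EFinM.
rewrite integralZl ?E0 ?mule0//; first exact: (svalP a.2).
exact: (bridge_integrable (svalP a.2)).
Qed.

Local Lemma form_sqr (s : seq (R * cube_point)) t :
  form s t ^+ 2 = \sum_(a <- s) \sum_(b <- s)
    (a.1 * b.1) * (B t (sval a.2) * B t (sval b.2)).
Proof.
rewrite expr2 /linear_form mulr_suml; apply: eq_bigr => a _.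
by rewrite mulr_sumr; apply: eq_bigr => b _; ring.
Qed.

Lemma bridge_form_variance (s : seq (R * cube_point)) :
  (\int[PB]_t (form s t ^+ 2)%:E = (cov_form s)%:E)%E.
Proof.
have ii (a b : R * cube_point) : PB.-integrable setT
    (fun t => ((a.1 * b.1) * (B t (sval a.2) * B t (sval b.2)))%:E).
  under eq_fun do rewrite EFinM; apply: integrableZl => //.
  exact: (bridge_integrableM (svalP a.2) (svalP b.2)).
have isum (a : R * cube_point) : PB.-integrable setT
    (fun t => (\sum_(b <- s) (a.1 * b.1) * (B t (sval a.2) * B t (sval b.2)))%:E).
  by under eq_fun do rewrite -sumEFin; apply: integrable_sum.
under eq_integral do rewrite form_sqr -sumEFin.
rewrite integral_sum//= /cov_form -sumEFin; apply: eq_bigr => a _.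
under eq_integral do rewrite -sumEFin.
rewrite integral_sum//= -sumEFin; apply: eq_bigr => b _.
under eq_integral do rewrite EFinM.
rewrite integralZl//; last exact: (bridge_integrableM (svalP a.2) (svalP b.2)).
by rewrite bridge_expectM//; [exact: (svalP a.2)|exact: (svalP b.2)].
Qed.

Lemma bridge_cos (th : R) (s : seq (R * cube_point)) :
  expect PB (fun t => cos (th + form s t)) = cos th * expR (- (cov_form s / 2)).
Proof.
apply: gaussian_cos; [exact: form_gaussian|exact: form_mean|].
by rewrite unlock; exact: bridge_form_variance.
Qed.

Lemma bridge_increment_prob u v (e : R) : unit_cube u -> unit_cube v -> 0 < e ->
  ((e ^+ 2)%:E * PB [set t | (e < `|B t u - B t v|)%R] <= (dist1 u v)%:E)%E.
Proof.
move=> hu hv e0; pose U : cube_point := exist _ u hu; pose V : cube_point := exist _ v hv.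
pose s : seq (R * cube_point) := [:: (1, U); (-1, V)].
have fE t : form s t = B t u - B t v.
  by rewrite /linear_form !big_cons big_nil/= addr0 mul1r mulN1r.
have mD : measurable_fun setT (fun t => B t u - B t v).
  by apply: measurable_funB; exact: measurable_bridge.
have mE : measurable [set t | e < `|B t u - B t v|].
  rewrite -[X in measurable X]setTI; apply: measurable_fun_ltr => //.
  exact: measurableT_comp.
apply: (@le_trans _ _ (\int[PB]_t (form s t ^+ 2)%:E)%E).
  rewrite -integral_cst// integral_mkcond; apply: ge0_le_integral => //.
  - by move=> t _; rewrite patchE; case: ifP => // _; rewrite lee_fin sqr_ge0.
  - apply/(measurable_restrictT _ mE); exact: measurable_cst.
  - apply/measurable_EFinP; apply: measurable_funX.
    by under eq_fun do rewrite fE.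
  - move=> t _; rewrite patchE; case: ifPn => [|_]; last by rewrite lee_fin sqr_ge0.
    rewrite inE /= fE => et; rewrite lee_fin -[leRHS]real_normK ?num_real//.
    by apply: lerXn2r; rewrite ?nnegrE ?normr_ge0//; exact: ltW.
rewrite bridge_form_variance lee_fin /cov_form !big_cons !big_nil/= !addr0.
rewrite (bridge_covC v).
by apply: le_trans (bridge_cov_increment hu hv); rewrite le_eqVlt; apply/orP; left; apply/eqP; ring.
Qed.

End bridge_marginals.

(** * Tight processes are equicontinuous in probability *)

Section finite_nets.
Context {R : realType} {U : choiceType} (A : set U).

Local Lemma uniform_compact_cover :
  @compact {uniform` A -> R} = @cover_compact {uniform` A -> R}.
Proof.
pose T : ptopologicalType :=
  HB.pack {uniform` A -> R} (Pointed.on (U -> R)) (Topological.on {uniform` A -> R}).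
exact: (@compact_cover T).
Qed.

Lemma compact_uniform_net (K : set {uniform` A -> R}) (e : R) : compact K -> 0 < e ->
  exists (N : nat) (g : 'I_N -> U -> R) (M : R),
    (forall i u, A u -> `|g i u| <= M) /\
    forall h : U -> R, K h -> (exists c : R, forall u, A u -> `|h u| <= c) ->
      exists i, forall u, A u -> `|g i u - h u| <= e.
Proof.
move=> + e0; rewrite uniform_compact_cover.
pose f (g : {uniform` A -> R}) : set {uniform` A -> R} :=
  ([set h : {uniform` A -> R} | forall u, A u -> `|g u - h u| < e])^°.
move=> /(_ _ K f (fun g _ => open_interior _)) [|D _ KD].
  move=> g Kg; exists g => //; apply/uniform_nbhs.
  by exists [set xy | ball xy.1 e xy.2]; split => //; exact: (entourage_ball R (PosNum e0)).
pose bnd (g : U -> R) := exists c : R, forall u, A u -> `|g u| <= c.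
pose l := finmap.enum_fset D.
pose g (i : 'I_(size l)) : U -> R :=
  let g0 := tnth (in_tuple l) i : U -> R in if pselect (bnd g0) then g0 else fun=> 0.
have gM i : exists c : R, forall u, A u -> `|g i u| <= c.
  by rewrite /g; case: pselect => [b|b] //=; exists 0 => u _; rewrite normr0.
have [M hM] := choice gM; exists (size l), g, (\sum_i `|M i|); split.
  move=> i u Au; apply: (le_trans (hM i u Au)); apply: (le_trans (ler_norm _)).
  by rewrite (bigD1 i)//= lerDl sumr_ge0.
move=> h Kh [c hc]; have [g0 /= g0D /interior_subset hg] := KD h Kh.
have /tnthP[i gi] : g0 \in in_tuple l by [].
exists i => u Au; rewrite /g -gi; case: pselect => [_|nb] /=; first by rewrite ltW// hg.
exfalso; apply: nb; exists (e + c) => v Av.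
rewrite -[g0 v](subrK (h v)) (le_trans (ler_normD _ _))// lerD//; last exact: hc.
by rewrite ltW// hg.
Qed.

(** Finitely many bounded functions take values in a common finite grid up to
    [e], so they oscillate by at most [e] on the fibres of a map to a finite
    type. *)
Lemma finite_oscillation (N : nat) (g : 'I_N -> U -> R) (M e : R) : 0 < e ->
  (forall i u, A u -> `|g i u| <= M) ->
  exists (F : finType) (cell : U -> F), forall u v, A u -> A v -> cell u = cell v ->
    forall i, `|g i u - g i v| <= e.
Proof.
move=> e0 gM; pose K := (Num.truncn (2 * `|M| / e)).+1.
exists {ffun 'I_N -> 'I_K.+1}, (fun u => [ffun i => inord (Num.truncn ((g i u + `|M|) / e))]).
move=> u v Au Av cuv i; have := congr1 (fun f : {ffun 'I_N -> 'I_K.+1} => f i : nat) cuv.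
have pos w : A w -> 0 <= (g i w + `|M|) / e.
  move=> Aw; rewrite divr_ge0 ?(ltW e0)// -[g i w]opprK addrC subr_ge0.
  rewrite (le_trans (ler_norm _))// normrN (le_trans (gM i w Aw))//.
  exact: ler_norm.
have lt w : A w -> (Num.truncn ((g i w + `|M|) / e) < K.+1)%N.
  move=> Aw; rewrite ltnS /K leqW// le_truncn// ler_pM2r ?invr_gt0//.
  rewrite mulr_natl mulr2n lerD2r; apply: (le_trans (ler_norm _)).
  by apply: (le_trans (gM i w Aw)); exact: ler_norm.
rewrite !ffunE !inordK ?lt// => tE.
have /andP[a1 a2] := truncn_itv (pos u Au); have /andP[b1 b2] := truncn_itv (pos v Av).
rewrite tE in a1 a2; rewrite -[leRHS]mul1r -ler_pdivrMr//.
have -> : `|g i u - g i v| / e = `|(g i u + `|M|) / e - (g i v + `|M|) / e|.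
  by rewrite -mulrBl normrM (gtr0_norm (x := e^-1)) ?invr_gt0// opprD addrACA subrr addr0.
rewrite ler_distl; apply/andP; split.
  rewrite lerBlDr ltW// (lt_le_trans b2)// -natr1 lerD2r//.
by rewrite ltW// (lt_le_trans a2)// -natr1 lerD2r.
Qed.

End finite_nets.

Section equicontinuity.
Context {R : realType} {d : nat}.
Context {dispB : measure_display} {OmegaB : measurableType dispB}.
Context (PB : probability OmegaB R) (B : OmegaB -> d.-tuple R -> R).
Hypothesis hB : tied_down_brownian_bridge PB B.

Lemma bridge_bounded t : exists c : R, forall u, unit_cube u -> `|B t u| <= c.
Proof.
case: hB => -[/(_ t) [c [_ hc]] _ _] _ _ _; exists (`|c| + 1) => u hu.
by apply: hc => //; rewrite (le_lt_trans (ler_norm _))// ltrDl.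
Qed.

(** Along pairs of points that get arbitrarily close, the increments of the
    bridge tend to zero in probability, hence cannot all exceed [e]. *)
Lemma linked_increments_null (u v : nat -> d.-tuple R) (e : R) : 0 < e ->
  (forall k, unit_cube (u k)) -> (forall k, unit_cube (v k)) ->
  (forall k, dist1 (u k) (v k) <= k.+1%:R^-1) ->
  let bad := \bigcap_k [set t | e < `|B t (u k) - B t (v k)|] in
  measurable bad /\ PB bad = 0%E.
Proof.
move=> e0 hu hv duv bad.
have mE k : measurable [set t | e < `|B t (u k) - B t (v k)|].
  rewrite -[X in measurable X]setTI; apply: measurable_fun_ltr => //.
  by apply: measurableT_comp => //; apply: measurable_funB; exact: (measurable_bridge hB).
have mbad : measurable bad by exact: bigcapT_measurable.
split => //; apply/eqP; rewrite eq_le measure_ge0 andbT.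
have badk k : (PB bad <= ((e ^+ 2)^-1 * k.+1%:R^-1)%:E)%E.
  have := bridge_increment_prob hB (hu k) (hv k) e0.
  rewrite -lee_pdivlMl ?exprn_gt0// => h.
  apply: le_trans (le_trans h _).
    apply: le_measure; rewrite ?inE//.
    by move=> t /(_ k I).
  by rewrite -EFinM lee_fin ler_wpM2l// invr_ge0 exprn_ge0// ltW.
have fin : PB bad = (fine (PB bad))%:E by rewrite fineK// fin_num_measure.
rewrite fin lee_fin leNgt; apply/negP => p0.
pose k := Num.truncn ((e ^+ 2)^-1 / fine (PB bad)).
have := badk k; rewrite fin lee_fin; apply/negP; rewrite -ltNge.
rewrite ltr_pdivrMr ?ltr0n// -ltr_pdivrMl// mulrC.
exact: truncnS_gt.
Qed.

(** Compactness reduces the paths to finitely many profiles up to [e]; these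
    profiles cut the cube into finitely many cells on which each path nearly
    stays constant. Two cells with points arbitrarily close to each other are
    joined almost surely by the covariance estimate, and the remaining pairs of
    cells stay at a positive distance. *)
Lemma tight_equicontinuity (p : R) : 0 < p ->
  exists k : R, forall e : R, 0 < e -> exists (A : set OmegaB) (eta : R),
  [/\ measurable A, 0 < eta, ((1 - p)%:E <= PB A)%E &
   forall t, A t -> (forall u, unit_cube u -> `|B t u| <= k) /\
     forall u v, unit_cube u -> unit_cube v -> dist1 u v < eta -> `|B t u - B t v| <= e].
Proof.
move=> p0; case: (hB) => -[_ mopen /(_ p p0) [K [cK clK PK]]] _ _ _.
have mK : measurable (B @^-1` K).
  have := mopen (~` K) (closed_openC clK); rewrite preimage_setC => /measurableC.
  by rewrite setCK.
have [N1 [g1 [M1 [g1M Kg1]]]] := compact_uniform_net cK (@ltr01 R).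
exists (1 + M1) => e e0.
have [N [g [M [gM Kg]]]] := compact_uniform_net cK (divr_gt0 e0 (ltr0n _ 7)).
have [F [cell osc]] := finite_oscillation (divr_gt0 e0 (ltr0n _ 7)) gM.
pose close (q : F * F) (k : nat) u v := [/\ unit_cube u, unit_cube v, cell u = q.1,
  cell v = q.2 & dist1 u v <= k.+1%:R^-1].
pose linked (q : F * F) := forall k, exists uv, close q k uv.1 uv.2.
have [kf hkf] : exists kf : F * F -> nat, forall q, ~ linked q ->
    forall uv, ~ close q (kf q) uv.1 uv.2.
  suff /choice[kf hkf] : forall q, exists k, ~ linked q -> forall uv, ~ close q k uv.1 uv.2.
    by exists kf.
  move=> q.
  have [l|l] := pselect (linked q); first by exists 0%N.
  have [k hk] : exists k, ~ exists uv, close q k uv.1 uv.2 by apply/existsNP.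
  by exists k => _ uv huv; apply: hk; exists uv.
have [uvf huvf] : exists uvf : F * F -> nat -> d.-tuple R * d.-tuple R, forall q,
    linked q -> forall k, close q k (uvf q k).1 (uvf q k).2.
  suff /choice[uvf huvf] : forall q, exists f : nat -> d.-tuple R * d.-tuple R,
      linked q -> forall k, close q k (f k).1 (f k).2 by exists uvf.
  move=> q.
  have [/choice[f hf]|l] := pselect (linked q); first by exists f.
  by exists (fun=> ([tuple of nseq d 0], [tuple of nseq d 0])).
pose bad (q : F * F) : set OmegaB := if pselect (linked q) then
  \bigcap_k [set t | e / 7 < `|B t (uvf q k).1 - B t (uvf q k).2|] else set0.
have hbad q : measurable (bad q) /\ PB (bad q) = 0%E.
  rewrite /bad; case: pselect => [l|_] /=; last by split => //; exact: measure0.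
  apply: linked_increments_null; first by rewrite divr_gt0.
  - by move=> k; case: (huvf q l k).
  - by move=> k; case: (huvf q l k).
  - by move=> k; case: (huvf q l k).
pose Bad := \big[setU/set0]_(q : F * F) bad q.
have [mBad PBad] : measurable Bad /\ PB Bad = 0%E.
  rewrite /Bad; elim/big_ind: _ => [|E G [mE PE] [mG PG]|q _]; last exact: hbad.
    by split => //; exact: measure0.
  by split; [exact: measurableU|exact: null_set_setU].
pose eta : R := ((\max_q kf q).+1)%:R^-1.
exists (B @^-1` K `\` Bad), eta; split.
- exact: measurableD.
- by rewrite invr_gt0 ltr0n.
- rewrite measureD//=; last by rewrite -ge0_fin_numE// fin_num_measure.
  have -> : PB (B @^-1` K `&` Bad) = 0%E.
    apply/eqP; rewrite eq_le measure_ge0 andbT -PBad.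
    by apply: le_measure; rewrite ?inE//; exact: measurableI.
  by rewrite sube0.
- move=> t [Kt nBad]; split.
    move=> u hu; have [i hi] := Kg1 _ Kt (bridge_bounded t).
    rewrite -[B t u](subrK (g1 i u)) (le_trans (ler_normD _ _))// lerD//.
      by rewrite distrC hi.
    exact: g1M.
  move=> u v hu hv uv; have [i hi] := Kg _ Kt (bridge_bounded t).
  have near x y : unit_cube x -> unit_cube y -> cell x = cell y -> `|B t x - B t y| <= 3 * (e / 7).
    move=> hx hy /(osc x y hx hy)/(_ i); have := hi x hx; have := hi y hy.
    rewrite !ler_norml => /andP[a1 a2] /andP[b1 b2] /andP[c1 c2].
    by apply/andP; split; lra.
  pose q := (cell u, cell v).
  have lq : linked q.
    apply: contrapT => /hkf /(_ (u, v)); apply; split => //=.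
    rewrite ltW// (lt_le_trans uv)// lef_pV2 ?posrE ?ltr0n// ler_nat ltnS.
    exact: leq_bigmax.
  have [k hk] : exists k, `|B t (uvf q k).1 - B t (uvf q k).2| <= e / 7.
    apply: contrapT => nk; apply: nBad; rewrite /Bad -bigcup_pred.
    exists q => //; rewrite /bad; case: pselect => //= _ k _ /=.
    by rewrite ltNge; apply/negP => hk; apply: nk; exists k.
  have [h1 h2 h3 h4 h5] := huvf q lq k.
  have := near _ _ hu h1 (esym h3); have := near _ _ hv h2 (esym h4).
  move: hk; rewrite !ler_norml => /andP[a1 a2] /andP[b1 b2] /andP[c1 c2].
  by apply/andP; split; lra.
Qed.

End equicontinuity.

(** * The weighted integral of the squared limit process *)

Lemma expRN_dist {R : realType} (x y : R) : 0 <= x -> 0 <= y ->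
  `|expR (- x) - expR (- y)| <= `|x - y|.
Proof.
wlog xy : x y / x <= y => [H|] x0 y0.
  by case/orP: (le_total x y) => h; [|rewrite distrC [leRHS]distrC]; exact: H.
have e : expR (- y) = expR (- x) * expR (- (y - x)) by rewrite -expRD; congr expR; ring.
have h1 := expR_ge1Dx (- (y - x)).
have h2 : expR (- (y - x)) <= 1 by rewrite -expR0 ler_expR oppr_le0 subr_ge0.
have h3 : expR (- x) <= 1 by rewrite -expR0 ler_expR oppr_le0.
have h4 := expR_gt0 (- x).
rewrite [leRHS]distrC !ger0_norm ?subr_ge0// ?ler_expR ?lerN2// e.
have : expR (- x) * (1 - expR (- (y - x))) <= 1 * (1 - expR (- (y - x))).
  by rewrite ler_wpM2r// subr_ge0.
by move: (expR (- x)) (expR (- (y - x))) h1 => a b; lra.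
Qed.

Lemma expRN_dist1 {R : realType} (x y : R) : 0 <= x -> 0 <= y ->
  `|expR (- x) - expR (- y)| <= 1.
Proof.
have h (z : R) : 0 <= z -> 0 <= expR (- z) <= 1.
  by move=> z0; rewrite expR_ge0 -expR0 ler_expR oppr_le0.
move=> /h/andP[x0 x1] /h/andP[y0 y1].
by rewrite ler_norml; apply/andP; split; lra.
Qed.

Lemma cvg_dist_le {R : realType} (f : R ^nat) (l : R) :
  (forall e : R, 0 < e -> \forall n \near \oo, `|l - f n| <= e) -> f n @[n --> \oo] --> l.
Proof. by move=> h; apply/cvgrPdist_le => /= e; exact: h. Qed.

Section weighted_squares.
Context {R : realType} {d : nat} (w' : d.-tuple R -> R) (M : R).
Hypothesis bw : bounded_measurable w'.
Hypothesis w'M : forall u, 0 <= w' u <= M.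
Hypothesis w'0 : forall u, ~ unit_cube u -> w' u = 0.
Local Notation Q := (@cube_measure R d).

(** [h] is often a path of a tight process, whence the care taken not to use its
    measurability. *)
Definition weighted_square (h : d.-tuple R -> R) : R :=
  expect Q (fun u => h u ^+ 2 * w' u).

Lemma weighted_square_ge0 h : 0 <= weighted_square h.
Proof.
apply: expect_ge0 => u; rewrite mulr_ge0 ?sqr_ge0//.
by case/andP: (w'M u).
Qed.

Lemma weighted_square_dist (h g : d.-tuple R -> R) (a r : R) :
  (forall u, unit_cube u -> `|h u| <= a) -> (forall u, unit_cube u -> `|g u| <= a) ->
  (forall u, unit_cube u -> `|h u - g u| <= r) ->
  `|weighted_square h - weighted_square g| <= 2 * a * r * M.
Proof.
move=> ha ga hgr.
have c1 : unit_cube (ones R d) by move=> j; rewrite tnth_mktuple ler01 lexx.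
have a0 : 0 <= a := le_trans (normr_ge0 _) (ha _ c1).
have r0 : 0 <= r := le_trans (normr_ge0 _) (hgr _ c1).
have M0 : 0 <= M by case/andP: (w'M (ones R d)) => x y; exact: le_trans y.
have bnd (f : d.-tuple R -> R) : (forall u, unit_cube u -> `|f u| <= a) ->
    forall u, 0 <= f u ^+ 2 * w' u <= a ^+ 2 * M.
  move=> fa u; have /andP[w0 wM] := w'M u; rewrite mulr_ge0 ?sqr_ge0//=.
  have [hu|hu] := pselect (unit_cube u).
    rewrite ler_pM ?sqr_ge0// -[leLHS]real_normK ?num_real//.
    by rewrite lerXn2r ?nnegrE// fa.
  by rewrite w'0// mulr0 mulr_ge0// sqr_ge0.
apply: (expect_dist_le Q (bnd h ha) (bnd g ga)) => u.
have /andP[w0 wM] := w'M u; have [hu|hu] := pselect (unit_cube u); last first.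
  by rewrite w'0// !mulr0 subrr normr0 !mulr_ge0.
rewrite -mulrBl subr_sqr !normrM (ger0_norm w0) ler_pM ?mulr_ge0//.
rewrite mulrC ler_pM// ?hgr//; rewrite (le_trans (ler_normD _ _))//.
by rewrite mulr_natl mulr2n lerD ?ha ?ga.
Qed.

Definition grid_weight (m : nat) (p : {ffun 'I_d -> 'I_m.+1}) : R :=
  expect Q (fun u => (grid_round m u == grid_point p)%:R * w' u).

Definition grid_cube_point (m : nat) (p : {ffun 'I_d -> 'I_m.+2}) : cube_point :=
  exist _ (grid_point p) (grid_pointP (R := R) p (ltn0Sn m)).

(** The Riemann sum of mesh [1 / m.+1], multiplied by [k], as a quadratic form
    in the values on the grid. *)
Definition grid_form (k : R) (m : nat) : seq (R * cube_point) :=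
  [seq (k * grid_weight p, grid_cube_point p) | p <- index_enum {ffun 'I_d -> 'I_m.+2}].

Lemma grid_form_ge0 k m : 0 <= k -> all (fun ci => 0 <= ci.1) (grid_form k m).
Proof.
move=> k0; rewrite /grid_form all_map; apply/allP => p _ /=; rewrite mulr_ge0//.
apply: expect_ge0 => u; rewrite mulr_ge0//.
by case/andP: (w'M u).
Qed.

Lemma grid_formE (h : d.-tuple R -> R) k m :
  quadratic_form (fun v : cube_point => h (sval v)) (grid_form k m) =
  k * weighted_square (h \o grid_round m.+1).
Proof.
have bc (p : {ffun 'I_d -> 'I_m.+2}) : bounded_measurable (fun u =>
    (grid_round m.+1 u == grid_point p)%:R * w' u).
  by apply: bmM => //; apply: bm_bool; exact: measurable_grid_cell.
rewrite /quadratic_form big_map /weighted_square.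
have -> : (fun u => (h \o grid_round m.+1) u ^+ 2 * w' u) =
    (fun u => \sum_(p : {ffun 'I_d -> 'I_m.+2})
      h (grid_point p) ^+ 2 * ((grid_round m.+1 u == grid_point p)%:R * w' u)).
  apply/funext => u /=; rewrite (grid_sum (fun v => h v ^+ 2) u (ltn0Sn m)) mulr_suml.
  by apply: eq_bigr => p _; rewrite mulrA.
rewrite expect_sum; last by move=> p _; exact: bmZ.
rewrite mulr_sumr; apply: eq_bigr => p _.
by rewrite expectZ//= -/(grid_weight p); ring.
Qed.

End weighted_squares.

Lemma grid_round_cube {R : realType} {d : nat} m (u : d.-tuple R) :
  unit_cube (grid_round m.+1 u).
Proof. by have [p ->] := grid_round_point m.+1 u; exact: grid_pointP. Qed.

Lemma dist1_grid_round {R : realType} {d : nat} m (u : d.-tuple R) : unit_cube u ->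
  dist1 u (grid_round m.+1 u) <= d%:R * m.+1%:R^-1.
Proof.
move=> hu; apply: (@le_trans _ _ (\sum_(j < d) m.+1%:R^-1)).
  by apply: ler_sum => j _; exact: grid_round_near.
by rewrite sumr_const card_ord mulr_natl.
Qed.

Section bridge_statistic.
Context {R : realType} {d : nat}.
Context {dispB : measure_display} {OmegaB : measurableType dispB}.
Context (PB : probability OmegaB R) (B : OmegaB -> d.-tuple R -> R).
Hypothesis hB : tied_down_brownian_bridge PB B.
Context (w' : d.-tuple R -> R) (M : R).
Hypothesis bw : bounded_measurable w'.
Hypothesis w'M : forall u, 0 <= w' u <= M.
Hypothesis w'0 : forall u, ~ unit_cube u -> w' u = 0.
Local Notation Phi b := (weighted_square w' (limit_process b)).

(** The statistic is a locally Lipschitz function of the path for the supremum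
    norm, so its superlevel sets are preimages of open sets of bounded
    functions. Fubini is of no help here, since [B] may fail to be jointly
    measurable. *)
Lemma measurable_weighted_square_bridge :
  measurable_fun setT (fun t => Phi (B t)).
Proof.
move=> mD; apply: (measurability _ (RGenOInfty.measurableE R)) => //.
move=> /= _ [_ [x ->] <-]; apply: measurableI => //.
pose U : set {uniform` @unit_cube R d -> R} := [set b |
  (exists c : R, forall u, unit_cube u -> `|b u| <= c) /\ x < Phi b].
rewrite (_ : _ @^-1` _ = B @^-1` U); last first.
  apply/seteqP; split => t /=; rewrite in_itv/= andbT; last by case.
  move=> xt.
  by split => //; exact: (bridge_bounded hB).
case: hB => -[_ + _] _ _ _; apply; rewrite openE => b [[c bc] xb].
have c1 : unit_cube (ones R d) by move=> j; rewrite tnth_mktuple ler01 lexx.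
have c0 : 0 <= c := le_trans (normr_ge0 _) (bc _ c1).
have M0 : 0 <= M by case/andP: (w'M (ones R d)) => y z; exact: le_trans z.
pose C : R := 2 * ((1 + d%:R) * (c + 1)) * (1 + d%:R) * M.
have C0 : 0 <= C.
  rewrite !mulr_ge0// ?addr_ge0//.
pose r := Num.min 1 ((Phi b - x) / (C + 1)).
have r0 : 0 < r by rewrite lt_min ltr01/= divr_gt0 ?subr_gt0// ltr_wpDl.
rewrite /interior; apply/uniform_nbhs; exists [set xy | ball xy.1 r xy.2].
split; first exact: (entourage_ball R (PosNum r0)).
move=> h hr; have {}hr u : unit_cube u -> `|b u - h u| <= r by move=> hu; rewrite ltW// hr.
have r1 : r <= 1 by rewrite ge_min lexx.
have hc u : unit_cube u -> `|h u| <= c + 1.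
  move=> hu; rewrite -[h u](subrK (b u)) (le_trans (ler_normD _ _))// addrC lerD ?bc//.
  by rewrite distrC (le_trans (hr u hu)).
split; first by exists (c + 1).
have := @weighted_square_dist R d w' M w'M w'0 (limit_process b) (limit_process h)
  ((1 + d%:R) * (c + 1)) ((1 + d%:R) * r).
move=> /(_ _ _ _)/le_trans => H.
have /ler_normlP[_ hd] : `|Phi b - Phi h| <= C * r.
  rewrite (_ : C * r = 2 * ((1 + d%:R) * (c + 1)) * ((1 + d%:R) * r) * M); last by rewrite /C; ring.
  apply: weighted_square_dist => // u hu.
  - by apply: limit_process_bound => // v hv; rewrite (le_trans (bc v hv))// lerDl.
  - exact: limit_process_bound.
  - exact: limit_process_distl.
have : C * r < Phi b - x.
  apply: (@lt_le_trans _ _ ((C + 1) * r)); first by rewrite ltr_pM2r// ltrDl.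
  by rewrite mulrC -ler_pdivlMr ?ltr_wpDl// ge_min lexx orbT.
by move: hd; lra.
Qed.

(** On an event of probability close to one the path is bounded and
    equicontinuous, so the Riemann sums of the statistic are uniformly close to
    it. *)
Lemma bridge_discretization (k : R) : 0 <= k ->
  expect PB (fun t => expR (- quadratic_form
    (fun v : cube_point => limit_process (B t) (sval v)) (grid_form w' k m)))
    @[m --> \oo] --> expect PB (fun t => expR (- (k * Phi (B t)))).
Proof.
move=> k0; apply: cvg_dist_le => e e0.
have e2 : 0 < e / 2 by rewrite divr_gt0.
have [c hc] := tight_equicontinuity hB e2.
have M0 : 0 <= M by case/andP: (w'M (ones R d)) => y z; exact: le_trans z.
pose a : R := (1 + d%:R) * `|c|.
have a0 : 0 <= a by rewrite mulr_ge0// addr_ge0.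
pose C1 : R := k * (2 * a * (1 + d%:R) * M).
pose C2 : R := k * (2 * a * (d%:R * (d%:R * `|c|)) * M).
have C10 : 0 <= C1 by rewrite !mulr_ge0// addr_ge0.
have C20 : 0 <= C2 by rewrite !mulr_ge0.
have dl0 : 0 < e / 4 / (C1 + 1) by rewrite !divr_gt0// ltr_wpDl.
have [A [eta [mA eta0 PA hA]]] := hc _ dl0.
have eta1 : 0 < eta / (d%:R + 1) by rewrite divr_gt0// ltr_wpDl.
have eta2 : 0 < e / 4 / (C2 + 1) by rewrite !divr_gt0// ltr_wpDl.
near=> m.
have hm1 : m.+1%:R^-1 < eta / (d%:R + 1).
  by near: m; exact: (near_infty_natSinv_lt (PosNum eta1)).
have hm2 : m.+1%:R^-1 < e / 4 / (C2 + 1).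
  by near: m; exact: (near_infty_natSinv_lt (PosNum eta2)).
pose X t := k * Phi (B t); pose Y t := k * weighted_square w' (limit_process (B t) \o grid_round m.+1).
have X0 t : 0 <= X t by rewrite mulr_ge0// (weighted_square_ge0 w'M).
have Y0 t : 0 <= Y t by rewrite mulr_ge0// (weighted_square_ge0 w'M).
have mX : measurable_fun setT X by apply: measurable_funM => //; exact: measurable_weighted_square_bridge.
have YE t : quadratic_form (fun v : cube_point => limit_process (B t) (sval v)) (grid_form w' k m) = Y t.
  exact: (grid_formE bw).
have mY : measurable_fun setT Y.
  have -> : Y = (fun t => quadratic_form
      (fun v : cube_point => limit_process (B t) (sval v)) (grid_form w' k m)).
    by apply/funext => t; rewrite YE.
  by apply: measurable_quadratic_form => v; exact: (measurable_limit_bridge hB (svalP v)).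
under [X in `|_ - expect PB X|]eq_fun do rewrite YE.
have bX := bm_expRN mX X0; have bY := bm_expRN mY Y0.
have dXY t : A t -> `|X t - Y t| <= e / 2.
  move=> At; have [hk hu] := hA t At.
  have hc' v : unit_cube v -> `|B t v| <= `|c| by move=> hv; rewrite (le_trans (hk v hv))// ler_norm.
  rewrite /X /Y -mulrBr normrM (ger0_norm k0).
  pose r : R := (1 + d%:R) * (e / 4 / (C1 + 1)) + d%:R * (d%:R * m.+1%:R^-1 * `|c|).
  have wd := @weighted_square_dist R d w' M w'M w'0 (limit_process (B t))
     (limit_process (B t) \o grid_round m.+1) a r.
  apply: (@le_trans _ _ (k * (2 * a * r * M))).
    rewrite ler_wpM2l//; apply: wd => u hcu.
    - exact: limit_process_bound.
    - by apply: limit_process_bound => //; exact: grid_round_cube.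
    - have du := dist1_grid_round m hcu.
      apply: (@le_trans _ _ ((1 + d%:R) * (e / 4 / (C1 + 1)) +
          d%:R * (dist1 u (grid_round m.+1 u) * `|c|))).
        apply: limit_process_distr => //; first exact: grid_round_cube.
        move=> x y hx hy xy; apply: hu => //.
        apply: (le_lt_trans xy); apply: (le_lt_trans du).
        apply: (@lt_trans _ _ ((d%:R + 1) * m.+1%:R^-1)).
          by rewrite ltr_pM2r ?invr_gt0 ?ltr0n// ltrDl.
        by rewrite mulrC -ltr_pdivlMr// ltr_wpDl.
      by rewrite lerD2l ler_wpM2l// ler_wpM2r.
  have -> : k * (2 * a * r * M) = C1 * (e / 4 / (C1 + 1)) + C2 * m.+1%:R^-1.
    by rewrite /r /C1 /C2; ring.
  have h1 : C1 * (e / 4 / (C1 + 1)) <= e / 4.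
    by rewrite mulrCA ler_piMr ?divr_ge0 ?(ltW e0)// ler_pdivrMr ?ltr_wpDl// mul1r lerDl.
  have h2 : C2 * m.+1%:R^-1 <= e / 4.
    apply: (@le_trans _ _ ((C2 + 1) * m.+1%:R^-1)).
      by rewrite ler_wpM2r ?invr_ge0// lerDl.
    by rewrite mulrC -ler_pdivlMr ?ltr_wpDl// ltW.
  by apply: (le_trans (lerD h1 h2)); lra.
have mAc : measurable (~` A) by exact: measurableC.
have bA : bounded_measurable (\1_(~` A) : OmegaB -> R).
  split; first exact: measurable_indic.
  by exists 1 => t; rewrite indicE; case: (_ \in _); rewrite ?normr1 ?normr0.
rewrite -(expectB PB bX bY); apply: (le_trans (norm_expect PB (bmB bX bY))).
apply: (@le_trans _ _ (expect PB (fun t => e / 2 + \1_(~` A) t))).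
  apply: le_expect; first by apply: bm_norm; exact: bmB.
    by apply: bmD => //; exact: bm_cst.
  move=> t; rewrite indicE; have [At|At] := pselect (A t).
    by rewrite memNset/= ?addr0 ?(le_trans (expRN_dist _ _))// ?dXY//; exact.
  rewrite mem_set//= (@le_trans _ _ 1)//; last by rewrite lerDr (ltW e2).
  exact: expRN_dist1.
rewrite (expectD PB (bm_cst _) bA) expect_cst expect_indic//.
have -> : fine (PB (~` A)) = 1 - fine (PB A).
  by rewrite probability_setC// fineB ?fin_num_measure.
have : 1 - e / 2 <= fine (PB A) by rewrite -lee_fin fineK// fin_num_measure.
by lra.
Unshelve. all: by end_near. Qed.

End bridge_statistic.

(** * Convergence of the statistic *)

(** Choose [r], then [m], then [n]. *)
Local Lemma cvg_approximation {R : realType} (a x : R ^nat) (b : nat -> R ^nat)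
    (c y : R ^nat) (l z : R) :
  (forall m, b m n @[n --> \oo] --> c m) -> c m @[m --> \oo] --> l ->
  x n @[n --> \oo] --> (0 : R) -> y m @[m --> \oo] --> (0 : R) -> 0 <= z ->
  (forall n m r, (0 < n)%N -> 0 < r ->
    `|a n - b m n| <= (1 + r^-1) * (x n + y m) + r * z) ->
  a n @[n --> \oo] --> l.
Proof.
move=> bc cl x0 y0 z0 ab; apply: cvg_dist_le => e e0.
pose r := e / 4 / (z + 1); have r0 : 0 < r by rewrite !divr_gt0// ltr_wpDl.
have rz : r * z <= e / 4.
  rewrite /r -mulrA ler_piMr ?divr_ge0 ?(ltW e0)// mulrC ler_pdivrMr ?ltr_wpDl//.
  by rewrite mul1r lerDl.
pose s := e / 8 / (1 + r^-1).
have s0 : 0 < s by rewrite !divr_gt0// addr_gt0// invr_gt0.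
have [m [ym lm]] : exists m, `|y m| <= s /\ `|l - c m| <= e / 4.
  have e4 : 0 < e / 4 by rewrite divr_gt0.
  have h1 : \forall m \near \oo, `|y m| <= s.
    by have /cvgr0Pnorm_le := y0; exact.
  have h2 : \forall m \near \oo, `|l - c m| <= e / 4.
    by have /cvgrPdist_le := cl; exact.
  have [m] := filter_ex (filterI h1 h2).
  by move=> [h3 h4]; exists m.
have e4 : 0 < e / 4 by rewrite divr_gt0.
near=> n.
have n0 : (0 < n)%N by near: n; exists 1%N.
have xn : `|x n| <= s by near: n; have /cvgr0Pnorm_le := x0; exact.
have bn : `|c m - b m n| <= e / 4 by near: n; have /cvgrPdist_le := bc m; exact.
have h : (1 + r^-1) * (x n + y m) <= e / 4.
  have -> : e / 4 = (1 + r^-1) * (s + s).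
    by rewrite /s; field; rewrite gt_eqF//= gt_eqF// addr_gt0.
  rewrite ler_wpM2l ?addr_ge0 ?invr_ge0 ?(ltW r0)// lerD//.
    exact: (le_trans (ler_norm _)).
  exact: (le_trans (ler_norm _)).
have an := ab n m r n0 r0.
have -> : l - a n = (l - c m) + (c m - b m n) + (b m n - a n) by ring.
rewrite (le_trans (ler_normD _ _))//.
have := ler_normD (l - c m) (c m - b m n).
move: an; rewrite distrC.
by move: lm bn h rz; lra.
Unshelve. all: by end_near. Qed.

Section statistic.
Context {R : realType} {d : nat}.
Context {disp0 : measure_display} {Omega0 : measurableType disp0}
  {P0 : probability Omega0 R} (X : {RV P0 >-> d.-tuple R}).
Context {disp : measure_display} {Omega : measurableType disp}
  (P : probability Omega R) (Xs : nat -> {RV P >-> d.-tuple R}).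
Hypothesis hF : forall j : 'I_d, continuous (marginal_cdf X j).
Hypothesis hX_ind : mutually_independent P0 (fun (j : 'I_d) t => tnth (X t) j).
Hypothesis hXs_law : forall i, same_distribution (Xs i) X.
Hypothesis hXs_ind : mutually_independent P (fun i t => Xs i t).
Context (w' : d.-tuple R -> R) (M : R).
Hypothesis bw : bounded_measurable w'.
Hypothesis w'M : forall u, 0 <= w' u <= M.
Hypothesis w'0 : forall u, ~ unit_cube u -> w' u = 0.
Local Notation Q := (@cube_measure R d).
Local Notation beta := (empirical_process X Xs).

(* Off the cube the deviation is unbounded, so it is cut to zero there. *)
Local Definition cut_deviation n t (u : d.-tuple R) : R :=
  (empirical_copula (fun i : 'I_n => Xs i t) u - prod_coords u) * \1_(@unit_cube R d) u.

Local Definition deviation n t (u : d.-tuple R) : R := Num.sqrt n%:R * cut_deviation n t u.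

Local Definition grid_process n m t u : R := limit_process (beta n t) (grid_round m.+1 u).

Local Lemma bm_cut_deviation n :
  bounded_measurable (fun z : Omega * d.-tuple R => cut_deviation n z.1 z.2).
Proof.
have mcoord (k : nat) j : measurable_fun setT (fun z : Omega * d.-tuple R => tnth (Xs k z.1) j).
  apply: (measurableT_comp (measurable_tnth j)).
  by apply: measurableT_comp; [exact: measurable_funPT|exact: measurable_fst].
have m2 j : measurable_fun setT (fun z : Omega * d.-tuple R => tnth z.2 j).
  by apply: (measurableT_comp (measurable_tnth j)); exact: measurable_snd.
have b1 : bounded_measurable (fun z : Omega * d.-tuple R => \1_(@unit_cube R d) z.2 : R).
  split; last by exists 1 => t; rewrite indicE; case: (_ \in _); rewrite ?normr1 ?normr0.
  apply: (measurableT_comp (f := \1_(@unit_cube R d) : d.-tuple R -> R)).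
    by apply: measurable_indic; exact: measurable_unit_cube.
  exact: measurable_snd.
rewrite (_ : (fun z => _) = (fun z : Omega * d.-tuple R =>
    empirical_copula (fun i : 'I_n => Xs i z.1) z.2 * \1_(@unit_cube R d) z.2 -
    prod_coords z.2 * \1_(@unit_cube R d) z.2)); last first.
  by apply/funext => z; exact: mulrBl.
apply: bmB.
  apply: bmM => //; apply: bmZ; apply: bm_sum => i _; apply: bm_prod => j _.
  apply: bm_bool; apply: measurable_fun_ler => //.
  apply: (bmZ _ _).1; apply: bm_sum => k _; apply: bm_bool.
  exact: measurable_fun_ler.
split.
  apply: measurable_funM; last exact: b1.1.
  by apply: measurable_prod => j _; exact: m2.
exists 1 => z; rewrite indicE; have [hu|hu] := pselect (unit_cube z.2); last first.
  by rewrite memNset// mulr0 normr0.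
rewrite mem_set// mulr1 ger0_norm; first by apply: prodr_ile1 => j _; exact: hu.
by apply: prodr_ge0 => j _; case/andP: (hu j).
Qed.

Local Lemma bm_deviation n :
  bounded_measurable (fun z : Omega * d.-tuple R => deviation n z.1 z.2).
Proof. by apply: bmZ; exact: bm_cut_deviation. Qed.

Local Lemma bm_grid_process n m :
  bounded_measurable (fun z : Omega * d.-tuple R => grid_process n m z.1 z.2).
Proof.
have -> : (fun z : Omega * d.-tuple R => grid_process n m z.1 z.2) =
    (fun z => \sum_(p : {ffun 'I_d -> 'I_m.+2}) limit_process (beta n z.1) (grid_point p) *
      (grid_round m.+1 z.2 == grid_point p)%:R).
  by apply/funext => z; rewrite /grid_process (grid_sum _ z.2 (ltn0Sn m)).
apply: bm_sum => p _; apply: bmM.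
  apply: (bm_comp (f := fun t => limit_process (beta n t) (grid_point p)) measurable_fst).
  exact: (bm_limit_process Xs hF).
apply: bm_bool; apply: (measurableT_comp (measurable_grid_cell p)).
exact: measurable_snd.
Qed.

Local Definition statistic n t : R := weighted_square w' (deviation n t).
Local Definition grid_statistic n m t : R := weighted_square w' (grid_process n m t).

Local Lemma independence_statisticE (w : d.-tuple R -> R) n t :
  (forall h : d.-tuple R -> R, (forall u, 0 <= h u) ->
    \int[lebesgue_tuple R d]_(u in @unit_cube R d) (h u * w u) = expect Q (fun u => h u * w' u)) ->
  independence_statistic w (fun i : 'I_n => Xs i t) = statistic n t.
Proof.
move=> wE; rewrite /independence_statistic wE; last by move=> u; exact: sqr_ge0.
have bc : bounded_measurable (fun u => cut_deviation n t u ^+ 2 * w' u).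
  have [mD [K DK]] := bm_cut_deviation n; apply: bmM bw; apply: bmX; split.
    exact: (measurableT_comp mD (measurable_pair1 t)).
  by exists K => u; exact: (DK (t, u)).
rewrite (_ : (fun u => _) = (fun u => cut_deviation n t u ^+ 2 * w' u)); last first.
  apply/funext => u; rewrite /cut_deviation indicE.
  by have [hu|hu] := pselect (unit_cube u); [rewrite mem_set// mulr1|rewrite w'0// !mulr0].
rewrite -(expectZ Q _ bc); congr (expect Q _); apply/funext => u.
by rewrite mulrA /deviation [in RHS]exprMn sqr_sqrtr.
Qed.

Local Lemma bm_weight : bounded_measurable (fun z : Omega * d.-tuple R => w' z.2).
Proof. by apply: bm_comp bw; exact: measurable_snd. Qed.

Local Lemma bm_statistic n : bounded_measurable (statistic n).
Proof.
apply: (bm_expectl P Q (F := fun t u => deviation n t u ^+ 2 * w' u)).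
by apply: bmM bm_weight; apply: bmX; exact: bm_deviation.
Qed.

Local Lemma bm_grid_statistic n m : bounded_measurable (grid_statistic n m).
Proof.
apply: (bm_expectl P Q (F := fun t u => grid_process n m t u ^+ 2 * w' u)).
by apply: bmM bm_weight; apply: bmX; exact: bm_grid_process.
Qed.

(** Young's inequality with weight [r]: only the difference needs to be small, [b]
    merely bounded. *)
Local Lemma sqr_dist (a b c r : R) : 0 < r ->
  `|a ^+ 2 - b ^+ 2| <=
  (1 + r^-1) * (2 * (a - c) ^+ 2 + 2 * (c - b) ^+ 2) + r * b ^+ 2.
Proof.
move=> r0; have r1 : 0 < r^-1 by rewrite invr_gt0.
have h : 2 * (`|a - b| * `|b|) <= r^-1 * `|a - b| ^+ 2 + r * `|b| ^+ 2.
  have := sqr_ge0 (`|a - b| - r * `|b|).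
  have -> : (`|a - b| - r * `|b|) ^+ 2 =
    r * (r^-1 * `|a - b| ^+ 2 + r * `|b| ^+ 2 - 2 * (`|a - b| * `|b|)).
    by field; rewrite gt_eqF.
  by rewrite pmulr_rge0// subr_ge0.
have h2 : (a - b) ^+ 2 <= 2 * (a - c) ^+ 2 + 2 * (c - b) ^+ 2.
  by have := sqr_ge0 ((a - c) - (c - b)); nra.
apply: (@le_trans _ _ ((1 + r^-1) * `|a - b| ^+ 2 + r * `|b| ^+ 2)); last first.
  by rewrite !real_normK ?num_real// lerD2r ler_wpM2l// addr_ge0// ltW.
have -> : a ^+ 2 - b ^+ 2 = (a - b) ^+ 2 + 2 * ((a - b) * b) by ring.
rewrite (le_trans (ler_normD _ _))// normrX normrM normr_nat normrM.
by move: h; lra.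
Qed.

Local Notation rank_rate := (2 * d%:R ^+ 2 * (4 * d%:R ^+ 2 + 1) : R).
Local Notation increment_rate := (2 + 8 * d%:R ^+ 2 : R).

Local Lemma pointwise_error n m (r : R) u : (0 < n)%N -> 0 < r -> unit_cube u ->
  expect P (fun t => `|deviation n t u ^+ 2 - grid_process n m t u ^+ 2|) <=
  (1 + r^-1) * (2 * (rank_rate * (Num.sqrt n%:R)^-1) +
    2 * (increment_rate * (d%:R * m.+1%:R^-1))) + r * (2 + 2 * d%:R ^+ 2).
Proof.
move=> n0 r0 hu; pose U : cube_point := exist _ u hu.
pose V : cube_point := exist _ _ (grid_round_cube m u).
have bd : bounded_measurable (fun t => deviation n t u).
  have [mD [K DK]] := bm_deviation n; split; last by exists K => t; exact: (DK (t, u)).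
  exact: (measurableT_comp mD (measurable_pair2 u)).
have bl (v : d.-tuple R) : bounded_measurable (fun t => limit_process (beta n t) v).
  exact: (bm_limit_process Xs hF).
have b1 : bounded_measurable (fun t =>
    (deviation n t u - limit_process (beta n t) u) ^+ 2) by apply: bmX; exact: bmB.
have b2 : bounded_measurable (fun t => (limit_process (beta n t) u -
    grid_process n m t u) ^+ 2) by apply: bmX; apply: bmB; exact: bl.
have b3 : bounded_measurable (fun t => grid_process n m t u ^+ 2) by apply: bmX; exact: bl.
have b12 := bmD (bmZ 2 b1) (bmZ 2 b2).
apply: (@le_trans _ _ (expect P (fun t => (1 + r^-1) *
    (2 * (deviation n t u - limit_process (beta n t) u) ^+ 2 +
     2 * (limit_process (beta n t) u - grid_process n m t u) ^+ 2) +
    r * grid_process n m t u ^+ 2))).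
  apply: le_expect; first by apply: bm_norm; apply: bmB => //; exact: bmX.
    by apply: bmD; [exact: bmZ|exact: bmZ].
  by move=> t; exact: sqr_dist.
rewrite (expectD P (bmZ _ b12) (bmZ _ b3)) (expectZ P _ b12) (expectZ P _ b3).
rewrite (expectD P (bmZ _ b1) (bmZ _ b2)) (expectZ P _ b1) (expectZ P _ b2).
apply: lerD.
  rewrite ler_wpM2l ?addr_ge0 ?invr_ge0 ?(ltW r0)//.
  apply: lerD; rewrite ler_wpM2l//.
    under eq_fun do rewrite /deviation /cut_deviation indicE mem_set// mulr1.
    exact: rank_process_approx_at.
  apply: (le_trans (empirical_limit_increment hF hX_ind hXs_law hXs_ind U V n0)).
  by rewrite ler_wpM2l// ?addr_ge0 ?mulr_ge0 ?sqr_ge0//; exact: dist1_grid_round.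
rewrite ler_wpM2l ?(ltW r0)//.
exact: (empirical_limit_sqr hF hX_ind hXs_law hXs_ind V n0).
Qed.

(** Fubini reduces the error to a bound at each point of the cube that is uniform
    in the point. *)
Local Lemma statistic_error n m (r : R) : (0 < n)%N -> 0 < r ->
  expect P (fun t => `|statistic n t - grid_statistic n m t|) <=
  M * ((1 + r^-1) * (2 * (rank_rate * (Num.sqrt n%:R)^-1) +
    2 * (increment_rate * (d%:R * m.+1%:R^-1))) + r * (2 + 2 * d%:R ^+ 2)).
Proof.
move=> n0 r0; set E := (X in _ <= M * X).
have M0 : 0 <= M by case/andP: (w'M (ones R d)) => y z; exact: le_trans z.
have c1 : unit_cube (ones R d) by move=> j; rewrite tnth_mktuple ler01 lexx.
have E0 : 0 <= E by apply: le_trans (pointwise_error m n0 r0 c1); exact: expect_ge0.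
pose F t u := `|deviation n t u ^+ 2 - grid_process n m t u ^+ 2| * w' u.
have bF : bounded_measurable (fun z : Omega * d.-tuple R => F z.1 z.2).
  apply: bmM bm_weight; apply: bm_norm; apply: bmB; apply: bmX.
    exact: bm_deviation.
  exact: bm_grid_process.
have sec (G : Omega -> d.-tuple R -> R) t :
    bounded_measurable (fun z : Omega * d.-tuple R => G z.1 z.2) -> bounded_measurable (G t).
  move=> [mG [K GK]]; split; last by exists K => u; exact: (GK (t, u)).
  exact: (measurableT_comp mG (measurable_pair1 t)).
have b1 t : bounded_measurable (fun u => deviation n t u ^+ 2 * w' u).
  by apply: bmM bw; apply: bmX; apply: sec; exact: bm_deviation.
have b2 t : bounded_measurable (fun u => grid_process n m t u ^+ 2 * w' u).
  by apply: bmM bw; apply: bmX; apply: sec; exact: bm_grid_process.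
apply: (@le_trans _ _ (expect P (fun t => expect Q (F t)))).
  apply: le_expect; first by apply: bm_norm; apply: bmB; [exact: bm_statistic|exact: bm_grid_statistic].
    exact: (bm_expectl P Q bF).
  move=> t; rewrite /statistic /grid_statistic /weighted_square -(expectB Q (b1 t) (b2 t)).
  apply: (le_trans (norm_expect Q (bmB (b1 t) (b2 t)))).
  apply: le_expect; first by apply: bm_norm; exact: bmB.
    exact: sec.
  by move=> u; rewrite /F -mulrBl normrM (ger0_norm (x := w' u))//; case/andP: (w'M u).
rewrite (expect_fubini P Q bF); apply: expect_le_cst; first exact: (bm_expectr P Q bF).
move=> u; have [hu|hu] := pselect (unit_cube u); last first.
  rewrite /F; under eq_fun do rewrite w'0// mulr0.
  by rewrite expect_cst mulr_ge0.
have bu : bounded_measurable (fun t => `|deviation n t u ^+ 2 - grid_process n m t u ^+ 2|).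
  have [mG [K GK]] : bounded_measurable (fun z : Omega * d.-tuple R =>
      `|deviation n z.1 z.2 ^+ 2 - grid_process n m z.1 z.2 ^+ 2|).
    by apply: bm_norm; apply: bmB; apply: bmX; [exact: bm_deviation|exact: bm_grid_process].
  split; last by exists K => t; exact: (GK (t, u)).
  exact: (measurableT_comp mG (measurable_pair2 u)).
rewrite /F; under eq_fun do rewrite mulrC.
rewrite expectZ//; have /andP[w0 wM] := w'M u.
by rewrite ler_pM// ?expect_ge0//; exact: pointwise_error.
Qed.

Local Lemma laplace_error (k : R) n m (r : R) : 0 <= k -> (0 < n)%N -> 0 < r ->
  `|expect P (fun t => expR (- (k * statistic n t))) -
    expect P (fun t => expR (- (k * grid_statistic n m t)))| <=
  (1 + r^-1) * (k * M * (2 * (rank_rate * (Num.sqrt n%:R)^-1)) +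
    k * M * (2 * (increment_rate * (d%:R * m.+1%:R^-1)))) +
  r * (k * M * (2 + 2 * d%:R ^+ 2)).
Proof.
move=> k0 n0 r0.
have s0 t : 0 <= k * statistic n t by rewrite mulr_ge0// (weighted_square_ge0 w'M).
have g0 t : 0 <= k * grid_statistic n m t by rewrite mulr_ge0// (weighted_square_ge0 w'M).
have bs := bmZ k (bm_statistic n); have bg := bmZ k (bm_grid_statistic n m).
have b1 := bm_expRN bs.1 s0; have b2 := bm_expRN bg.1 g0.
have b3 : bounded_measurable (fun t => `|statistic n t - grid_statistic n m t|).
  by apply: bm_norm; apply: bmB; [exact: bm_statistic|exact: bm_grid_statistic].
rewrite -(expectB P b1 b2); apply: (le_trans (norm_expect P (bmB b1 b2))).
apply: (@le_trans _ _ (k * expect P (fun t => `|statistic n t - grid_statistic n m t|))).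
  rewrite -expectZ//; apply: le_expect; [by apply: bm_norm; exact: bmB|exact: bmZ|].
  move=> t; apply: (le_trans (expRN_dist (s0 t) (g0 t))).
  by rewrite -mulrBr normrM (ger0_norm k0).
apply: (le_trans (ler_wpM2l k0 (statistic_error m n0 r0))).
by rewrite le_eqVlt; apply/orP; left; apply/eqP; ring.
Qed.

Context {dispB : measure_display} {OmegaB : measurableType dispB}.
Context (PB : probability OmegaB R) (B : OmegaB -> d.-tuple R -> R).
Hypothesis hB : tied_down_brownian_bridge PB B.

Local Lemma grid_statistic_cvg (k : R) m : 0 <= k ->
  expect P (fun t => expR (- (k * grid_statistic n m t))) @[n --> \oo] -->
  expect PB (fun t => expR (- quadratic_form
    (fun v : cube_point => limit_process (B t) (sval v)) (grid_form w' k m))).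
Proof.
move=> k0; have gE n t : k * grid_statistic n m t = quadratic_form
    (fun v : cube_point => limit_process (beta n t) (sval v)) (grid_form w' k m).
  by rewrite (grid_formE bw).
under eq_fun do under eq_fun do rewrite gE.
apply: (quadratic_form_cvg (V := fun n (v : cube_point) t => limit_process (beta n t) (sval v))
  (V' := fun (v : cube_point) t => limit_process (B t) (sval v))).
- by move=> n v; exact: (bm_limit_process Xs hF n (sval v)).1.
- by move=> v; exact: (measurable_limit_bridge hB (svalP v)).
- move=> th s.
  under eq_fun do under eq_fun do rewrite limit_process_linear_form.
  under [X in expect PB X]eq_fun do rewrite limit_process_linear_form.
  rewrite (bridge_cos hB); exact: empirical_cos_cvg.
- exact: (grid_form_ge0 w'M).
Qed.

(** For a fixed grid the Riemann sums are quadratic forms in finitely many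
    values of the process and converge by the central limit theorem; the grid
    error is uniform in [n]. *)
Lemma statistic_laplace (k : R) : 0 <= k ->
  expect P (fun t => expR (- (k * statistic n t))) @[n --> \oo] -->
  expect PB (fun t => expR (- (k * weighted_square w' (limit_process (B t))))).
Proof.
move=> k0; have M0 : 0 <= M by case/andP: (w'M (ones R d)) => y z; exact: le_trans z.
apply: (cvg_approximation (z := k * M * (2 + 2 * d%:R ^+ 2))
  (x := fun n => k * M * (2 * (rank_rate * (Num.sqrt n%:R)^-1)))
  (y := fun m => k * M * (2 * (increment_rate * (d%:R * m.+1%:R^-1))))
  (b := fun m n => expect P (fun t => expR (- (k * grid_statistic n m t))))
  (c := fun m => expect PB (fun t => expR (- quadratic_form
    (fun v : cube_point => limit_process (B t) (sval v)) (grid_form w' k m))))).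
- by move=> m; exact: grid_statistic_cvg.
- exact: (bridge_discretization hB bw w'M w'0 k0).
- rewrite -(mulr0 (k * M)) -(mulr0 2) -(mulr0 rank_rate).
  by do 3 apply: cvgMr; exact: cvg_inv_sqrt.
- rewrite -(mulr0 (k * M)) -(mulr0 2) -(mulr0 increment_rate) -(mulr0 d%:R).
  by do 4 apply: cvgMr; exact: cvg_harmonic.
- by rewrite !mulr_ge0// addr_ge0// mulr_ge0// sqr_ge0.
- by move=> n m r n0 r0; exact: laplace_error.
Qed.

End statistic.

Unset Implicit Arguments.

Theorem theorem2p3 (R : realType) (d : nat) (hd : (2 <= d)%N)
    (disp0 : measure_display) (Omega0 : measurableType disp0)
    (P0 : probability Omega0 R) (X : {RV P0 >-> d.-tuple R})
    (C : d.-tuple R -> R)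
    (hF : forall j : 'I_d, continuous (marginal_cdf X j))
    (hC : is_copula_of X C)
    (hdC : forall j : 'I_d, has_continuous_partial C j)
    (disp : measure_display) (Omega : measurableType disp)
    (P : probability Omega R) (Xs : nat -> {RV P >-> d.-tuple R})
    (hXs_law : forall i, same_distribution (Xs i) X)
    (hXs_ind : mutually_independent P (fun i t => Xs i t))
    (dispB : measure_display) (OmegaB : measurableType dispB)
    (PB : probability OmegaB R) (B : OmegaB -> d.-tuple R -> R)
    (hB : tied_down_brownian_bridge PB B)
    (w : d.-tuple R -> R)
    (hw_bounded : [bounded w u | u in @unit_cube R d])
    (hw_ge0 : forall u, @unit_cube R d u -> 0 <= w u)
    (hw_int : lebesgue_integrable (@unit_cube R d) w)
    (hX_ind : mutually_independent P0 (fun (j : 'I_d) t => tnth (X t) j)) :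
  cvg_in_distribution P PB
    (fun n t => independence_statistic w (fun i : 'I_n => Xs i t))
    (fun t => limit_statistic w (B t)).
Proof.
have [M [w' [bw w'M w'0 wE]]] := borel_weight hw_bounded hw_ge0 hw_int.
have ZE t : limit_statistic w (B t) = weighted_square w' (limit_process (B t)).
  by rewrite /limit_statistic wE// => u; exact: sqr_ge0.
have -> : (fun t => limit_statistic w (B t)) =
    (fun t => weighted_square w' (limit_process (B t))) by exact/funext.
have -> : (fun n t => independence_statistic w (fun i : 'I_n => Xs i t)) = statistic Xs w'.
  by apply/funext => n; apply/funext => t; exact: (independence_statisticE Xs bw w'0).
apply: laplace_cvg_in_distribution.
- by move=> n; case: (bm_statistic Xs bw n).
- exact: (measurable_weighted_square_bridge hB w'M w'0).
- by move=> n t; exact: (weighted_square_ge0 w'M).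
- by move=> t; exact: (weighted_square_ge0 w'M).
- by move=> k; apply: (statistic_laplace hF hX_ind hXs_law hXs_ind bw w'M w'0 hB).
Qed.
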